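(* Let $\Gamma_g$ be the fundamental group of the closed orientable surface of genus $g\ge2$, with a fixed finite generating set. There is a constant $C$ such that for every nontrivial $w\in\Gamma_g$ represented by a word of length $n$ there exists a normal subgroup of $\Gamma_g$ of index at most $C n^3$ which does not contain $w$.
   Context: The constant $C$ depends only on the group $\Gamma_g$ with its generating set, not on $w$ or $n$. *)

(* Defs.v *)
From HB Require Import structures.
From Stdlib Require Import Relations.
From mathcomp Require Import all_boot all_order all_algebra generic_quotient.
From mathcomp Require Import all_classical all_reals.
From mathcomp Require Import topology normedtype trigo.
From mathcomp Require Import ring lra.

Set Implicit Arguments.
Unset Strict Implicit.
Unset Printing Implicit Defensive.

Import Order.TTheory GRing.Theory Num.Theory.
Import numFieldNormedType.Exports.

Local Open Scope classical_set_scope.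
Local Open Scope ring_scope.
Local Open Scope quotient_scope.

(* Loops are total functions on [R] of which only the restriction to [0, 1]
   matters; two loops that agree on [0, 1] are homotopic. *)
Record loop (R : realType) (T : topologicalType) (x : T) := Loop {
  loop_fun :> R -> T;
  loop_cont : {within `[0, 1], continuous loop_fun};
  loop0 : loop_fun 0 = x;
  loop1 : loop_fun 1 = x
}.
Arguments loop R {T} x.

HB.instance Definition _ (R : realType) (T : topologicalType) (x : T) :=
  gen_eqMixin (loop R x).
HB.instance Definition _ (R : realType) (T : topologicalType) (x : T) :=
  gen_choiceMixin (loop R x).

(* In [H (s, t)] the first coordinate is the deformation parameter. *)
Definition homotopic (R : realType) (T : topologicalType) (x : T)
    (f g : loop R x) : Prop :=
  exists H : R * R -> T,
    [/\ {within `[0, 1] `*` `[0, 1], continuous H},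
        forall t, t \in `[0, 1] -> H (0, t) = f t,
        forall t, t \in `[0, 1] -> H (1, t) = g t &
        forall s, s \in `[0, 1] -> H (s, 0) = x /\ H (s, 1) = x].

Section Pasting.
Context {R : realType}.

Lemma continuous_within_comp (X Y Z : topologicalType) (A : set Y)
    (f : Y -> Z) (p : X -> Y) :
  {within A, continuous f} -> continuous p -> (forall x, A (p x)) ->
  continuous (f \o p).
Proof.
move=> /subspace_continuousP fA cp Ap x.
apply: (@cvg_trans _ (f @ within A (nbhs (p x)))); last exact: fA.
move=> U /= nU; have := cp x _ nU; rewrite /nbhs /=.
by apply: filterS => y; apply; exact: Ap.
Qed.

Lemma continuous_compT (X Y Z : topologicalType) (f : X -> Y) (h : Y -> Z) :
  continuous f -> continuous h -> continuous (fun y => h (f y)).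
Proof.
by move=> cf ch y; apply: (@continuous_comp _ _ _ f h); [exact: cf|exact: ch].
Qed.

Lemma continuous_pair (X Y Z : topologicalType) (f : X -> Y) (h : X -> Z) :
  continuous f -> continuous h -> continuous (fun y => (f y, h y)).
Proof.
by move=> cf ch y; apply: cvg_pair; [exact: cf|exact: ch].
Qed.

Lemma continuous_fst (X Y : topologicalType) : continuous (fun p : X * Y => p.1).
Proof. by move=> p; exact: cvg_fst. Qed.

Lemma continuous_snd (X Y : topologicalType) : continuous (fun p : X * Y => p.2).
Proof. by move=> p; exact: cvg_snd. Qed.

Lemma continuous_within_eq (X T : topologicalType) (A : set X) (f g : X -> T) :
  continuous f -> (forall y, A y -> f y = g y) -> {within A, continuous g}.
Proof.
move=> cf fg; apply: (@subspace_eq_continuous _ A _ f).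
  by move=> y /set_mem; exact: fg.
exact: continuous_subspaceT.
Qed.

Lemma continuous_paste (X T : topologicalType) (u : X -> R) (a b : X -> T) :
  continuous u -> continuous a -> continuous b ->
  (forall x, u x = 2^-1 -> a x = b x) ->
  continuous (fun x => if u x <= 2^-1 then a x else b x).
Proof.
move=> cu ca cb ab.
pose A := u @^-1` [set y | y <= 2^-1]; pose B := u @^-1` [set y | 2^-1 <= y].
have cA : closed A by apply: closed_comp => [y _|]; [exact: cu|exact: closed_le].
have cB : closed B by apply: closed_comp => [y _|]; [exact: cu|exact: closed_ge].
have ABT : A `|` B = setT.
  by apply/seteqP; split => // y _; rewrite /A /B /=; case: (leP (u y) 2^-1);
    [left|move=> /ltW; right].
apply/continuous_subspace_setT; rewrite -ABT; apply: withinU_continuous => //.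
  by apply: (continuous_within_eq ca) => y; rewrite /A /= => ->.
apply: (continuous_within_eq cb) => y; rewrite /B /= => uy.
by case: ifP => // uy'; rewrite ab //; apply/le_anti; rewrite uy uy'.
Qed.

Lemma continuous_minr (X : topologicalType) (f g : X -> R) :
  continuous f -> continuous g -> continuous (fun t => Num.min (f t) (g t)).
Proof. by move=> cf cg t; apply: (@continuous_min R X f g); [exact: cf|exact: cg]. Qed.

Lemma continuous_maxr (X : topologicalType) (f g : X -> R) :
  continuous f -> continuous g -> continuous (fun t => Num.max (f t) (g t)).
Proof. by move=> cf cg t; apply: (@continuous_max R X f g); [exact: cf|exact: cg]. Qed.

Lemma continuous_affine (a b : R) : continuous (fun t => a * t + b).
Proof.
move=> t; apply: continuousD; last exact: cvg_cst.
by apply: continuousM; [exact: cvg_cst|exact: cvg_id].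
Qed.

Lemma continuous_addr (X : topologicalType) (f g : X -> R) :
  continuous f -> continuous g -> continuous (fun t => f t + g t).
Proof.
by move=> cf cg t; apply: (@continuousD R R X f g); [exact: cf|exact: cg].
Qed.

Lemma continuous_subr (X : topologicalType) (f g : X -> R) :
  continuous f -> continuous g -> continuous (fun t => f t - g t).
Proof.
by move=> cf cg t; apply: (@continuousB R R X f g); [exact: cf|exact: cg].
Qed.

Lemma continuous_mulr (X : topologicalType) (f g : X -> R) :
  continuous f -> continuous g -> continuous (fun t => f t * g t).
Proof.
by move=> cf cg t; apply: (@continuousM R X f g); [exact: cf|exact: cg].
Qed.

Definition clamp (t : R) : R := Num.max 0 (Num.min t 1).

Lemma clamp_itv t : clamp t \in `[0, 1].
Proof.
rewrite in_itv /= /clamp le_max lexx /= ge_max ler01 /= ge_min lexx orbT //.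
Qed.

Lemma clamp_id t : t \in `[0, 1] -> clamp t = t.
Proof.
by rewrite in_itv /= /clamp => /andP[t0 t1]; rewrite min_l // max_r.
Qed.

Lemma clamp_continuous : continuous clamp.
Proof.
apply: continuous_maxr; first by move=> t; exact: cvg_cst.
by apply: continuous_minr => t; [exact: cvg_id|exact: cvg_cst].
Qed.

Lemma clamp_low t : t <= 0 -> clamp t = 0.
Proof. by move=> t0; rewrite /clamp max_l // ge_min t0. Qed.

Lemma clamp_high t : 1 <= t -> clamp t = 1.
Proof. by move=> t1; rewrite /clamp min_r // max_r. Qed.

End Pasting.

Section Loops.
Context {R : realType} {T : topologicalType} (x : T).
Implicit Types f g h : loop R x.

Lemma loop_clamp_continuous f : continuous (f \o clamp).
Proof.
apply: continuous_within_comp; [exact: loop_cont|exact: clamp_continuous|].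
by move=> t; exact: clamp_itv.
Qed.

Lemma loop_clamp_comp f (X : topologicalType) (p : X -> R) :
  continuous p -> continuous (fun y => f (clamp (p y))).
Proof.
move=> cp y; apply: (@continuous_comp _ _ _ p (f \o clamp)); first exact: cp.
exact: loop_clamp_continuous.
Qed.

Definition cst_loop : loop R x :=
  @Loop R T x (cst x) (continuous_subspaceT (@cst_continuous _ _ x))
    erefl erefl.

Lemma rev_loop_subproof f :
  {within `[0, 1], continuous (fun t => f (1 - t))}.
Proof.
apply: (@continuous_within_eq R T _ (fun t => f (clamp (1 - t)))); last first.
  move=> t /= t01; rewrite clamp_id //.
  by move: t01; rewrite !in_itv /=; lra.
apply: loop_clamp_comp => t.
by apply: continuousB; [exact: cvg_cst|exact: cvg_id].
Qed.

Definition rev_loop f : loop R x :=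
  @Loop R T x (fun t => f (1 - t)) (@rev_loop_subproof f)
    (etrans (congr1 f (subr0 1)) (loop1 f))
    (etrans (congr1 f (subrr 1)) (loop0 f)).

Definition concat_fun f g (t : R) : T :=
  if t <= 2^-1 then f (2 * t) else g (2 * t - 1).

Lemma concat_clampE f g t : t \in `[0, 1] ->
  concat_fun f g t =
  if t <= 2^-1 then f (clamp (2 * t)) else g (clamp (2 * t - 1)).
Proof.
rewrite in_itv /= /concat_fun => /andP[t0 t1].
by case: ifPn => t2; rewrite clamp_id // in_itv /=; move: t2; rewrite -?ltNge;
  lra.
Qed.

Lemma concat_loop_subproof f g : {within `[0, 1], continuous (concat_fun f g)}.
Proof.
apply: (@continuous_within_eq R T _ (fun t =>
  if t <= 2^-1 then f (clamp (2 * t)) else g (clamp (2 * t - 1)))); last first.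
  by move=> t /= /concat_clampE ->.
apply: continuous_paste.
- by move=> t; exact: cvg_id.
- by apply: loop_clamp_comp => t; exact: mulrl_continuous.
- by apply: loop_clamp_comp; exact: continuous_affine.
move=> t ->; rewrite divff ?pnatr_eq0 // subrr clamp_high // clamp_low //.
by rewrite loop1 loop0.
Qed.

Lemma concat_loop0 f g : concat_fun f g 0 = x.
Proof. by rewrite /concat_fun invr_ge0 ler0n mulr0 loop0. Qed.

Lemma concat_loop1 f g : concat_fun f g 1 = x.
Proof.
rewrite /concat_fun ifF; last by apply/negbTE; rewrite -ltNge; lra.
by rewrite (_ : 2 * 1 - 1 = 1) ?loop1 //; ring.
Qed.

Definition concat_loop f g : loop R x :=
  Loop (@concat_loop_subproof f g) (concat_loop0 f g) (concat_loop1 f g).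

Lemma homotopicT f g (H : R * R -> T) : continuous H ->
  (forall t, t \in `[0, 1] -> H (0, t) = f t) ->
  (forall t, t \in `[0, 1] -> H (1, t) = g t) ->
  (forall s, s \in `[0, 1] -> H (s, 0) = x /\ H (s, 1) = x) ->
  homotopic f g.
Proof. by move=> cH *; exists H; split => //; exact: continuous_subspaceT. Qed.

Lemma homotopic_clamp f g : homotopic f g -> exists H : R * R -> T,
  [/\ continuous H,
      forall t, H (0, t) = f (clamp t),
      forall t, H (1, t) = g (clamp t) &
      forall s, H (s, 0) = x /\ H (s, 1) = x].
Proof.
move=> [H [cH H0 H1 Hx]]; exists (H \o fun p => (clamp p.1, clamp p.2)); split.
- apply: continuous_within_comp; first exact: cH.
    by apply: continuous_pair; apply: continuous_compT;
      [exact: continuous_fst|exact: clamp_continuous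
      |exact: continuous_snd|exact: clamp_continuous].
  by move=> p; split; exact: clamp_itv.
- by move=> t /=; rewrite clamp_low // H0 // clamp_itv.
- by move=> t /=; rewrite clamp_high // H1 // clamp_itv.
- move=> s /=; rewrite (clamp_low (lexx 0)) (clamp_high (lexx 1)).
  by apply: Hx; exact: clamp_itv.
Qed.

Lemma homotopic_reparam f g h (p q : R -> R) :
  continuous p -> continuous q ->
  (forall t, t \in `[0, 1] -> p t \in `[0, 1]) ->
  (forall t, t \in `[0, 1] -> q t \in `[0, 1]) ->
  p 0 = q 0 -> p 1 = q 1 ->
  (forall t, t \in `[0, 1] -> f t = h (p t)) ->
  (forall t, t \in `[0, 1] -> g t = h (q t)) ->
  homotopic f g.
Proof.
move=> cp cq p01 q01 pq0 pq1 fE gE.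
apply: (@homotopicT _ _
  (fun y => h (clamp (p y.2 + y.1 * (q y.2 - p y.2))))).
- apply: loop_clamp_comp.
  have c2 (r : R -> R) : continuous r -> continuous (fun y : R * R => r y.2).
    by move=> cr; apply: continuous_compT; first exact: continuous_snd.
  apply: continuous_addr; first exact: c2.
  apply: continuous_mulr; first exact: continuous_fst.
  by apply: continuous_subr; exact: c2.
- by move=> t t01; rewrite /= mul0r addr0 clamp_id ?p01 // fE.
- by move=> t t01; rewrite /= mul1r addrC subrK clamp_id ?q01 // gE.
move=> s _ /=; have i0 : (0 : R) \in `[0, 1] by rewrite in_itv /= lexx ler01.
have i1 : (1 : R) \in `[0, 1] by rewrite in_itv /= lexx ler01.
rewrite -pq0 -pq1 !subrr !mulr0 !addr0 !clamp_id ?p01 //.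
by rewrite -!fE // loop0 loop1.
Qed.

Lemma homotopic_refl f : homotopic f f.
Proof.
apply: (@homotopic_reparam f f f id id) => //; by move=> t; exact: cvg_id.
Qed.

Lemma homotopic_sym f g : homotopic f g -> homotopic g f.
Proof.
move=> /homotopic_clamp[H [cH H0 H1 Hx]].
apply: (@homotopicT _ _ (fun y => H (1 - y.1, y.2))).
- apply: continuous_compT; last exact: cH.
  apply: continuous_pair; last exact: continuous_snd.
  apply: continuous_subr; last exact: continuous_fst.
  by move=> y; exact: cvg_cst.
- by move=> t t01; rewrite /= subr0 H1 clamp_id.
- by move=> t t01; rewrite /= subrr H0 clamp_id.
- by move=> s _; exact: Hx.
Qed.

Lemma homotopic_trans f g h :
  homotopic f g -> homotopic g h -> homotopic f h.
Proof.
move=> /homotopic_clamp[H [cH H0 H1 Hx]] /homotopic_clamp[K [cK K0 K1 Kx]].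
have aff (c : R) : continuous (fun y : R * R => (2 * y.1 - c, y.2)).
  apply: continuous_pair; last exact: continuous_snd.
  have := @continuous_affine R 2 (- c).
  by apply: continuous_compT; exact: continuous_fst.
apply: (@homotopicT _ _ (fun y => if y.1 <= 2^-1 then H (2 * y.1 - 0, y.2)
                                  else K (2 * y.1 - 1, y.2))).
- apply: continuous_paste.
  + by move=> y; exact: cvg_fst.
  + by apply: continuous_compT; [exact: aff|exact: cH].
  + by apply: continuous_compT; [exact: aff|exact: cK].
  by move=> y ->; rewrite divff ?pnatr_eq0 // subr0 subrr H1 K0.
- by move=> t t01; rewrite /= invr_ge0 ler0n mulr0 subr0 H0 clamp_id.
- move=> t t01; rewrite /= ifF; last by apply/negbTE; rewrite -ltNge; lra.
  by rewrite (_ : 2 * 1 - 1 = 1) ?K1 ?clamp_id //; ring.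
- by move=> s _ /=; case: ifP => _; [exact: Hx|exact: Kx].
Qed.

Lemma homotopic_concat f f' g g' : homotopic f f' -> homotopic g g' ->
  homotopic (concat_loop f g) (concat_loop f' g').
Proof.
move=> /homotopic_clamp[H [cH H0 H1 Hx]] /homotopic_clamp[K [cK K0 K1 Kx]].
have aff (c : R) : continuous (fun y : R * R => (y.1, 2 * y.2 - c)).
  apply: continuous_pair; first exact: continuous_fst.
  have := @continuous_affine R 2 (- c).
  by apply: continuous_compT; exact: continuous_snd.
apply: (@homotopicT _ _ (fun y => if y.2 <= 2^-1 then H (y.1, 2 * y.2 - 0)
                                  else K (y.1, 2 * y.2 - 1))).
- apply: continuous_paste.
  + by move=> y; exact: cvg_snd.
  + by apply: continuous_compT; [exact: aff|exact: cH].
  + by apply: continuous_compT; [exact: aff|exact: cK].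
  move=> y ->; rewrite divff ?pnatr_eq0 // subr0 subrr.
  by rewrite (Hx _).2 (Kx _).1.
- by move=> t t01; rewrite /= concat_clampE // subr0 H0 K0.
- by move=> t t01; rewrite /= concat_clampE // subr0 H1 K1.
- move=> s _ /=; rewrite invr_ge0 ler0n mulr0 subr0 (Hx _).1; split=> //.
  rewrite ifF; last by apply/negbTE; rewrite -ltNge; lra.
  by rewrite (_ : 2 * 1 - 1 = 1) ?(Kx _).2 //; ring.
Qed.

Lemma homotopic_rev f g : homotopic f g ->
  homotopic (rev_loop f) (rev_loop g).
Proof.
move=> /homotopic_clamp[H [cH H0 H1 Hx]].
have r01 (t : R) : t \in `[0, 1] -> 1 - t \in `[0, 1].
  by rewrite !in_itv /=; lra.
apply: (@homotopicT _ _ (fun y => H (y.1, 1 - y.2))).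
- apply: continuous_compT; last exact: cH.
  apply: continuous_pair; first exact: continuous_fst.
  apply: continuous_subr; last exact: continuous_snd.
  by move=> y; exact: cvg_cst.
- by move=> t t01; rewrite /= H0 clamp_id // r01.
- by move=> t t01; rewrite /= H1 clamp_id // r01.
- by move=> s _ /=; rewrite subr0 subrr; have [-> ->] := Hx s.
Qed.

Lemma homotopic_concat1l f : homotopic (concat_loop cst_loop f) f.
Proof.
apply: (@homotopic_reparam _ _ f (fun t => Num.max 0 (2 * t - 1)) id).
- apply: continuous_maxr; first by move=> t; exact: cvg_cst.
  exact: continuous_affine.
- by move=> t; exact: cvg_id.
- by move=> t; rewrite !in_itv /= => ?; case: (leP 0 (2 * t - 1)); lra.
- by [].
- by case: leP; lra.
- by case: leP; lra.
- move=> t t01; rewrite /= /concat_fun /= /cst.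
  case: ifPn => t2; first by rewrite max_l ?loop0 //; lra.
  by rewrite max_r //; move: t2; rewrite -ltNge; lra.
- by [].
Qed.

Lemma homotopic_concat1r f : homotopic (concat_loop f cst_loop) f.
Proof.
apply: (@homotopic_reparam _ _ f (fun t => Num.min (2 * t) 1) id).
- apply: continuous_minr; last by move=> t; exact: cvg_cst.
  by move=> t; exact: mulrl_continuous.
- by move=> t; exact: cvg_id.
- by move=> t; rewrite !in_itv /= => ?; case: (leP (2 * t) 1); lra.
- by [].
- by case: leP; lra.
- by case: leP; lra.
- move=> t t01; rewrite /= /concat_fun /= /cst.
  case: ifPn => t2; first by rewrite min_l //; lra.
  by rewrite min_r ?loop1 //; move: t2; rewrite -ltNge; lra.
- by [].
Qed.

Lemma homotopic_concatVr f : homotopic (concat_loop f (rev_loop f)) cst_loop.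
Proof.
apply: (@homotopic_reparam _ _ f (fun t => Num.min (2 * t) (2 - 2 * t)) (cst 0)).
- apply: continuous_minr; first by move=> t; exact: mulrl_continuous.
  apply: continuous_subr; first by move=> t; exact: cvg_cst.
  by move=> t; exact: mulrl_continuous.
- by move=> t; exact: cvg_cst.
- by move=> t; rewrite !in_itv /= => ?; case: (leP (2 * t) (2 - 2 * t)); lra.
- by move=> t _; rewrite in_itv /= lexx ler01.
- by rewrite /cst; case: leP; lra.
- by rewrite /cst; case: leP; lra.
- move=> t t01; rewrite /= /concat_fun /=.
  case: ifPn => t2; first by rewrite min_l //; lra.
  rewrite min_r; last by move: t2; rewrite -ltNge; lra.
  by congr (f _); ring.
- by move=> t _; rewrite /= /cst loop0.
Qed.

Lemma homotopic_concatVl f : homotopic (concat_loop (rev_loop f) f) cst_loop.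
Proof.
apply: (@homotopic_reparam _ _ f (fun t => Num.max (1 - 2 * t) (2 * t - 1))
  (cst 1)).
- apply: continuous_maxr; apply: continuous_subr => t;
    by [exact: cvg_cst|exact: mulrl_continuous].
- by move=> t; exact: cvg_cst.
- by move=> t; rewrite !in_itv /= => ?; case: (leP (1 - 2 * t) (2 * t - 1)); lra.
- by move=> t _; rewrite in_itv /= lexx ler01.
- by rewrite /cst; case: leP; lra.
- by rewrite /cst; case: leP; lra.
- move=> t t01; rewrite /= /concat_fun /=.
  case: ifPn => t2; first by rewrite max_l //; lra.
  by rewrite max_r //; move: t2; rewrite -ltNge; lra.
- by move=> t _; rewrite /= /cst loop1.
Qed.

Lemma homotopic_concatA f g h :
  homotopic (concat_loop f (concat_loop g h)) (concat_loop (concat_loop f g) h).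
Proof.
apply: homotopic_sym.
apply: (@homotopic_reparam _ _ (concat_loop f (concat_loop g h))
  (fun t => Num.min (Num.min (2 * t) (t + 4^-1)) (2^-1 * (t + 1))) id).
- apply: continuous_minr; first apply: continuous_minr.
  + by move=> t; exact: mulrl_continuous.
  + by apply: continuous_addr => t; [exact: cvg_id|exact: cvg_cst].
  apply: continuous_mulr; first by move=> t; exact: cvg_cst.
  by apply: continuous_addr => t; [exact: cvg_id|exact: cvg_cst].
- by move=> t; exact: cvg_id.
- by move=> t; rewrite !in_itv /= => ?; case: (leP (2 * t) (t + 4^-1)) => ?;
  [case: (leP (2 * t) (2^-1 * (t + 1)))|case: (leP (t + 4^-1) (2^-1 * (t + 1)))];
  lra.
- by [].
- by case: (leP (2 * 0)) => ?; case: leP; lra.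
- by case: (leP (2 * 1)) => ?; case: leP; lra.
- move=> t; rewrite in_itv /= => /andP[t0 t1].
  rewrite /concat_fun /= /concat_fun.
  have [t2|t2] := leP t 2^-1.
    have [t4|t4] := leP (2 * t) 2^-1.
      rewrite (min_l (x := 2 * t)); last lra.
      by rewrite min_l ?ifT //; lra.
    rewrite (min_r (x := 2 * t)); last lra.
    rewrite min_l; last lra.
    rewrite ifF; last by apply/negbTE; rewrite -ltNge; lra.
    by rewrite ifT; [congr (g _); field|lra].
  rewrite (min_r (x := 2 * t)); last lra.
  rewrite min_r; last lra.
  rewrite ifF; last by apply/negbTE; rewrite -ltNge; lra.
  rewrite ifF; last by apply/negbTE; rewrite -ltNge; lra.
  by congr (h _); field.
- by [].
Qed.

Definition homotopicb f g : bool := `[< homotopic f g >].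

Lemma homotopicb_refl : reflexive homotopicb.
Proof. by move=> f; apply/asboolP; exact: homotopic_refl. Qed.

Lemma homotopicb_sym : symmetric homotopicb.
Proof.
by move=> f g; apply/asboolP/asboolP; exact: homotopic_sym.
Qed.

Lemma homotopicb_trans : transitive homotopicb.
Proof.
by move=> g f h /asboolP fg /asboolP gh; apply/asboolP; exact: homotopic_trans gh.
Qed.

Canonical homotopic_equiv :=
  EquivRel homotopicb homotopicb_refl homotopicb_sym homotopicb_trans.

End Loops.

Definition pi1 (R : realType) (T : topologicalType) (x : T) : Type :=
  {eq_quot @homotopic_equiv R T x}.
Arguments pi1 R {T} x.

HB.instance Definition _ (R : realType) (T : topologicalType) (x : T) :=
  EqQuotient.copy (pi1 R x) {eq_quot @homotopic_equiv R T x}.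
HB.instance Definition _ (R : realType) (T : topologicalType) (x : T) :=
  Choice.copy (pi1 R x) {eq_quot @homotopic_equiv R T x}.

Definition loop_class (R : realType) (T : topologicalType) (x : T)
  (f : loop R x) : pi1 R x := \pi_(pi1 R x) f.

Section FundamentalGroup.
Context {R : realType} {T : topologicalType} (x : T).
Implicit Types (f g : loop R x) (u v : pi1 R x).

Definition pi1_one : pi1 R x := loop_class (cst_loop x).
Definition pi1_mul u v : pi1 R x := loop_class (concat_loop (repr u) (repr v)).
Definition pi1_inv u : pi1 R x := loop_class (rev_loop (repr u)).

Lemma loop_classP f g : loop_class f = loop_class g <-> homotopic f g.
Proof.
split=> [/eqmodP/asboolP //|fg]; apply/eqmodP; exact/asboolP.
Qed.

Lemma loop_class_repr u : loop_class (repr u) = u.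
Proof. exact: reprK. Qed.

Lemma repr_loop_class f : homotopic (repr (loop_class f)) f.
Proof. by apply/loop_classP; rewrite loop_class_repr. Qed.

Lemma pi1_mulE f g :
  pi1_mul (loop_class f) (loop_class g) = loop_class (concat_loop f g).
Proof. by apply/loop_classP/homotopic_concat; exact: repr_loop_class. Qed.

Lemma pi1_invE f : pi1_inv (loop_class f) = loop_class (rev_loop f).
Proof. by apply/loop_classP/homotopic_rev; exact: repr_loop_class. Qed.

Lemma pi1_mulA : associative pi1_mul.
Proof.
move=> u v w; rewrite -[u]loop_class_repr -[v]loop_class_repr.
rewrite -[w]loop_class_repr !pi1_mulE; apply/loop_classP.
exact: homotopic_concatA.
Qed.

Lemma pi1_mul1g : left_id pi1_one pi1_mul.
Proof.
move=> u; rewrite -[u]loop_class_repr pi1_mulE; apply/loop_classP.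
exact: homotopic_concat1l.
Qed.

Lemma pi1_mulg1 : right_id pi1_one pi1_mul.
Proof.
move=> u; rewrite -[u]loop_class_repr pi1_mulE; apply/loop_classP.
exact: homotopic_concat1r.
Qed.

Lemma pi1_mulVg : left_inverse pi1_one pi1_inv pi1_mul.
Proof.
move=> u; rewrite -[u]loop_class_repr pi1_invE pi1_mulE; apply/loop_classP.
exact: homotopic_concatVl.
Qed.

Lemma pi1_mulgV : right_inverse pi1_one pi1_inv pi1_mul.
Proof.
move=> u; rewrite -[u]loop_class_repr pi1_invE pi1_mulE; apply/loop_classP.
exact: homotopic_concatVr.
Qed.

HB.instance Definition _ := isGroup.Build (pi1 R x)
  pi1_mulA pi1_mul1g pi1_mulg1 pi1_mulVg pi1_mulgV.

End FundamentalGroup.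

(* The standard model of the closed orientable surface of genus [g]: the closed
   unit disc, regarded as a polygon with [4 * g] sides ([g > 0]), which are glued
   according to the word a_1 b_1 a_1^-1 b_1^-1 ... a_g b_g a_g^-1 b_g^-1. *)
Section Surface.
Context (R : realType) (g : nat).

Definition disc : set (R * R) := [set p | p.1 ^+ 2 + p.2 ^+ 2 <= 1].

(* The angle of the point with parameter [t] in [0, 1] on the [j]-th side, the
   sides being numbered from 0 and traversed counterclockwise. *)
Definition side_angle (j : nat) (t : R) : R :=
  2 * pi * ((j%:R + t) / (4 * g)%:R).

Lemma side_subproof (j : nat) (t : R) :
  (cos (side_angle j t), sin (side_angle j t)) \in disc.
Proof. by apply/mem_set; rewrite /disc /= cos2Dsin2. Qed.

Definition side (j : nat) (t : R) : disc :=
  exist (fun p => p \in disc) _ (side_subproof j t).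

(* The sides [4k], ..., [4k + 3] carry the labels a, b, a^-1, b^-1: side [4k]
   is glued to side [4k + 2], and side [4k + 1] to side [4k + 3], with the
   orientation reversed. *)
Inductive glued : disc -> disc -> Prop :=
| Glued_a (k : 'I_g) (t : R) : t \in `[0, 1] ->
    glued (side (4 * k) t) (side (4 * k + 2) (1 - t))
| Glued_b (k : 'I_g) (t : R) : t \in `[0, 1] ->
    glued (side (4 * k + 1) t) (side (4 * k + 3) (1 - t)).

Definition gluing (p q : disc) : bool :=
  `[< clos_refl_sym_trans disc glued p q >].

Lemma gluing_refl : reflexive gluing.
Proof. by move=> p; apply/asboolP; exact: rst_refl. Qed.

Lemma gluing_sym : symmetric gluing.
Proof. by move=> p q; apply/asboolP/asboolP; exact: rst_sym. Qed.

Lemma gluing_trans : transitive gluing.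
Proof.
by move=> q p r /asboolP pq /asboolP qr; apply/asboolP; exact: rst_trans qr.
Qed.

Canonical gluing_equiv := EquivRel gluing gluing_refl gluing_sym gluing_trans.

Definition surface : topologicalType := quotient_topology {eq_quot gluing_equiv}.

End Surface.

Section GroupNotions.
Context {G : groupType}.

(* A word is a finite sequence of generators and inverses of generators; its
   length is its size, with no reduction. *)
Definition word_over (S : seq G) (s : seq G) : bool :=
  all (fun y => (y \in S) || (y^-1%g \in S)) s.

Definition represents (s : seq G) (w : G) : Prop :=
  \big[*%g/1%g]_(y <- s) y = w.

Definition generates (S : seq G) : Prop :=
  forall w : G, exists2 s, word_over S s & represents s w.

Definition normal_subgroup (N : {pred G}) : Prop :=
  group_closed N /\ forall y z : G, y \in N -> (y ^ z)%g \in N.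

Definition lcoset_of (N : {pred G}) (y : G) : set G :=
  [set z | (y^-1 * z)%g \in N].

Definition index_at_most (N : {pred G}) (m : nat) : Prop :=
  (range (lcoset_of N) #<= `I_m)%card.

End GroupNotions.

(* Main.v *)
(* Cut the surface along the cones around the sides and vertices of the polygon.
   Each chart contracts onto its centre in a way compatible with the gluing, so
   every loop is a product of loops that cross one side, and these generate; a
   consistent labelling of the vertices and middles of the sides by elements of
   a group H is a covering with structure group H, whose monodromy gives the
   universal property.  Hence pi_1 has the standard presentation.  A cyclic cover
   embeds Gamma_g into Gamma_2, which is the amalgam of two free groups of rank 2
   over the group of the boundary curve c.  The once-punctured torus group in
   SL_2(Z), conjugated in the second factor by the unipotent matrix with entry X
   that commutes with c, gives a faithful representation of Gamma_2 in
   SL_2(Z[X]): the degree in X grows along alternating products.  A word of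
   length n goes to a matrix with entries of degree O(n) and coefficients
   e^{O(n)}, so by Chebyshev some prime p = O(n) exceeds the degree of a nonzero
   entry P of the difference with the identity without dividing its leading
   coefficient, and P does not vanish at some point of F_p.  The word survives
   in SL_2(F_p), which has at most p^3 elements. *)

Require Import Defs.
From HB Require Import structures.
From Stdlib Require Import Relations.
From mathcomp Require Import all_boot all_order all_algebra generic_quotient.
From mathcomp Require Import all_classical all_reals.
From mathcomp Require Import topology normedtype realfun trigo.
From mathcomp Require Import zify ring lra.

Set Implicit Arguments.
Unset Strict Implicit.
Unset Printing Implicit Defensive.
Import Order.TTheory GRing.Theory Num.Theory.
Import numFieldNormedType.Exports.

(** * Path homotopies *)

(** The delicate point of the representation is that the powers of c are exactly the elements of the
    punctured torus group that fix the cusp at infinity. An element of a factor outside the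
    amalgamated subgroup therefore has a nonzero lower left entry, and this entry carries the
    leading term when the factors are separated by unipotents with entry X or -X. The commutator c
    is minus a unipotent matrix, hence commutes with the twist. Normal forms in the amalgam are only
    shown to exist; the degree then shows that an alternating product is nontrivial. The exponent 3
    comes from the size of p. A nonzero polynomial over F_p such as X^p - X may vanish at every
    point of F_p, so p has to exceed the degree, which is linear in n; on the other side the
    coefficients are only exponential in n, so linear size is also enough to avoid the divisors of
    the leading coefficient. The generating set enters only through one constant K that bounds the
    entries of the generators and of their inverses. *)

Section Paths.
Local Open Scope classical_set_scope.
Local Open Scope ring_scope.
Context {R : realType} {T : topologicalType}.
Implicit Types (f g h k l m : R -> T) (p q r : T).

(** Continuity is required on the whole line, so that composition with reparametrizations avoids the
    subspace topology; a [loop] is brought to this form by composing it with [clamp]. *)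
Definition path_from_to f p q := [/\ continuous f, f 0 = p & f 1 = q].

Definition path_homotopic f g := exists H : R * R -> T,
  [/\ continuous H,
      forall t, t \in `[0, 1] -> H (0, t) = f t,
      forall t, t \in `[0, 1] -> H (1, t) = g t &
      forall s, H (s, 0) = f 0 /\ H (s, 1) = f 1].

Definition path_cat f g (t : R) : T :=
  if t <= 2^-1 then f (2 * t) else g (2 * t - 1).

Definition path_rev f (t : R) : T := f (1 - t).

Lemma continuous_paste_at (X : topologicalType) (c : R) (u : X -> R)
    (a b : X -> T) :
  continuous u -> continuous a -> continuous b ->
  (forall y, u y = c -> a y = b y) ->
  continuous (fun y => if u y <= c then a y else b y).
Proof.
move=> cu ca cb ab.
have -> : (fun y => if u y <= c then a y else b y) =
          (fun y => if u y - (c - 2^-1) <= 2^-1 then a y else b y).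
  by apply/funext => y; congr (if _ then _ else _); apply/idP/idP; lra.
apply: continuous_paste => //.
  by apply: continuous_subr => // y; exact: cvg_cst.
by move=> y uy; apply: ab; lra.
Qed.

Lemma path_catP f g p q r :
  path_from_to f p q -> path_from_to g q r -> path_from_to (path_cat f g) p r.
Proof.
move=> [cf f0 f1] [cg g0 g1]; split.
- apply: continuous_paste_at.
  + by move=> t; exact: cvg_id.
  + by apply: continuous_compT cf => t; exact: mulrl_continuous.
  + by apply: continuous_compT cg; exact: continuous_affine.
  + by move=> t ->; rewrite divff ?pnatr_eq0// subrr f1 g0.
- by rewrite /path_cat invr_ge0 ler0n mulr0.
- rewrite /path_cat ifF; last by apply/negbTE; rewrite -ltNge; lra.
  by rewrite (_ : 2 * 1 - 1 = 1) //; ring.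
Qed.

Lemma path_revP f p q : path_from_to f p q -> path_from_to (path_rev f) q p.
Proof.
move=> [cf f0 f1]; split; rewrite /path_rev ?subr0 ?subrr//.
apply: continuous_compT cf; apply: continuous_subr => t.
  exact: cvg_cst.
exact: cvg_id.
Qed.

Lemma path_cstP p : path_from_to (cst p) p p.
Proof. by split => // t; exact: cvg_cst. Qed.

(* Any two paths with the same ends in the plane are joined by a straight-line
   homotopy, which is then pushed forward by [h]. *)
Lemma path_homotopic_plane (h : R * R -> T) (a b : R -> R * R) f g :
  continuous h -> continuous a -> continuous b ->
  a 0 = b 0 -> a 1 = b 1 ->
  (forall t, t \in `[0, 1] -> f t = h (a t)) ->
  (forall t, t \in `[0, 1] -> g t = h (b t)) ->
  path_homotopic f g.
Proof.
move=> ch ca cb ab0 ab1 fa gb.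
have i0 : (0 : R) \in `[0, 1] by rewrite in_itv /= lexx ler01.
have i1 : (1 : R) \in `[0, 1] by rewrite in_itv /= lexx ler01.
exists (fun y => h ((a y.2).1 + y.1 * ((b y.2).1 - (a y.2).1),
                    (a y.2).2 + y.1 * ((b y.2).2 - (a y.2).2))); split.
- have c1 (c : R -> R * R) : continuous c ->
      continuous (fun y : R * R => (c y.2).1).
    move=> cc; apply: (@continuous_compT _ _ _ (fun y => c y.2) fst).
      by apply: continuous_compT cc; exact: continuous_snd.
    exact: continuous_fst.
  have c2 (c : R -> R * R) : continuous c ->
      continuous (fun y : R * R => (c y.2).2).
    move=> cc; apply: (@continuous_compT _ _ _ (fun y => c y.2) snd).
      by apply: continuous_compT cc; exact: continuous_snd.
    exact: continuous_snd.
  apply: continuous_compT ch; apply: continuous_pair;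
    by apply: continuous_addr; [auto|apply: continuous_mulr;
      [exact: continuous_fst|apply: continuous_subr; auto]].
- by move=> t t01 /=; rewrite !mul0r !addr0 fa //; case: (a t).
- move=> t t01 /=; rewrite !mul1r ![_ + (_ - _)]addrC !subrK gb //.
  by case: (b t).
- move=> s /=; rewrite -ab0 -ab1 !subrr !mulr0 !addr0 !fa //.
  by split; [case: (a 0)|case: (a 1)].
Qed.

(** The groupoid laws for paths all reduce to this: both sides reparametrize a single map of the
    line. *)
Lemma path_homotopic_line h (a b : R -> R) f g :
  continuous h -> continuous a -> continuous b ->
  a 0 = b 0 -> a 1 = b 1 ->
  (forall t, t \in `[0, 1] -> f t = h (a t)) ->
  (forall t, t \in `[0, 1] -> g t = h (b t)) ->
  path_homotopic f g.
Proof.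
move=> ch ca cb ab0 ab1 fa gb.
apply: (@path_homotopic_plane (h \o fst) (fun t => (a t, 0)) (fun t => (b t, 0))).
- by apply: continuous_compT ch; exact: continuous_fst.
- by apply: continuous_pair => // t; exact: cvg_cst.
- by apply: continuous_pair => // t; exact: cvg_cst.
- by rewrite ab0.
- by rewrite ab1.
- exact: fa.
- exact: gb.
Qed.

Lemma path_homotopic_eq f g : continuous f ->
  (forall t, t \in `[0, 1] -> g t = f t) -> path_homotopic f g.
Proof.
by move=> cf fg; apply: (@path_homotopic_line f id id) => //;
  move=> t; exact: cvg_id.
Qed.

Lemma path_homotopic_refl f : continuous f -> path_homotopic f f.
Proof. by move=> cf; exact: path_homotopic_eq. Qed.

Lemma path_homotopic_ends f g : path_homotopic f g -> f 0 = g 0 /\ f 1 = g 1.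
Proof.
move=> [H [_ _ Hg He]]; have [<- <-] := He 1.
by rewrite !Hg // in_itv /= ?lexx ler01.
Qed.

Lemma path_homotopic_sym f g : path_homotopic f g -> path_homotopic g f.
Proof.
move=> fg; have [e0 e1] := path_homotopic_ends fg.
case: fg => H [cH Hf Hg He]; exists (fun y => H (1 - y.1, y.2)); split.
- apply: continuous_compT cH; apply: continuous_pair; last first.
    exact: continuous_snd.
  apply: continuous_subr; last exact: continuous_fst.
  by move=> y; exact: cvg_cst.
- by move=> t t01; rewrite /= subr0 Hg.
- by move=> t t01; rewrite /= subrr Hf.
- by move=> s; rewrite /= -e0 -e1; exact: He.
Qed.

Lemma path_homotopic_trans f g h :
  path_homotopic f g -> path_homotopic g h -> path_homotopic f h.
Proof.
move=> fg gh; have [e0 e1] := path_homotopic_ends fg.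
case: fg gh => H [cH Hf Hg He] [K [cK Kg Kh Ke]].
(* [H] at parameter 1 and [K] at parameter 0 both equal [g] only for times in [0, 1]; clamping the
   time makes the two halves agree everywhere. *)
have aff (c : R) : continuous (fun y : R * R => (2 * y.1 - c, clamp y.2)).
  apply: continuous_pair; last first.
    by apply: continuous_compT clamp_continuous; exact: continuous_snd.
  have := @continuous_affine R 2 (- c).
  by apply: continuous_compT; exact: continuous_fst.
exists (fun y => if y.1 <= 2^-1 then H (2 * y.1 - 0, clamp y.2)
                 else K (2 * y.1 - 1, clamp y.2)); split.
- apply: continuous_paste.
  + by move=> y; exact: cvg_fst.
  + by apply: continuous_compT; [exact: aff|exact: cH].
  + by apply: continuous_compT; [exact: aff|exact: cK].
  move=> y ->; rewrite divff ?pnatr_eq0 // subr0 subrr Hg ?Kg //;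
    exact: clamp_itv.
- by move=> t t01; rewrite /= invr_ge0 ler0n mulr0 subr0 clamp_id // Hf.
- move=> t t01; rewrite /= ifF; last by apply/negbTE; rewrite -ltNge; lra.
  by rewrite (_ : 2 * 1 - 1 = 1) ?clamp_id ?Kh //; ring.
- move=> s /=; rewrite (clamp_low (lexx _)) (clamp_high (lexx _)).
  by case: ifP => _; rewrite ?(He _).1 ?(He _).2 ?(Ke _).1 ?(Ke _).2 ?e0 ?e1.
Qed.

Lemma path_homotopic_cat f f' g g' : f 1 = g 0 ->
  path_homotopic f f' -> path_homotopic g g' ->
  path_homotopic (path_cat f g) (path_cat f' g').
Proof.
move=> fg [H [cH Hf Hf' He]] [K [cK Kg Kg' Ke]].
have aff (c : R) : continuous (fun y : R * R => (y.1, 2 * y.2 - c)).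
  apply: continuous_pair; first exact: continuous_fst.
  have := @continuous_affine R 2 (- c).
  by apply: continuous_compT; exact: continuous_snd.
exists (fun y => if y.2 <= 2^-1 then H (y.1, 2 * y.2 - 0)
                 else K (y.1, 2 * y.2 - 1)); split.
- apply: continuous_paste.
  + by move=> y; exact: cvg_snd.
  + by apply: continuous_compT; [exact: aff|exact: cH].
  + by apply: continuous_compT; [exact: aff|exact: cK].
  move=> y ->; rewrite divff ?pnatr_eq0 // subr0 subrr.
  by rewrite (He _).2 (Ke _).1.
- move=> t; rewrite /= in_itv /path_cat /= subr0 => t01; case: ifPn => t2.
    by rewrite Hf // in_itv /=; lra.
  by rewrite Kg // in_itv /=; move: t2; rewrite -ltNge; lra.
- move=> t; rewrite /= in_itv /path_cat /= subr0 => t01; case: ifPn => t2.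
    by rewrite Hf' // in_itv /=; lra.
  by rewrite Kg' // in_itv /=; move: t2; rewrite -ltNge; lra.
- move=> s /=; rewrite /path_cat invr_ge0 ler0n mulr0 subr0 (He _).1; split=> //.
  have -> : (1 <= 2^-1 :> R) = false by apply/negbTE; rewrite -ltNge; lra.
  have -> : 2 * 1 - 1 = 1 :> R by ring.
  exact: (Ke _).2.
Qed.

Lemma path_homotopic_cat1l f : continuous f ->
  path_homotopic (path_cat (cst (f 0)) f) f.
Proof.
move=> cf; apply: (@path_homotopic_line f (fun t => Num.max 0 (2 * t - 1)) id) => //.
- apply: continuous_maxr; first by move=> t; exact: cvg_cst.
  exact: continuous_affine.
- by move=> t; exact: cvg_id.
- by case: leP; lra.
- by case: leP; lra.
- move=> t; rewrite in_itv /path_cat /= => t01.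
  case: ifPn => t2; first by rewrite max_l //; lra.
  by rewrite max_r //; move: t2; rewrite -ltNge; lra.
Qed.

Lemma path_homotopic_cat1r f : continuous f ->
  path_homotopic (path_cat f (cst (f 1))) f.
Proof.
move=> cf; apply: (@path_homotopic_line f (fun t => Num.min (2 * t) 1) id) => //.
- apply: continuous_minr; last by move=> t; exact: cvg_cst.
  by move=> t; exact: mulrl_continuous.
- by move=> t; exact: cvg_id.
- by case: leP; lra.
- by case: leP; lra.
- move=> t; rewrite in_itv /path_cat /= => t01.
  case: ifPn => t2; first by rewrite min_l //; lra.
  by rewrite min_r //; move: t2; rewrite -ltNge; lra.
Qed.

Lemma path_homotopic_catV f : continuous f ->
  path_homotopic (path_cat f (path_rev f)) (cst (f 0)).
Proof.
move=> cf; apply: (@path_homotopic_line f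
  (fun t => Num.min (2 * t) (2 - 2 * t)) (cst 0)) => //.
- apply: continuous_minr; first by move=> t; exact: mulrl_continuous.
  apply: continuous_subr; first by move=> t; exact: cvg_cst.
  by move=> t; exact: mulrl_continuous.
- by move=> t; exact: cvg_cst.
- by rewrite /cst; case: leP; lra.
- by rewrite /cst; case: leP; lra.
- move=> t; rewrite in_itv /path_cat /path_rev /= => t01.
  case: ifPn => t2; first by rewrite min_l //; lra.
  rewrite min_r; last by move: t2; rewrite -ltNge; lra.
  by congr (f _); ring.
Qed.

Lemma path_homotopic_catVl f : continuous f ->
  path_homotopic (path_cat (path_rev f) f) (cst (f 1)).
Proof.
move=> cf; apply: (@path_homotopic_line f
  (fun t => Num.max (1 - 2 * t) (2 * t - 1)) (cst 1)) => //.
- apply: continuous_maxr; apply: continuous_subr => t;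
    by [exact: cvg_cst|exact: mulrl_continuous].
- by move=> t; exact: cvg_cst.
- by rewrite /cst; case: leP; lra.
- by rewrite /cst; case: leP; lra.
- move=> t; rewrite in_itv /path_cat /path_rev /= => t01.
  case: ifPn => t2; first by rewrite max_l //; lra.
  by rewrite max_r //; move: t2; rewrite -ltNge; lra.
Qed.

Lemma path_homotopic_catA f g h :
  continuous f -> continuous g -> continuous h -> f 1 = g 0 -> g 1 = h 0 ->
  path_homotopic (path_cat (path_cat f g) h) (path_cat f (path_cat g h)).
Proof.
move=> cf cg ch fg gh.
(* The three paths laid end to end on [0, 3]; the two bracketings traverse [L] at different
   speeds. *)
pose L t := if t <= 1 then f t else if t <= 2 then g (t - 1) else h (t - 2).
have cid : continuous (fun t : R => t) by move=> t; exact: cvg_id.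
have csub c : continuous (fun t : R => t - c).
  by apply: continuous_subr => // t; exact: cvg_cst.
apply: (@path_homotopic_line L (fun t => Num.min (4 * t) (2 * t + 1))
  (fun t => Num.max (2 * t) (4 * t - 1))).
- apply: continuous_paste_at => //.
    apply: continuous_paste_at => //.
    + by apply: continuous_compT cg; exact: csub.
    + by apply: continuous_compT ch; exact: csub.
    + by move=> t ->; rewrite subrr (_ : 2 - 1 = 1) //; ring.
  by move=> t ->; rewrite ler1n /= subrr fg.
- apply: continuous_minr; last exact: continuous_affine.
  by move=> t; exact: mulrl_continuous.
- apply: continuous_maxr; last exact: continuous_affine.
  by move=> t; exact: mulrl_continuous.
- by case: (leP (4 * 0)) => ?; case: leP; lra.
- by case: (leP (4 * 1)) => ?; case: leP; lra.
- move=> t; rewrite in_itv /path_cat /L /= => t01.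
  have [t2|t2] := leP t 2^-1.
    have -> : Num.min (4 * t) (2 * t + 1) = 4 * t by rewrite min_l //; lra.
    have [t4|t4] := leP (2 * t) 2^-1.
      by rewrite ifT; [congr f; ring|lra].
    rewrite ifF; last by apply/negbTE; rewrite -ltNge; lra.
    by rewrite ifT; [congr g; ring|lra].
  have -> : Num.min (4 * t) (2 * t + 1) = 2 * t + 1 by rewrite min_r //; lra.
  rewrite ifF; last by apply/negbTE; rewrite -ltNge; lra.
  rewrite ifF; last by apply/negbTE; rewrite -ltNge; lra.
  by congr h; ring.
- move=> t; rewrite in_itv /path_cat /L /= => t01.
  have [t2|t2] := leP t 2^-1.
    have -> : Num.max (2 * t) (4 * t - 1) = 2 * t by rewrite max_l //; lra.
    by rewrite ifT //; lra.
  have -> : Num.max (2 * t) (4 * t - 1) = 4 * t - 1 by rewrite max_r //; lra.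
  rewrite [RHS]ifF; last by apply/negbTE; rewrite -ltNge; lra.
  have [t4|t4] := leP (2 * t - 1) 2^-1.
    by rewrite ifT; [congr g; ring|lra].
  rewrite ifF; last by apply/negbTE; rewrite -ltNge; lra.
  by congr h; ring.
Qed.

End Paths.

(** * Classes of paths in the fundamental group *)

Section PathClass.
Local Open Scope classical_set_scope.
Local Open Scope ring_scope.
Context {R : realType} {T : topologicalType} (x : T).
Implicit Types (f g h : R -> T) (p q : T).

Definition loop_of_path f (hf : path_from_to f x x) : loop R x :=
  let: And3 cf f0 f1 := hf in Loop (continuous_subspaceT cf) f0 f1.

Lemma loop_of_pathE f (hf : path_from_to f x x) : loop_of_path hf = f :> (R -> T).
Proof. by case: hf. Qed.

(** The value 1 on maps that are not loops at [x] is a junk value, which keeps proofs of loophood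
    out of the terms. *)
Definition path_class f : pi1 R x :=
  if pselect (path_from_to f x x) is left hf then loop_class (loop_of_path hf)
  else 1%g.

Lemma path_class_homotopic f g :
  path_from_to f x x -> path_from_to g x x -> path_homotopic f g ->
  path_class f = path_class g.
Proof.
move=> hf hg [H [cH H0 H1 He]]; rewrite /path_class.
case: pselect => // {}hf; case: pselect => // {}hg.
apply/loop_classP; apply: (homotopicT cH).
- by rewrite loop_of_pathE.
- by rewrite loop_of_pathE.
- by move=> s _; case: hf => _ <- f1; rewrite -{2}f1.
Qed.

Lemma path_class_loop (l : loop R x) :
  path_class (l \o clamp) = loop_class l /\ path_from_to (l \o clamp) x x.
Proof.
have hl : path_from_to (l \o clamp) x x.
  split; first exact: loop_clamp_continuous.
    by rewrite /= clamp_low // loop0.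
  by rewrite /= clamp_high // loop1.
split=> //; rewrite /path_class; case: pselect => // {}hl.
apply/loop_classP; apply: (@homotopic_reparam _ _ _ _ _ l id id) => //;
  try by move=> t; exact: cvg_id.
by move=> t t01; rewrite loop_of_pathE /= clamp_id.
Qed.

Lemma path_class_cat f g : path_from_to f x x -> path_from_to g x x ->
  path_class (path_cat f g) = (path_class f * path_class g)%g.
Proof.
move=> hf hg; have hfg := path_catP hf hg; rewrite /path_class.
case: pselect => // {}hfg; case: pselect => // {}hf; case: pselect => // {}hg.
rewrite [RHS]pi1_mulE; apply/loop_classP.
apply: (@homotopic_reparam _ _ _ _ _ (loop_of_path hfg) id id) => //;
  try by move=> t; exact: cvg_id.
by move=> t _; rewrite /= /concat_fun !loop_of_pathE.
Qed.

Lemma path_class_cst : path_class (cst x) = 1%g.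
Proof.
rewrite /path_class; case: pselect => // hx; apply/loop_classP.
apply: (@homotopic_reparam _ _ _ _ _ (cst_loop x) id id) => //;
  try by move=> t; exact: cvg_id.
by move=> t _; rewrite loop_of_pathE.
Qed.

(* [frame d] is a path from the base point to [pr d]; it turns a path from
   [pr d] to [pr e] into the class of a loop. *)
Context {D : Type} (pr : D -> T) (frame : D -> R -> T)
  (frameP : forall d, path_from_to (frame d) x (pr d)).

Definition framed d f e : pi1 R x :=
  path_class (path_cat (path_cat (frame d) f) (path_rev (frame e))).

Lemma framed_path d f e : path_from_to f (pr d) (pr e) ->
  path_from_to (path_cat (path_cat (frame d) f) (path_rev (frame e))) x x.
Proof.
move=> hf; apply: path_catP; last exact: path_revP.
exact: path_catP hf.
Qed.

Lemma framed_homotopic d f g e : path_from_to f (pr d) (pr e) ->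
  path_from_to g (pr d) (pr e) -> path_homotopic f g ->
  framed d f e = framed d g e.
Proof.
move=> hf hg fg; apply: path_class_homotopic; try exact: framed_path.
have [cd d0 d1] := frameP d; have [ce e0 e1] := frameP e.
have [ck k0 k1] := path_catP (frameP d) hf.
have [cr r0 r1] := path_revP (frameP e).
apply: path_homotopic_cat; first by rewrite k1 r0.
  apply: path_homotopic_cat fg; first by case: hf => _ -> _.
  exact: path_homotopic_refl.
exact: path_homotopic_refl.
Qed.

Lemma framed1 d f e : path_from_to f (pr d) (pr e) ->
  path_homotopic (path_cat (frame d) f) (frame e) -> framed d f e = 1%g.
Proof.
move=> hf kf; rewrite -path_class_cst.
have [cd d0 d1] := frameP d; have [ce e0 e1] := frameP e.
have [ck k0 k1] := path_catP (frameP d) hf.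
have [cr r0 r1] := path_revP (frameP e).
apply: path_class_homotopic; [exact: framed_path|exact: path_cstP|].
apply: path_homotopic_trans (_ : path_homotopic
    (path_cat (frame e) (path_rev (frame e))) _).
  apply: path_homotopic_cat => //; first by rewrite k1 r0.
  exact: path_homotopic_refl.
by rewrite -e0; exact: path_homotopic_catV.
Qed.

(** The return along [frame e] cancels against the departure along [frame e]. *)
Lemma framed_cat d f e h c : path_from_to f (pr d) (pr e) ->
  path_from_to h (pr e) (pr c) ->
  (framed d f e * framed e h c)%g = framed d (path_cat f h) c.
Proof.
move=> hf hh.
have hfh := path_catP hf hh.
have kf := path_catP (frameP d) hf; have kh := path_catP (frameP e) hh.
have rd := path_revP (frameP e); have rc := path_revP (frameP c).
rewrite -path_class_cat; try exact: framed_path.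
have Lf := framed_path hf; have Lh := framed_path hh.
have Lfh := framed_path hfh.
apply: path_class_homotopic => //; first exact: path_catP Lf Lh.
have refl g p q : path_from_to g p q -> path_homotopic g g.
  by case=> cg _ _; exact: path_homotopic_refl.
have assoc f1 f2 f3 p1 p2 p3 p4 : path_from_to f1 p1 p2 ->
    path_from_to f2 p2 p3 -> path_from_to f3 p3 p4 ->
    path_homotopic (path_cat (path_cat f1 f2) f3) (path_cat f1 (path_cat f2 f3)).
  move=> [? ? f11] [? f20 f21] [? f30 ?].
  by apply: path_homotopic_catA; rewrite // ?f11 ?f21.
have congr f1 f2 g1 g2 p1 p2 p3 : path_from_to f1 p1 p2 ->
    path_from_to g1 p2 p3 -> path_homotopic f1 f2 -> path_homotopic g1 g2 ->
    path_homotopic (path_cat f1 g1) (path_cat f2 g2).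
  by move=> [? ? f11] [? g10 ?]; apply: path_homotopic_cat; rewrite f11 g10.
apply: path_homotopic_trans (path_homotopic_sym (assoc _ _ _ _ _ _ _ Lf kh rc)) _.
apply: (congr _ _ _ _ _ _ _ (path_catP Lf kh) rc); last exact: refl rc.
apply: path_homotopic_trans (path_homotopic_sym
  (assoc _ _ _ _ _ _ _ Lf (frameP e) hh)) _.
apply: path_homotopic_trans (assoc _ _ _ _ _ _ _ (frameP d) hf hh).
apply: (congr _ _ _ _ _ _ _ (path_catP Lf (frameP e)) hh); last exact: refl hh.
apply: path_homotopic_trans (assoc _ _ _ _ _ _ _ kf rd (frameP e)) _.
have [ckf _ kf1] := kf; have [ce _ e1] := frameP e.
have := path_homotopic_cat1r ckf; rewrite kf1 => k1.
apply: path_homotopic_trans k1.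
apply: (congr _ _ _ _ _ _ _ kf (path_catP rd (frameP e)) (refl _ _ _ kf)).
by rewrite -e1; exact: path_homotopic_catVl.
Qed.

Lemma framed_cst1 d : framed d (cst (pr d)) d = 1%g.
Proof.
have [cd _ d1] := frameP d.
apply: framed1; first exact: path_cstP.
by rewrite -d1; exact: path_homotopic_cat1r.
Qed.

Lemma framed_loop d f : pr d = x -> frame d = cst x -> path_from_to f x x ->
  framed d f d = path_class f.
Proof.
move=> dx fd hf; rewrite /framed fd.
have hc : path_from_to (cst x : R -> T) x x by exact: path_cstP.
have -> : path_rev (cst x) = (cst x : R -> T) by apply/funext.
have hcf := path_catP hc hf.
by rewrite path_class_cat // path_class_cat // path_class_cst mul1g mulg1.
Qed.

End PathClass.

(** * Charts of the glued polygon *)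

Section Polar.
Local Open Scope classical_set_scope.
Local Open Scope ring_scope.
Context {R : realType} (g : nat).
Implicit Types (p : R * R) (r v w y : R).

(** Half the angle of a side. In this unit a full turn is [8 * g], the vertices have even and the
    middles of the sides odd parameters. *)
Definition unit_angle : R := pi / (4 * g)%:R.
Local Notation theta := unit_angle.

Definition polar r v : R * R := (r * cos (v * theta), r * sin (v * theta)).
Definition plane_norm p : R := Num.sqrt (p.1 ^+ 2 + p.2 ^+ 2).
Definition dot_dir v p : R := p.1 * cos (v * theta) + p.2 * sin (v * theta).
Definition cross_dir v p : R := p.2 * cos (v * theta) - p.1 * sin (v * theta).

(* The open cone of half-angle [unit_angle] around the direction [v]. *)
Definition cone v p : bool := cos theta * plane_norm p < dot_dir v p.

(** The angular offset from the direction [v] in units of [unit_angle]. The arctangent gives the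
    right branch because [dot_dir] is positive on the cone. *)
Definition cone_angle v p : R := atan (cross_dir v p / dot_dir v p) / theta.

Lemma dot_polar v r w : dot_dir v (polar r w) = r * cos ((w - v) * theta).
Proof. by rewrite /dot_dir /= mulrBl cosB; ring. Qed.

Lemma cross_polar v r w : cross_dir v (polar r w) = r * sin ((w - v) * theta).
Proof. by rewrite /cross_dir /= mulrBl sinB; ring. Qed.

Lemma norm_polar r v : 0 <= r -> plane_norm (polar r v) = r.
Proof.
move=> r0; rewrite /plane_norm /= (_ : _ + _ = r ^+ 2) ?sqrtr_sqr ?ger0_norm //.
by rewrite !exprMn -mulrDr cos2Dsin2 mulr1.
Qed.

Lemma dot_cross_norm v p :
  dot_dir v p ^+ 2 + cross_dir v p ^+ 2 = plane_norm p ^+ 2.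
Proof.
rewrite sqr_sqrtr ?addr_ge0 ?sqr_ge0 //.
transitivity ((p.1 ^+ 2 + p.2 ^+ 2) * (cos (v * theta) ^+ 2 + sin (v * theta) ^+ 2)).
  by rewrite /dot_dir /cross_dir; ring.
by rewrite cos2Dsin2 mulr1.
Qed.

Lemma plane_norm_ge0 p : 0 <= plane_norm p. Proof. exact: sqrtr_ge0. Qed.

Lemma cone_cst_continuous :
  [/\ continuous plane_norm, forall v, continuous (dot_dir v)
    & forall v, continuous (cross_dir v)].
Proof.
have c1 : continuous (fun p : R * R => p.1) by exact: continuous_fst.
have c2 : continuous (fun p : R * R => p.2) by exact: continuous_snd.
have cc (c : R) : continuous (fun p : R * R => c) by move=> p; exact: cvg_cst.
split=> [|v|v].
- apply: (@continuous_compT _ _ _ (fun p : R * R => p.1 ^+ 2 + p.2 ^+ 2)).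
    by apply: continuous_addr; apply: continuous_mulr.
  exact: sqrt_continuous.
- by apply: continuous_addr; apply: continuous_mulr.
- by apply: continuous_subr; apply: continuous_mulr.
Qed.

Lemma cone_open v : open [set p | cone v p].
Proof.
have [cn cd _] := cone_cst_continuous.
rewrite (_ : [set p | cone v p] =
    (fun p => dot_dir v p - cos theta * plane_norm p) @^-1` [set y | 0 < y]).
  apply: open_comp; last exact: open_gt.
  move=> p _; apply: continuous_subr; first exact: cd.
  by apply: continuous_mulr => // q; exact: cvg_cst.
by apply/seteqP; split => p /=; rewrite /cone subr_gt0.
Qed.

Context (g0 : (0 < g)%N).

Lemma unit_angle_gt0 : 0 < theta.
Proof. by rewrite divr_gt0 ?pi_gt0 // ltr0n muln_gt0 g0. Qed.

Lemma unit_angle8 : (8 * g)%:R * theta = 2 * pi.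
Proof.
rewrite /unit_angle (_ : (8 * g = 2 * (4 * g))%N); last by rewrite mulnA.
rewrite natrM; field; rewrite pnatr_eq0 -lt0n; exact: g0.
Qed.

Lemma unit_angle_le : theta <= pi / 4.
Proof.
rewrite ler_pM2l ?pi_gt0 // lef_pV2 ?posrE ?ltr0n ?muln_gt0 ?g0 // ler_nat.
by rewrite leq_pmulr.
Qed.

Lemma unit_angle_lt_pihalf : theta < pi / 2.
Proof. by have := unit_angle_le; have := pi_gt0 R; lra. Qed.

Lemma cos_unit_gt0 : 0 < cos theta.
Proof.
apply: cos_gt0_pihalf; have := unit_angle_gt0; have := unit_angle_lt_pihalf; lra.
Qed.

Lemma polar_period r v : polar r (v + (8 * g)%:R) = polar r v.
Proof.
rewrite /polar mulrDl unit_angle8 mulr_natl cosD2pi sinD2pi //.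
Qed.

Lemma cos_lt_unit y : `|y| < 1 -> cos theta < cos (y * theta).
Proof.
move=> y1; rewrite -[ltRHS]cos_norm normrM (gtr0_norm unit_angle_gt0).
have t0 := unit_angle_gt0; have t1 := unit_angle_lt_pihalf.
have p0 := pi_gt0 R; have y0 := normr_ge0 y.
have yt : `|y| * theta < theta by rewrite gtr_pMl.
rewrite ltr_cos // in_itv /=; apply/andP; split; try lra.
by rewrite mulr_ge0 // ltW.
Qed.

Lemma cos_le_unit (z : R) : theta <= z <= 2 * pi - theta -> cos z <= cos theta.
Proof.
have t0 := unit_angle_gt0; have t1 := unit_angle_lt_pihalf.
have p0 := pi_gt0 R; move=> z01.
have main (u : R) : theta <= u <= pi -> cos u <= cos theta.
  by move=> u01; rewrite leNgt ltr_cos ?in_itv /=; lra.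
have [zp|zp] := leP z pi; first by apply: main; lra.
rewrite (_ : cos z = cos (2 * pi - z)); first by apply: main; lra.
by rewrite -[RHS]cosN opprB mulr_natl -[RHS]cosD2pi subrK.
Qed.

Lemma cone_polar v r y : 0 < r -> `|y| < 1 ->
  cone v (polar r (v + y)) /\ cone_angle v (polar r (v + y)) = y.
Proof.
move=> r0 y1; have t0 := unit_angle_gt0; have t1 := unit_angle_lt_pihalf.
have p0 := pi_gt0 R; have c0 := cos_unit_gt0; have yc := cos_lt_unit y1.
rewrite /cone /cone_angle norm_polar ?ltW // dot_polar cross_polar.
have -> : v + y - v = y by ring.
split; first by rewrite mulrC ltr_pM2l.
rewrite -mulf_div divff ?gt_eqF // mul1r -/(tan _) tanK.
  by rewrite mulfK // gt_eqF.
have yt : `|y * theta| < theta by rewrite normrM (gtr0_norm t0) gtr_pMl.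
by move: yt; rewrite ltr_norml in_itv /=; lra.
Qed.

Lemma coneE v p : cone v p ->
  [/\ 0 < plane_norm p, `|cone_angle v p| < 1
    & p = polar (plane_norm p) (v + cone_angle v p)].
Proof.
move=> cvp; have t0 := unit_angle_gt0; have t1 := unit_angle_lt_pihalf.
have c0 := cos_unit_gt0; have p0 := pi_gt0 R; have n0 := plane_norm_ge0 p.
have D0 : 0 < dot_dir v p.
  by apply: le_lt_trans cvp; rewrite mulr_ge0 // ltW.
have DC := dot_cross_norm v p.
set D := dot_dir v p in D0 DC cvp *; set C := cross_dir v p in DC *.
set n := plane_norm p in n0 DC *.
have ngt0 : 0 < n.
  rewrite lt_neqAle n0 andbT eq_sym; apply/eqP => n00; move: DC; rewrite n00.
  by move/eqP; rewrite expr0n /= paddr_eq0 ?sqr_ge0 // sqrf_eq0 gt_eqF.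
set a := atan (C / D).
have [a1 a2] : - (pi / 2) < a /\ a < pi / 2.
  by split; [exact: atan_gtNpi2|exact: atan_ltpi2].
have ca : cos a = D / n.
  rewrite cos_atan (_ : 1 + _ = (n / D) ^+ 2); last first.
    by rewrite !exprMn !exprVn -DC; field; rewrite gt_eqF.
  by rewrite sqrtr_sqr ger0_norm ?invf_div // divr_ge0 // ltW.
have sa : sin a = C / n.
  have ta : tan a = C / D by exact: atanK.
  have -> : sin a = tan a * cos a.
    by rewrite /tan mulfVK // ca mulf_neq0 ?invr_neq0 // gt_eqF.
  by rewrite ta ca; field; rewrite !gt_eqF.
have aE : cone_angle v p * theta = a by rewrite /cone_angle mulfVK ?gt_eqF.
split=> //.
  rewrite -(ltr_pM2r t0) mul1r -{1}(gtr0_norm t0) -normrM aE.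
  have a3 : `|a| < pi / 2 by rewrite ltr_norml a1.
  have a4 := normr_ge0 a.
  rewrite -ltr_cos; first by rewrite cos_norm ca ltr_pdivlMr.
    by rewrite in_itv /=; lra.
  by rewrite in_itv /=; lra.
rewrite /polar mulrDl aE cosD sinD ca sa [p in LHS]surjective_pairing.
have cs := cos2Dsin2 (v * theta).
congr pair.
  transitivity (D * cos (v * theta) - C * sin (v * theta)); last first.
    by field; rewrite gt_eqF.
  rewrite -[LHS]mulr1 -cs /D /C /dot_dir /cross_dir; ring.
transitivity (D * sin (v * theta) + C * cos (v * theta)); last first.
  by field; rewrite gt_eqF.
by rewrite -[LHS]mulr1 -cs /D /C /dot_dir /cross_dir; ring.
Qed.

(** Distinct directions of equal parity are at least two units apart both ways round, and each cone
    reaches less than one unit to either side. *)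
Lemma cone_unique (n m : nat) p : (n < 8 * g)%N -> (m < 8 * g)%N ->
  odd n = odd m -> cone n%:R p -> cone m%:R p -> n = m.
Proof.
wlog nm : n m / (m <= n)%N.
  move=> W; case: (leqP m n) => [|/ltnW] nm n8 m8 onm cn cm; first exact: W.
  by apply/esym; apply: W.
move=> n8 m8 onm cn cm; apply/eqP; case: (eqVneq n m) => // neq.
have [k nE k2] : exists2 k, n = (m + k)%N & (2 <= k <= 8 * g - 2)%N.
  by exists (n - m)%N; lia.
have [r0 y1 pE] := coneE cm; move: cn; rewrite {1}pE.
have t0 := unit_angle_gt0.
rewrite /cone norm_polar ?ltW // dot_polar nE natrD mulrC ltr_pM2l // ltNge.
suff -> : cos ((m%:R + cone_angle m%:R p - (m%:R + k%:R)) * theta) <= cos theta.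
  by [].
set y := cone_angle _ _ in y1 *.
rewrite -cosN -mulNr (_ : - _ = k%:R - y); last ring.
have kle : k%:R <= (8 * g)%:R - 2 :> R by rewrite -natrB ?ler_nat; lia.
have kge : 2 <= k%:R :> R by rewrite ler_nat; lia.
apply: cos_le_unit; rewrite -unit_angle8.
have y2 : -1 < y < 1 by rewrite -ltr_norml.
apply/andP; split.
  by rewrite -[leLHS]mul1r ler_pM2r //; lra.
have -> : (8 * g)%:R * theta - theta = ((8 * g)%:R - 1) * theta by ring.
by rewrite ler_pM2r //; lra.
Qed.

Lemma unit_polar p : plane_norm p = 1 ->
  exists (n : nat) (y : R), [/\ (n < 8 * g)%N, 0 <= y < 1 & p = polar 1 (n%:R + y)].
Proof.
move=> p1; have t0 := unit_angle_gt0; have p0 := pi_gt0 R.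
have cs : p.1 ^+ 2 + p.2 ^+ 2 = 1.
  by rewrite -(expr1n _ 2) -p1 sqr_sqrtr // addr_ge0 ?sqr_ge0.
have x1 : -1 <= p.1 <= 1.
  rewrite -ler_norml -(@ler_pXn2r _ 2) ?nnegrE // expr1n real_normK ?num_real //.
  by rewrite -cs lerDl sqr_ge0.
have [phi [phi0 phi1 phc phs]] : exists phi,
    [/\ 0 <= phi, phi < 2 * pi, cos phi = p.1 & sin phi = p.2].
  have ca : cos (acos p.1) = p.1 by rewrite acosK.
  have sa : sin (acos p.1) = `|p.2|.
    by rewrite sin_acos // -cs addrC addKr sqrtr_sqr.
  have a0 := acos_ge0 x1; have a1 := acos_lepi x1.
  have [s0|s0] := leP 0 p.2.
    by exists (acos p.1); rewrite ca sa ger0_norm //; split => //; lra.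
  exists (2 * pi - acos p.1); split; try lra.
  - rewrite ltrBlDr ltrDl lt_neqAle a0 andbT eq_sym; apply/eqP => a00.
    by move: sa; rewrite a00 sin0 => /esym/eqP; rewrite normr_eq0 lt_eqF.
  - by rewrite addrC mulr_natl cosD2pi cosN.
  - by rewrite addrC mulr_natl sinD2pi sinN sa ltr0_norm // opprK.
have v0 : 0 <= phi / theta by rewrite divr_ge0 // ltW.
have /andP[n1 n2] := truncn_itv v0.
exists (Num.truncn (phi / theta)), (phi / theta - (Num.truncn (phi / theta))%:R).
split.
- rewrite -(ltr_nat R); apply: le_lt_trans n1 _.
  by rewrite ltr_pdivrMr // unit_angle8.
- by rewrite subr_ge0 n1 /= ltrBlDr addrC natr1.
- rewrite addrC subrK /polar mulfVK ?gt_eqF // phc phs !mul1r.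
  exact: surjective_pairing.
Qed.

End Polar.

(** * The gluing in polar coordinates and its charts *)

Section Surface.
Local Open Scope classical_set_scope.
Local Open Scope ring_scope.
Local Open Scope quotient_scope.
Context {R : realType} (g : nat).
Implicit Types (p q : @disc R) (r v w y : R) (b c : bool).
Local Notation D := (@disc R).
Local Notation N := (8 * g)%N.

Definition surface_pr : D -> surface R g := \pi_(surface R g).

Lemma discP (z : R * R) : (z \in @disc R) = (plane_norm z <= 1).
Proof.
apply/idP/idP; rewrite inE /disc /= => z1.
  by rewrite /plane_norm -[leRHS]sqrtr1 ler_wsqrtr.
have := plane_norm_ge0 z => z0; rewrite -(@ler_pXn2r _ 2) ?nnegrE // in z1.
by move: z1; rewrite expr1n sqr_sqrtr // addr_ge0 ?sqr_ge0.
Qed.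

Lemma disc_origin_subproof : (0, 0) \in @disc R.
Proof. by apply/mem_set; rewrite /disc /= expr0n /= addr0. Qed.

(* Junk value: points outside the disc are sent to the origin. *)
Definition to_disc (z : R * R) : D :=
  insubd (exist (fun z => z \in @disc R) _ disc_origin_subproof) z.

Lemma to_discK z : plane_norm z <= 1 -> val (to_disc z) = z.
Proof. by rewrite -discP => zD; rewrite insubdK. Qed.

Lemma val_to_disc p : to_disc (val p) = p.
Proof. by apply/val_inj; rewrite to_discK // -discP; case: p. Qed.

Lemma disc_norm p : plane_norm (val p) <= 1.
Proof. by rewrite -discP; case: p. Qed.

Lemma to_disc_continuous (X : topologicalType) (f : X -> R * R) :
  continuous f -> (forall a, plane_norm (f a) <= 1) ->
  continuous (fun a => to_disc (f a)).
Proof.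
move=> cf f1; apply: continuous_comp_initial.
rewrite (_ : _ \o _ = f) //; apply/funext => a /=; exact: to_discK.
Qed.

Lemma val_disc_continuous : continuous (fun p : D => val p).
Proof. exact: initial_continuous. Qed.

Lemma surface_pr_continuous : continuous surface_pr.
Proof. exact: pi_continuous. Qed.

Lemma surface_pr_repr (x : surface R g) : surface_pr (repr x) = x.
Proof. exact: reprK. Qed.

Lemma surface_open (U : set (surface R g)) :
  open U = open (surface_pr @^-1` U).
Proof. by []. Qed.

Lemma surface_pr_glued p q : glued g p q -> surface_pr p = surface_pr q.
Proof. by move=> pq; apply/eqmodP/asboolP; exact: rst_step. Qed.

(** Identification of points is only given as an equivalence closure; relations between identified
    points are verified on the generating pairs. *)
Lemma surface_pr_ind (P : D -> D -> Prop) :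
  (forall p, P p p) -> (forall p q, P p q -> P q p) ->
  (forall p q s, P p q -> P q s -> P p s) ->
  (forall p q, glued g p q -> P p q) ->
  forall p q, surface_pr p = surface_pr q -> P p q.
Proof.
move=> Pr Ps Pt Pg p q /eqmodP/asboolP; elim=> //.
- by move=> a b _; exact: Ps.
- by move=> a b c _ Pab _; exact: Pt.
Qed.

Context (g0 : (0 < g)%N).

Definition disc_polar r v : D := to_disc (polar g r v).

Lemma val_disc_polar r v : 0 <= r <= 1 -> val (disc_polar r v) = polar g r v.
Proof. by move=> /andP[r0 r1]; rewrite to_discK // norm_polar. Qed.

Lemma disc_polar_period r v : disc_polar r (v + N%:R) = disc_polar r v.
Proof. by rewrite /disc_polar polar_period. Qed.

Lemma sideE (j : nat) t : side g j t = disc_polar 1 (2 * (j%:R + t)).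
Proof.
have i1 : 0 <= (1 : R) <= 1 by lra.
apply/val_inj; rewrite val_disc_polar //= /polar !mul1r /side_angle /unit_angle.
suff -> : 2 * pi * ((j%:R + t) / (4 * g)%:R) =
    2 * (j%:R + t) * (pi / (4 * g)%:R) by [].
by field; rewrite pnatr_eq0 -lt0n.
Qed.

(* The point with angular parameter [v] is glued to that with parameter
   [2 * low + 6 - v], for [v] in [low, low + 2]. *)
Definition side_low (k : 'I_g) c : nat := 8 * k + 2 * c.

Lemma side_low_le k c : (side_low k c + 6 <= N)%N.
Proof. by have := ltn_ord k; rewrite /side_low; case: c; lia. Qed.

(** With [v = low + 2 t] the partner on the side two places further has parameter [low + 6 - 2 t],
    so both kinds of gluing become one reflection. *)
Lemma gluedE p q : glued g p q <-> exists k c v,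
  [/\ (side_low k c)%:R <= v <= (side_low k c)%:R + 2, p = disc_polar 1 v &
      q = disc_polar 1 ((2 * side_low k c + 6)%:R - v)].
Proof.
split=> [[k t|k t]|[k [c [v [v01 -> ->]]]]].
- rewrite in_itv /= => t01; exists k, false, (2 * ((4 * k)%:R + t)).
  have e1 : (8 * k)%:R = 8 * k%:R :> R by rewrite natrM.
  have e2 : (4 * k)%:R = 4 * k%:R :> R by rewrite natrM.
  rewrite !sideE /side_low muln0 addn0; split=> //; first by rewrite e1 e2; lra.
  have e3 : (2 * (8 * k) + 6)%:R = 16 * k%:R + 6 :> R by rewrite natrD natrM e1; ring.
  by congr disc_polar; rewrite e3 natrD e2; ring.
- rewrite in_itv /= => t01; exists k, true, (2 * ((4 * k + 1)%:R + t)).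
  have e1 : (8 * k + 2)%:R = 8 * k%:R + 2 :> R by rewrite natrD natrM.
  have e2 : (4 * k)%:R = 4 * k%:R :> R by rewrite natrM.
  rewrite !sideE /side_low muln1; split=> //; first by rewrite e1 natrD e2; lra.
  have e3 : (2 * (8 * k + 2) + 6)%:R = 16 * k%:R + 10 :> R.
    by rewrite natrD natrM e1; ring.
  have e4 : (4 * k + 3)%:R = 4 * k%:R + 3 :> R by rewrite natrD natrM.
  by congr disc_polar; rewrite e3 e4 natrD e2; ring.
- have lE : (side_low k c)%:R = 8 * k%:R + 2 * c%:R :> R.
    by rewrite /side_low natrD !natrM.
  have sE : (2 * side_low k c + 6)%:R = 16 * k%:R + 4 * c%:R + 6 :> R.
    by rewrite natrD natrM lE; ring.
  rewrite lE in v01; rewrite sE; case: c v01 {lE sE} => /= v01.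
    pose t := v / 2 - (4 * k + 1)%:R.
    have -> : v = 2 * ((4 * k + 1)%:R + t) by rewrite /t; field.
    have -> : 16 * k%:R + 4 * 1 + 6 - 2 * ((4 * k + 1)%:R + t) =
        2 * ((4 * k + 3)%:R + (1 - t)).
      by rewrite (natrD _ (4 * k) 3) (natrD _ (4 * k) 1) natrM; ring.
    rewrite -!sideE; apply: Glued_b; rewrite in_itv /= /t natrD natrM; lra.
  pose t := v / 2 - (4 * k)%:R.
  have -> : v = 2 * ((4 * k)%:R + t) by rewrite /t; field.
  have -> : 16 * k%:R + 4 * 0 + 6 - 2 * ((4 * k)%:R + t) =
      2 * ((4 * k + 2)%:R + (1 - t)).
    by rewrite natrD natrM; ring.
  rewrite -!sideE; apply: Glued_a; rewrite in_itv /= /t natrM; lra.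
Qed.

(* [None] is the chart of the open disc; [Some b] is the union of the cones
   around the directions of parity [b], that is around the vertices for
   [b = false] and around the middles of the sides for [b = true]. *)
Definition chart := option bool.

Definition in_chart (i : chart) p : bool :=
  match i with
  | None => plane_norm (val p) < 1
  | Some b => [exists n : 'I_N, (odd n == b) && cone g n%:R (val p)]
  end.

(** By [cone_unique] there is only one candidate; 0 is a junk value outside the chart. *)
Definition node b p : nat :=
  if [pick n : 'I_N | (odd n == b) && cone g n%:R (val p)] is Some n then n
  else 0%N.

Lemma nodeP b p : in_chart (Some b) p ->
  [/\ (node b p < N)%N, odd (node b p) = b & cone g (node b p)%:R (val p)].
Proof.
move=> /existsP[n hn]; rewrite /node; case: pickP => [m /andP[/eqP]|/(_ n)].
  by move=> om cm; split.
by rewrite hn.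
Qed.

Lemma node_unique b p n : (n < N)%N -> odd n = b -> cone g n%:R (val p) ->
  in_chart (Some b) p /\ node b p = n.
Proof.
move=> nN on cn.
have ip : in_chart (Some b) p.
  by apply/existsP; exists (Ordinal nN); rewrite /= on eqxx.
split=> //; have [mN om cm] := nodeP ip.
by apply: (@cone_unique R g g0 _ _ (val p)) => //; rewrite om on.
Qed.

Lemma cone_openD v : open [set p : D | cone g v (val p)].
Proof.
rewrite (_ : [set _ | _] = (fun p : D => val p) @^-1` [set z | cone g v z]) //.
apply: open_comp; last exact: cone_open.
by move=> p _; exact: val_disc_continuous.
Qed.

Lemma in_chart_open i : open [set p : D | in_chart i p].
Proof.
case: i => [b|] /=.
  rewrite (_ : [set _ | _] = \bigcup_(n in [set n : 'I_N | odd n == b])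
      [set p : D | cone g n%:R (val p)]).
    by apply: bigcup_open => n _; exact: cone_openD.
  apply/seteqP; split => p /=.
    by move=> /existsP[n /andP[on cn]]; exists n.
  by move=> [n /= on cn]; apply/existsP; exists n; rewrite on.
have [cn _ _] := @cone_cst_continuous R g.
rewrite (_ : [set _ | _] =
   (fun p : D => plane_norm (val p)) @^-1` [set y | y < 1]) //.
apply: open_comp; last exact: open_lt.
move=> p _; have := @continuous_compT _ _ _ (fun p : D => val p) plane_norm.
by apply; [exact: val_disc_continuous|exact: cn].
Qed.

Lemma node_near b p : in_chart (Some b) p ->
  \forall q \near p, in_chart (Some b) q /\ node b q = node b p.
Proof.
move=> ip; have [nN on cn] := nodeP ip.
have : nbhs p [set q : D | cone g (node b p)%:R (val q)].
  by apply: open_nbhs_nbhs; split => //; exact: cone_openD.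
by apply: filterS => q cq; apply: node_unique.
Qed.

Lemma node_polar (n : nat) r y : (n <= N)%N -> 0 < r <= 1 -> `|y| < 1 ->
  let p := disc_polar r (n%:R + y) in
  [/\ in_chart (Some (odd n)) p, node (odd n) p = (n %% N)%N,
      cone_angle g (n %% N)%:R (val p) = y & plane_norm (val p) = r].
Proof.
move=> nN r01 y1 p; have [r0 r1] := andP r01.
have N0 : (0 < N)%N by rewrite muln_gt0.
have pE : val p = polar g r ((n %% N)%:R + y).
  rewrite val_disc_polar; last by rewrite r1 ltW.
  move: nN; rewrite leq_eqVlt => /orP[/eqP ->|nN]; last by rewrite modn_small.
  by rewrite modnn add0r addrC polar_period.
have := cone_polar g0 (n %% N)%:R r0 y1; rewrite -pE => -[cp ap].
have on : odd (n %% N) = odd n by have := divn_eq n N; lia.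
have [ip np] := node_unique (ltn_pmod n N0) on cp.
split=> //; rewrite pE norm_polar // ltW //.
Qed.

Lemma in_chart_cover p : exists i, in_chart i p.
Proof.
have := disc_norm p; rewrite le_eqVlt => /orP[/eqP p1|p1]; last by exists None.
have [n [y [nN y01 pE]]] := unit_polar g0 p1.
exists (Some (odd n)).
have i1 : 0 < (1 : R) <= 1 by lra.
have y1 : `|y| < 1 by rewrite ger0_norm; lra.
have [+ _ _ _] := node_polar (ltnW nN) i1 y1.
by rewrite (_ : disc_polar _ _ = p) // /disc_polar -pE val_to_disc.
Qed.

Section Side.
Context (k : 'I_g) (c : bool) (lo : nat) (v : R).
Context (loE : lo = side_low k c).
Context (v_side : lo%:R <= v <= lo%:R + 2).
Let p := disc_polar 1 v.
Let q := disc_polar 1 ((2 * lo + 6)%:R - v).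

Lemma in_chart_side b (n : nat) w : (n < N)%N -> 0 <= w <= N%:R ->
  cone g n%:R (val (disc_polar 1 w)) ->
  `|w - n%:R| < 1 \/ n = 0%N /\ `|w - N%:R| < 1.
Proof.
move=> nN w01; rewrite val_disc_polar ?ler01 ?lexx //.
rewrite /cone norm_polar ?ler01 // dot_polar mul1r mulr1 => cw.
have [|w1] := ltP `|w - n%:R| 1; [by left|right].
have n1 : n%:R + 1 <= N%:R :> R by rewrite natr1 ler_nat.
have n0 : 0 <= n%:R :> R by rewrite ler0n.
have t0 := @unit_angle_gt0 R _ g0.
have w2 : N%:R - 1 < `|w - n%:R|.
  rewrite ltNge; apply/negP => w2; move: cw; rewrite ltNge; apply/negP; rewrite negbK.
  rewrite -cos_norm normrM (gtr0_norm t0); apply: cos_le_unit => //.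
  rewrite -{1}[unit_angle g]mul1r ler_pM2r // w1 /= -(@unit_angle8 R _ g0).
  have -> : N%:R * unit_angle g - unit_angle g = (N%:R - 1) * unit_angle g :> R by ring.
  by rewrite ler_pM2r.
have n00 : n = 0%N.
  apply/eqP; rewrite eqn0Ngt; apply/negP => npos.
  have : 1 <= n%:R :> R by rewrite ler1n.
  by move: w2; case: ler0P; lra.
split=> //; move: w2; rewrite n00 subr0.
by rewrite ger0_norm; [case: ler0P; lra|lra].
Qed.

Lemma chart_side_l b : in_chart (Some b) p ->
  exists n : nat, [/\ (lo <= n <= lo + 2)%N, odd n = b & `|v - n%:R| < 1].
Proof.
move=> /nodeP[nN on cn]; have loN := side_low_le k c; rewrite -loE in loN.
have loN' : lo%:R + 6 <= N%:R :> R by rewrite -natrD ler_nat.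
have lo0 : 0 <= lo%:R :> R by [].
have [v_lo v_hi] := andP v_side.
have v01 : 0 <= v <= N%:R by lra.
case: (in_chart_side b nN v01 cn) => [vn|[_]]; last by rewrite ltr_norml => ?; exfalso; lra.
exists (node b p); split=> //; move: vn; rewrite ltr_norml => vn.
have : lo%:R < (node b p).+1%:R :> R by rewrite -natr1; lra.
have : (node b p)%:R < (lo + 3)%:R :> R by rewrite natrD; lra.
by rewrite !ltr_nat; lia.
Qed.

Lemma chart_side_r b : in_chart (Some b) q ->
  exists n : nat, [/\ (lo <= n <= lo + 2)%N, odd n = b & `|v - n%:R| < 1].
Proof.
move=> /nodeP[nN on cn]; have loN := side_low_le k c; rewrite -loE in loN.
have loN' : lo%:R + 6 <= N%:R :> R by rewrite -natrD ler_nat.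
have lo0 : 0 <= lo%:R :> R by [].
have sE : (2 * lo + 6)%:R = 2 * lo%:R + 6 :> R by rewrite natrD natrM.
have [v_lo v_hi] := andP v_side.
have v01 : 0 <= (2 * lo + 6)%:R - v <= N%:R by rewrite sE; lra.
have [m [mN om vm]] : exists m : nat,
    [/\ (m <= N)%N, odd m = b & `|(2 * lo + 6)%:R - v - m%:R| < 1].
  case: (in_chart_side b nN v01 cn) => [vn|[n0 vn]].
    by exists (node b q); split => //; exact: ltnW.
  by exists N; split => //; rewrite oddM -on n0.
move: vm; rewrite sE ltr_norml => vm.
have m1 : (lo + 3)%:R < m%:R :> R by rewrite natrD; lra.
have m2 : m%:R < (lo + 7)%:R :> R by rewrite natrD; lra.
rewrite !ltr_nat in m1 m2.
exists (2 * lo + 6 - m)%N; split; [lia| |].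
  by rewrite -om; lia.
rewrite natrB ?sE ?ltr_norml; [lra|lia].
Qed.

(** The reflection carries the cone around [n] to the cone around the reflected direction and
    reverses the offset. *)
Lemma chart_side (n : nat) : (lo <= n <= lo + 2)%N -> `|v - n%:R| < 1 ->
  [/\ in_chart (Some (odd n)) p /\ in_chart (Some (odd n)) q,
      node (odd n) p = n, node (odd n) q = ((2 * lo + 6 - n) %% N)%N,
      cone_angle g n%:R (val p) = v - n%:R &
      cone_angle g ((2 * lo + 6 - n) %% N)%:R (val q) = n%:R - v].
Proof.
move=> nlo vn; have loN := side_low_le k c; rewrite -loE in loN.
have i1 : 0 < (1 : R) <= 1 by lra.
have nN : (n < N)%N by lia.
have [ip np ap _] := node_polar (ltnW nN) i1 vn.
rewrite addrC subrK modn_small // -/p in ip np ap.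
have mN : (2 * lo + 6 - n <= N)%N by lia.
have vm : `|n%:R - v| < 1 by rewrite distrC.
have [iq nq aq _] := node_polar mN i1 vm.
have qE : (2 * lo + 6 - n)%:R + (n%:R - v) = (2 * lo + 6)%:R - v :> R.
  by rewrite natrB; [ring|lia].
have oE : odd (2 * lo + 6 - n) = odd n by lia.
by rewrite qE -/q oE in iq nq aq; split.
Qed.

Lemma side_interior : ~~ in_chart None p /\ ~~ in_chart None q.
Proof.
by rewrite /= !val_disc_polar ?ler01 ?lexx // !norm_polar ?ler01 // ltxx.
Qed.

End Side.

Lemma in_chart_pr i p q : surface_pr p = surface_pr q ->
  in_chart i p = in_chart i q.
Proof.
move: p q; apply: surface_pr_ind => [//|p q ->//|p q s -> //|p q].
move=> /gluedE[k [c [v [v01 -> ->]]]].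
case: i => [b|]; last first.
  by have [/negbTE -> /negbTE ->] := side_interior (side_low k c) v.
apply/idP/idP.
  move=> /(chart_side_l erefl v01)[n [nlo on vn]].
  by have [[_]] := chart_side erefl v01 nlo vn; rewrite on.
move=> /(chart_side_r erefl v01)[n [nlo on vn]].
by have [[+ _]] := chart_side erefl v01 nlo vn; rewrite on.
Qed.

End Surface.

(** * Local systems and monodromy *)

Section LocallyConstant.
Local Open Scope classical_set_scope.
Local Open Scope ring_scope.
Context {R : realType} {A : Type}.

(** The level sets are relatively open, so connectedness leaves only one. The values lie in an
    arbitrary type; taking [Prop], this also runs the usual arguments by an open and closed set of
    times. *)
Lemma locally_constant (J : set R) (f : R -> A) : is_interval J ->
  (forall t, J t -> \forall u \near t, J u -> f u = f t) ->
  forall s t, J s -> J t -> f s = f t.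
Proof.
move=> /connected_intervalP cJ fJ s t Js Jt.
suff : J `&` [set u | f u = f s] = J by rewrite eqEsubset => -[_ /(_ t Jt)[]].
apply: cJ.
- by exists s.
- exists (interior [set u | J u -> f u = f s]); first exact: open_interior.
  apply/seteqP; split => u [Ju fu]; split=> //.
    by have := fJ u Ju; rewrite /interior /=; apply: filterS => v; rewrite -fu.
  exact: (interior_subset fu).
- exists (~` interior [set u | J u -> f u <> f s]).
    by apply: open_closedC; exact: open_interior.
  apply/seteqP; split => u [Ju fu]; split=> //.
    by move=> /interior_subset/(_ Ju); apply.
  apply: contrapT => nfu; apply: fu.
  by have := fJ u Ju; rewrite /interior /=; apply: filterS => v /= H /H ->.
Qed.

Lemma locally_constant_line (f : R -> A) :
  (forall t, \forall u \near t, f u = f t) -> forall s t, f s = f t.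
Proof.
move=> fJ s t; apply: (@locally_constant setT) => // u _.
by have := fJ u; apply: filterS.
Qed.

End LocallyConstant.

(** * The covering defined by labels on the polygon *)

Section Monodromy.
Local Open Scope classical_set_scope.
Local Open Scope ring_scope.
Context {R : realType} (g : nat) (g0 : (0 < g)%N) {G : groupType}.
Local Notation D := (@disc R).
Local Notation N := (8 * g)%N.
Local Notation pr := (@surface_pr R g).
Local Notation in_chart := (@in_chart R g).
Local Notation node := (@node R g).

(** Gluing along a side multiplies the labels of its two ends and of its middle by the same element
    on the right; these data define a covering with structure group [G]. *)
Context (label : nat -> G) (side_label : 'I_g -> bool -> G).
Context (labelP : forall k c n,
  (side_low k c <= n <= side_low k c + 2)%N ->
  label ((2 * side_low k c + 6 - n) %% N)%N = (label n * side_label k c)%g).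

Definition lab (i : chart) (d : D) : G :=
  if i is Some b then label (node b d) else 1%g.

Lemma lab_side k c (v : R) i :
  (side_low k c)%:R <= v <= (side_low k c)%:R + 2 ->
  let p := disc_polar g 1 v in
  let q := disc_polar g 1 ((2 * side_low k c + 6)%:R - v) in
  in_chart i p -> lab i q = (lab i p * side_label k c)%g.
Proof.
move=> v01 p q; case: i => [b|]; last first.
  by have [/negbTE ->] := side_interior g (side_low k c) v.
move=> /(chart_side_l g0 erefl v01)[n [nlo <- vn]] /=.
by have [_ -> -> _ _] := chart_side g0 erefl v01 nlo vn; exact: labelP.
Qed.

(** One [h] serves all charts at once, so it cancels in [lab i * (lab j)^-1], which therefore
    descends to the surface. *)
Lemma lab_pr p q : pr p = pr q ->
  exists h, forall i, in_chart i p -> lab i q = (lab i p * h)%g.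
Proof.
move=> pq; suff [_] : (forall i, in_chart i p = in_chart i q) /\
  exists h, forall i, in_chart i p -> lab i q = (lab i p * h)%g by [].
move: p q pq; apply: surface_pr_ind.
- by move=> p; split=> //; exists 1%g => i _; rewrite mulg1.
- move=> p q [pq [h hE]]; split=> [i|]; first by rewrite pq.
  by exists h^-1%g => i; rewrite -pq => ip; rewrite hE // mulgK.
- move=> p q s [pq [h hE]] [qs [h' hE']]; split=> [i|]; first by rewrite pq qs.
  by exists (h * h')%g => i ip; rewrite hE' -?pq // hE // mulgA.
- move=> p q pq; split=> [i|]; first exact/in_chart_pr/surface_pr_glued.
  move/(gluedE g0) : pq => [k [c [v [v01 -> ->]]]].
  by exists (side_label k c) => i; exact: lab_side.
Qed.

Definition in_patch (i : chart) (s : surface R g) : bool := in_chart i (repr s).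

Definition transition (i j : chart) (s : surface R g) : G :=
  (lab i (repr s) * (lab j (repr s))^-1)%g.

Lemma in_patchE i d : in_patch i (pr d) = in_chart i d.
Proof. by apply: in_chart_pr => //; rewrite surface_pr_repr. Qed.

Lemma transitionE i j d : in_chart i d -> in_chart j d ->
  transition i j (pr d) = (lab i d * (lab j d)^-1)%g.
Proof.
move=> id jd; have [|h hE] := @lab_pr d (repr (pr d)).
  by rewrite surface_pr_repr.
by rewrite /transition !hE // invgM mulgA mulgK.
Qed.

Lemma transition_trans i j k s :
  (transition i j s * transition j k s)%g = transition i k s.
Proof. by rewrite /transition mulgA mulgVK. Qed.

Lemma patch_cover s : exists i, in_patch i s.
Proof. exact: in_chart_cover. Qed.

Lemma lab_near i d : in_chart i d ->
  \forall e \near d, in_chart i e /\ lab i e = lab i d.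
Proof.
case: i => [b|] id; last first.
  have : nbhs d [set e | in_chart None e].
    by apply: open_nbhs_nbhs; split => //; exact: in_chart_open.
  by apply: filterS => e ie; split.
by have := node_near g0 id; apply: filterS => e [ie /= ->].
Qed.

Lemma transition_near i j s : in_patch i s -> in_patch j s ->
  \forall u \near s, [/\ in_patch i u, in_patch j u
                       & transition i j u = transition i j s].
Proof.
move=> is_ js; pose W := [set u | [/\ in_patch i u, in_patch j u
                       & transition i j u = transition i j s]].
suff oW : open W by apply: (open_nbhs_nbhs (conj oW _)).
rewrite surface_open openE => d [].
rewrite !in_patchE => id jd dE; rewrite /interior /=.
near=> e.
have [ie iE] : in_chart i e /\ lab i e = lab i d by near: e; exact: lab_near.
have [je jE] : in_chart j e /\ lab j e = lab j d by near: e; exact: lab_near.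
by split; rewrite ?in_patchE // -dE !transitionE // iE jE.
Unshelve. all: by end_near. Qed.

Lemma patch_near i s : in_patch i s -> \forall u \near s, in_patch i u.
Proof.
move=> si; apply: open_nbhs_nbhs; split=> //.
rewrite surface_open (_ : _ @^-1` _ = [set d : D | in_chart i d]).
  exact: in_chart_open.
by apply/seteqP; split => d; rewrite /= in_patchE.
Qed.

Lemma patch_near_comp (Z : topologicalType) (gam : Z -> surface R g) z i :
  {for z, continuous gam} -> in_patch i (gam z) ->
  \forall u \near z, in_patch i (gam u).
Proof. by move=> cg iz; apply: cg (patch_near iz). Qed.

Lemma transition_near_comp (Z : topologicalType) (gam : Z -> surface R g) z i j :
  {for z, continuous gam} -> in_patch i (gam z) -> in_patch j (gam z) ->
  \forall u \near z, transition i j (gam u) = transition i j (gam z).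
Proof.
move=> cg iz jz; near=> u.
suff [] : [/\ in_patch i (gam u), in_patch j (gam u)
  & transition i j (gam u) = transition i j (gam z)] by [].
by near: u; apply: cg (transition_near iz jz).
Unshelve. all: by end_near. Qed.

(* A section of the covering with structure group [G] along [gam], read in the
   local trivializations over the patches. *)
Definition section_at (Z : topologicalType) (gam : Z -> surface R g)
    (F : chart -> Z -> G) (z : Z) :=
  (forall i j, in_patch i (gam z) -> in_patch j (gam z) ->
     F j z = (F i z * transition i j (gam z))%g) /\
  (forall i, in_patch i (gam z) -> \forall u \near z, F i u = F i z).

Lemma section_mull (Z : topologicalType) (gam : Z -> surface R g) F h z :
  section_at gam F z -> section_at gam (fun i u => (h * F i u)%g) z.
Proof.
move=> [Fa Fb]; split=> [i j iz jz|i iz]; first by rewrite (Fa i j) // mulgA.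
by have := Fb i iz; apply: filterS => u ->.
Qed.

(** The existence of a section over [[a, b]] is, as a proposition, locally constant in [b]. *)
Lemma section_exists (gam : R -> surface R g) (a b : R) : continuous gam ->
  exists F, forall t, a <= t <= b -> section_at gam F t.
Proof.
move=> cg; pose P b := exists F, forall t, a <= t <= b -> section_at gam F t.
(* At [a - 1] the interval is empty and the claim vacuous. *)
suff: P b = P (a - 1).
  rewrite /P => ->; exists (fun _ _ => 1%g) => t at1; exfalso; lra.
move: b (a - 1); apply: locally_constant_line => t0.
have [i it0] := patch_cover (gam t0).
have nJ : \forall t \near t0, in_patch i (gam t).
  exact: (patch_near_comp (cg t0) it0).
have /nbhs_ballP[e /= e0 eJ] := nJ.
have step t t' : ball t0 e t -> ball t0 e t' -> P t -> P t'.
  move=> Jt Jt' [F FP].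
  have Js s : t <= s <= t' -> in_patch i (gam s).
    move=> tst; apply: eJ; move: Jt Jt'; rewrite /ball /= !ltr_distlC; lra.
  exists (fun j s => if s <= t then F j s else (F i t * transition i j (gam s))%g).
  move=> s at's; have [st|ts|tE] := ltgtP s t.
  - have [|Fa Fb] := FP s; first lra.
    split=> [j k js ks|j js]; first by rewrite ltW // (Fa j k).
    have nst : \forall u \near s, u < t by apply: open_nbhs_nbhs; split => //; exact: open_lt.
    near=> u; rewrite (ltW st) ifT; first by near: u; exact: Fb.
    by apply/ltW; near: u.
  - have is_ : in_patch i (gam s) by apply: Js; lra.
    split=> [j k js ks|j js].
      by rewrite leNgt ts /= -mulgA transition_trans.
    have nst : \forall u \near s, t < u by apply: open_nbhs_nbhs; split => //; exact: open_gt.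
    near=> u; rewrite !leNgt ts /= ifF; last by apply/negbF; near: u.
    suff -> : transition i j (gam u) = transition i j (gam s) by [].
    by near: u; exact: (transition_near_comp (cg s) is_ js).
  - subst s; have [|Fa Fb] := FP t; first lra.
    have it : in_patch i (gam t) by apply: Js; lra.
    split=> [j k js ks|j js]; first by rewrite lexx (Fa j k).
    near=> u; rewrite lexx; case: ifP => ut; first by near: u; exact: Fb.
    rewrite (Fa i j it js); congr (_ * _)%g; near: u.
    exact: (transition_near_comp (cg t) it js).
near=> t; apply/propext.
have Jt : ball t0 e t by near: t; exact: nbhsx_ballx.
by split; apply: step => //; exact: ballxx.
Unshelve. all: by end_near. Qed.

(** The quotient of two sections is the same in all charts and locally constant. *)
Lemma section_unique (gam : R -> surface R g) (J : set R) F F' :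
  continuous gam -> is_interval J ->
  (forall t, J t -> section_at gam F t) -> (forall t, J t -> section_at gam F' t) ->
  exists h, forall i t, J t -> in_patch i (gam t) -> F i t = (h * F' i t)%g.
Proof.
move=> cg iJ FP FP'; have [[t0 Jt0]|nJ] := pselect (exists t, J t); last first.
  by exists 1%g => i t Jt; case: nJ; exists t.
pose ch t := projT1 (cid (patch_cover (gam t))).
have chP t : in_patch (ch t) (gam t) by exact: (projT2 (cid (patch_cover (gam t)))).
pose h t := (F (ch t) t * (F' (ch t) t)^-1)%g.
have hE i t : J t -> in_patch i (gam t) -> (F i t * (F' i t)^-1)%g = h t.
  move=> Jt it; have [Fa _] := FP t Jt; have [Fa' _] := FP' t Jt.
  by rewrite (Fa (ch t) i) // (Fa' (ch t) i) // invgM mulgA mulgK.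
exists (h t0) => i t Jt it.
suff <- : h t = h t0 by rewrite -(hE i t Jt it) mulgVK.
apply: (locally_constant iJ) => // {i it Jt}t Jt.
have [Fa Fb] := FP t Jt; have [Fa' Fb'] := FP' t Jt.
near=> u => Ju; rewrite -(hE (ch t) u Ju); last first.
  by near: u; exact: (patch_near_comp (cg t) (chP t)).
rewrite /h; congr (_ * _^-1)%g; near: u; [exact: Fb|exact: Fb'].
Unshelve. all: by end_near. Qed.

(** That the value at time [t] is locally constant in [s] is, as a proposition, locally constant in
    [t], and it holds at time 0. At time 1 all rows are at [s0], so the value in the chart [i0] is
    constant in [s]. *)
Lemma section_homotopy (H : R * R -> surface R g) (F : R -> chart -> R -> G)
    (s0 : surface R g) i0 :
  continuous H -> (forall s, H (s, 0) = s0) ->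
  (forall s, H (s, 1) = s0) ->
  (forall s t, -1 <= t <= 2 -> section_at (fun u => H (s, u)) (F s) t) ->
  in_patch i0 s0 -> (forall s, F s i0 0 = F 0 i0 0) ->
  F 0 i0 1 = F 1 i0 1.
Proof.
move=> cH H0 H1 FP i0P F0.
have cs s : continuous (fun u : R => H (s, u)).
  apply: continuous_compT cH; apply: continuous_pair => u; last exact: cvg_id.
  exact: cvg_cst.
have ct t : continuous (fun u : R => H (u, t)).
  apply: continuous_compT cH; apply: continuous_pair => u; first exact: cvg_id.
  exact: cvg_cst.
suff main s1 t : 0 <= t <= 1 -> forall i, in_patch i (H (s1, t)) ->
    \forall s \near s1, F s i t = F s1 i t.
  have : forall s1 : R, \forall s \near s1, F s i0 1 = F s1 i0 1.
    by move=> s1; apply: main; rewrite ?H1 // lexx ler01.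
  by move/locally_constant_line; apply.
pose Q t := forall i, in_patch i (H (s1, t)) ->
    \forall s \near s1, F s i t = F s1 i t.
have Q0 : Q 0.
  move=> i; rewrite H0 => i0i; near=> s.
  have [Fa _] := FP s 0 ltac:(lra); have [Fa' _] := FP s1 0 ltac:(lra).
  by rewrite (Fa i0 i) ?(Fa' i0 i) ?H0 // (F0 s) (F0 s1).
move=> t01; suff -> : (forall i, in_patch i (H (s1, t)) ->
    \forall s \near s1, F s i t = F s1 i t) = Q 0 by [].
rewrite -/(Q t); move: t01 => /= t01.
have iJ : is_interval [set u : R | 0 <= u <= 1] by move=> u v /= ? ? w; lra.
apply: (locally_constant iJ _ t01); last by rewrite /= lexx ler01.
move=> {t t01} t0 /= t01.
have [i it0] := patch_cover (H (s1, t0)).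
have nIJ : \forall y \near (s1, t0), in_patch i (H y).
  exact: (patch_near_comp (cH (s1, t0)) it0).
have /nbhs_ballP[e /= e0 eJ] := nIJ.
(* The radius is at most 1 so that the times stay in [-1, 2], where the sections are given. *)
pose d := Num.min e 1.
have d0 : 0 < d by rewrite lt_min e0 ltr01.
have box s t : ball s1 e s -> ball t0 d t -> in_patch i (H (s, t)).
  move=> Is Jt; apply: eJ; split => //=.
  by move: Jt; rewrite /ball /= lt_min => /andP[].
have J2 t : ball t0 d t -> -1 <= t <= 2.
  rewrite /ball /= lt_min => /andP[_]; rewrite ltr_distlC; lra.
have ballI : is_interval (ball t0 d).
  move=> u v; rewrite /ball /= !ltr_distlC => ud vd w uvw; rewrite ltr_distlC; lra.
have Fcst s t : ball s1 e s -> ball t0 d t -> F s i t = F s i t0.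
  move=> Is Jt; apply: (locally_constant ballI) => //; last exact: ballxx.
  move=> u Ju; have [_ Fb] := FP s u (J2 u Ju).
  by near=> v => _; near: v; apply: Fb; exact: box.
have Is1 : ball s1 e s1 by exact: ballxx.
near=> t => _.
have Jt : ball t0 d t by near: t; exact: nbhsx_ballx.
(* In the box the value in the patch [i] does not depend on the time, so every [Q u] is equivalent
   to one condition at [t0]. *)
suff QE u : ball t0 d u -> Q u <-> \forall s \near s1, F s i t0 = F s1 i t0.
  by rewrite (propext (QE t Jt)) (propext (QE t0 (ballxx _ d0))).
move=> Ju; split=> [Qu|Fi j ju].
  near=> s.
  have Is : ball s1 e s by near: s; exact: nbhsx_ballx.
  rewrite -(Fcst s u) // -(Fcst s1 u) //; near: s.
  by apply: Qu; exact: box.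
have iu : in_patch i (H (s1, u)) by exact: box.
have njs := patch_near_comp (ct u s1) ju.
have ntr := transition_near_comp (ct u s1) iu ju.
near=> s.
have Is : ball s1 e s by near: s; exact: nbhsx_ballx.
have [Fa _] := FP s u (J2 u Ju); have [Fa' _] := FP s1 u (J2 u Ju).
have jsu : in_patch j (H (s, u)) by near: s.
have isu : in_patch i (H (s, u)) by exact: box.
have trE : transition i j (H (s, u)) = transition i j (H (s1, u)) by near: s.
have FE : F s i t0 = F s1 i t0 by near: s.
by rewrite (Fa i j) // (Fa' i j) // (Fcst s u) // (Fcst s1 u) // FE trE.
Unshelve. all: by end_near. Qed.

End Monodromy.

Lemma near_continuous (X Y : topologicalType) (f : X -> Y) (P : Y -> Prop)
    (t : X) : continuous f ->
  (\forall u \near f t, P u) -> \forall u \near t, P (f u).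
Proof. by move=> cf; exact: cf. Qed.

(** * Framing by segments inside the disc *)

Section Frame.
Local Open Scope classical_set_scope.
Local Open Scope ring_scope.
Context {R : realType} (g : nat).
Local Notation D := (@disc R).
Local Notation pr := (@surface_pr R g).

Definition disc_seg (d e : D) (t : R) : D :=
  let s := clamp t in
  to_disc ((1 - s) * (val d).1 + s * (val e).1, (1 - s) * (val d).2 + s * (val e).2).

Lemma plane_norm_conv (a b : R * R) (s : R) : 0 <= s <= 1 ->
  plane_norm a <= 1 -> plane_norm b <= 1 ->
  plane_norm ((1 - s) * a.1 + s * b.1, (1 - s) * a.2 + s * b.2) <= 1.
Proof.
move=> s01; rewrite -!discP !inE /disc /= => a1 b1.
have s0 : 0 <= s by lra.
have s1 : 0 <= 1 - s by lra.
have : 0 <= s * (1 - s) * ((a.1 - b.1) ^+ 2 + (a.2 - b.2) ^+ 2).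
  by apply: mulr_ge0; [exact: mulr_ge0|rewrite addr_ge0 ?sqr_ge0].
have : 0 <= (1 - s) * (1 - (a.1 ^+ 2 + a.2 ^+ 2)) by rewrite mulr_ge0 //; lra.
have : 0 <= s * (1 - (b.1 ^+ 2 + b.2 ^+ 2)) by rewrite mulr_ge0 //; lra.
nra.
Qed.

Lemma disc_seg_norm (d e : D) (t : R) :
  plane_norm ((1 - clamp t) * (val d).1 + clamp t * (val e).1,
    (1 - clamp t) * (val d).2 + clamp t * (val e).2) <= 1.
Proof.
have := clamp_itv t; rewrite in_itv /= => t01.
by apply: plane_norm_conv t01 _ _; exact: disc_norm.
Qed.

Lemma disc_seg_continuous d e : continuous (disc_seg d e).
Proof.
have cc : continuous (@clamp R) by exact: clamp_continuous.
have ck (c : R) : continuous (fun t : R => c) by move=> t; exact: cvg_cst.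
apply: to_disc_continuous; last by move=> t; exact: disc_seg_norm.
by apply: continuous_pair; apply: continuous_addr; apply: continuous_mulr => //;
  apply: continuous_subr.
Qed.

Lemma disc_seg0 d e : disc_seg d e 0 = d.
Proof.
rewrite /disc_seg clamp_low //= subr0 !mul0r !mul1r !addr0.
by rewrite -surjective_pairing val_to_disc.
Qed.

Lemma disc_seg1 d e : disc_seg d e 1 = e.
Proof.
rewrite /disc_seg clamp_high //= subrr !mul0r !mul1r !add0r.
by rewrite -surjective_pairing val_to_disc.
Qed.

Lemma disc_seg_id d : disc_seg d d = cst d.
Proof.
apply/funext => t; rewrite /disc_seg -!mulrDl subrK !mul1r.
by rewrite -surjective_pairing val_to_disc.
Qed.

Lemma pr_path (f : R -> D) d e : continuous f -> f 0 = d -> f 1 = e ->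
  path_from_to (fun t => pr (f t)) (pr d) (pr e).
Proof.
move=> cf <- <-; split => //; apply: continuous_compT cf _.
exact: surface_pr_continuous.
Qed.

Context (x : surface R g).

Definition frame (d : D) (t : R) : surface R g := pr (disc_seg (repr x) d t).

Lemma frameP d : path_from_to (frame d) x (pr d).
Proof.
rewrite -{1}(surface_pr_repr x).
by apply: pr_path; [exact: disc_seg_continuous|exact: disc_seg0|exact: disc_seg1].
Qed.

(* [zeta p q] is the loop that runs to [p] inside the disc, jumps to the
   identified point [q] and runs back. *)
Definition zeta (p q : D) : pi1 R x := framed x frame p (cst (pr p)) q.

End Frame.

(** * Monodromy as a homomorphism *)

Section Monodromy.
Local Open Scope classical_set_scope.
Local Open Scope ring_scope.
Context {R : realType} (g : nat) (g0 : (0 < g)%N) {G : groupType}.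
Local Notation D := (@disc R).
Local Notation N := (8 * g)%N.
Local Notation pr := (@surface_pr R g).
Local Notation in_chart := (@in_chart R g).

Context (label : nat -> G) (side_label : 'I_g -> bool -> G).
Context (labelP : forall k c n,
  (side_low k c <= n <= side_low k c + 2)%N ->
  label ((2 * side_low k c + 6 - n) %% N)%N = (label n * side_label k c)%g).
Local Notation lab := (@lab R g G label).
Local Notation transition := (@transition R g G label).
Local Notation in_patch := (@in_patch R g).
Local Notation section_at := (@section_at R g G label).
Implicit Types (f : R -> surface R g).

Definition chart_of (d : D) : chart := projT1 (cid (in_chart_cover g0 d)).

Lemma chart_ofP d : in_chart (chart_of d) d.
Proof. exact: projT2 (cid (in_chart_cover g0 d)). Qed.

(** The value of the section over the lift [d], measured against the labels of the polygon. As
    [F j = F i * lab i * (lab j)^-1], any chart around [d] gives the same value. *)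
Definition tile (F : chart -> R -> G) (t : R) (d : D) : G :=
  (F (chart_of d) t * lab (chart_of d) d)%g.

Lemma tileE f F t d i : section_at f F t -> f t = pr d -> in_chart i d ->
  tile F t d = (F i t * lab i d)%g.
Proof.
move=> [Fa _] fd id; have cd := chart_ofP d.
rewrite /tile (Fa i) ?fd ?in_patchE // (transitionE g0 labelP) //.
by rewrite -mulgA mulgVK.
Qed.

Definition section_on f (F : chart -> R -> G) :=
  forall t, 0 <= t <= 1 -> section_at f F t.

(** The left factor by which two sections differ cancels, so the choice of the section is
    immaterial; 1 is a junk value for the case of no section. *)
Definition monodromy f d e : G :=
  if pselect (exists F, section_on f F) is left h then
    ((tile (projT1 (cid h)) 0 d)^-1 * tile (projT1 (cid h)) 1 e)%g
  else 1%g.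

Lemma monodromyE f d e F : path_from_to f (pr d) (pr e) -> section_on f F ->
  monodromy f d e = ((tile F 0 d)^-1 * tile F 1 e)%g.
Proof.
move=> [cf f0 f1] FP; rewrite /monodromy; case: pselect => [h|]; last first.
  by case; exists F.
case: (cid h) => F' F'P /=.
have iJ : is_interval [set u : R | 0 <= u <= 1] by move=> u v /= ? ? w; lra.
have [h' hE] := section_unique g0 cf iJ F'P FP.
have i0 : 0 <= (0 : R) <= 1 by lra.
have i1 : 0 <= (1 : R) <= 1 by lra.
have p0 : in_patch (chart_of d) (f 0) by rewrite f0 in_patchE // chart_ofP.
have p1 : in_patch (chart_of e) (f 1) by rewrite f1 in_patchE // chart_ofP.
by rewrite /tile !hE // -!mulgA invgM -mulgA mulKg.
Qed.

Lemma section_on_exists f : continuous f -> exists F, section_on f F.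
Proof. by move=> cf; exact: (section_exists g0 labelP 0 1 cf). Qed.

Lemma monodromy_cat f h d e c : path_from_to f (pr d) (pr e) ->
  path_from_to h (pr e) (pr c) ->
  monodromy (path_cat f h) d c = (monodromy f d e * monodromy h e c)%g.
Proof.
move=> hf hh; have hfh := path_catP hf hh.
have [cfh _ _] := hfh; have [F FP] := section_on_exists cfh.
have FE1 : section_on f (fun i t => F i (2^-1 * t)).
  move=> t t01; have [|Fa Fb] := FP (2^-1 * t); first lra.
  have fE : path_cat f h (2^-1 * t) = f t.
    rewrite /path_cat ifT; last lra.
    by rewrite mulrA divff ?pnatr_eq0 // mul1r.
  rewrite fE in Fa Fb; split=> // i it.
  have ca : continuous (fun u : R => 2^-1 * u) by exact: mulrl_continuous.
  exact: (near_continuous ca (Fb i it)).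
have FE2 : section_on h (fun i t => F i (2^-1 * t + 2^-1)).
  move=> t t01; have [|Fa Fb] := FP (2^-1 * t + 2^-1); first lra.
  have fE : path_cat f h (2^-1 * t + 2^-1) = h t.
    have [t0|t0] := eqVneq t 0.
      rewrite t0 mulr0 add0r /path_cat lexx divff ?pnatr_eq0 //.
      by case: hf hh => _ _ -> [_ -> _].
    rewrite /path_cat ifF; last first.
      apply/negbTE; rewrite -ltNge.
      have : 0 < t by rewrite lt_neqAle eq_sym t0; lra.
      lra.
    by congr h; field.
  rewrite fE in Fa Fb; split=> // i it.
  have ca : continuous (fun u : R => 2^-1 * u + 2^-1) by exact: continuous_affine.
  exact: (near_continuous ca (Fb i it)).
rewrite (monodromyE hfh FP) (monodromyE hf FE1) (monodromyE hh FE2).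
rewrite /tile mulr0 mulr1 add0r (_ : 2^-1 + 2^-1 = 1 :> R); last lra.
by rewrite [RHS]mulgA mulgK.
Qed.

(** Along a path that lifts to the polygon the inverse labels form a section, and its [tile] is
    constantly 1. *)
Lemma monodromy_lift (f : R -> D) d e : continuous f -> f 0 = d -> f 1 = e ->
  monodromy (fun t => pr (f t)) d e = 1%g.
Proof.
move=> cf f0 f1; have hf := pr_path g cf f0 f1.
have FP : section_on (fun t => pr (f t)) (fun i t => (lab i (f t))^-1%g).
  move=> t _; split=> [i j|i]; rewrite !in_patchE // => it.
    by move=> jt; rewrite (transitionE g0 labelP) // mulKg.
  have nl : \forall u \near t, in_chart i (f u) /\ lab i (f u) = lab i (f t).
    exact: (cf t _ (lab_near g0 label it)).
  by apply: filterS nl => u [_ ->].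
by rewrite (monodromyE hf FP) /tile f0 f1 !mulVg.
Unshelve. all: by end_near. Qed.

Lemma monodromy_rev f d e : path_from_to f (pr d) (pr e) ->
  monodromy (path_rev f) e d = (monodromy f d e)^-1%g.
Proof.
move=> hf; have hr := path_revP hf; have [cf _ _] := hf.
have [F FP] := section_on_exists cf.
have FR : section_on (path_rev f) (fun i t => F i (1 - t)).
  move=> t t01; have [|Fa Fb] := FP (1 - t); first lra.
  split=> // i it.
  have ca : continuous (fun u : R => 1 - u).
    by apply: continuous_subr => u; [exact: cvg_cst|exact: cvg_id].
  exact: (near_continuous ca (Fb i it)).
by rewrite (monodromyE hr FR) (monodromyE hf FP) /tile subr0 subrr [RHS]invgM invgK.
Qed.

Lemma monodromy_homotopic f h d : path_from_to f (pr d) (pr d) ->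
  path_from_to h (pr d) (pr d) -> path_homotopic f h ->
  monodromy f d d = monodromy h d d.
Proof.
move=> hf hh [H [cH Hf Hh He]]; have [_ f0 f1] := hf.
have cs s : continuous (fun u : R => H (s, u)).
  apply: continuous_compT cH; apply: continuous_pair => u; last exact: cvg_id.
  exact: cvg_cst.
pose i0 := chart_of d.
have H0 s : H (s, 0) = pr d by rewrite (He s).1.
have H1 s : H (s, 1) = pr d by rewrite (He s).2.
have [F FP] : exists F : R -> chart -> R -> G, forall s,
    (forall t, -1 <= t <= 2 -> section_at (fun u => H (s, u)) (F s) t) /\
    F s i0 0 = 1%g.
  suff /choice[F FP] : forall s, exists F : chart -> R -> G,
    (forall t, -1 <= t <= 2 -> section_at (fun u => H (s, u)) F t) /\
    F i0 0 = 1%g by exists F.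
  move=> s; have [F FP] := section_exists g0 labelP (-1) 2 (cs s).
  (* Left multiplication preserves sections, so all rows can be made to start at 1. *)
  exists (fun i t => ((F i0 0)^-1 * F i t)%g); rewrite mulVg; split=> // t t01.
  by apply: section_mull; exact: FP.
have i0P : in_patch i0 (pr d) by rewrite in_patchE // chart_ofP.
have F01 : F 0 i0 1 = F 1 i0 1.
  apply: (section_homotopy g0 labelP cH H0 H1 _ i0P).
    by move=> s t t01; apply: (FP s).1.
  by move=> s; rewrite (FP s).2 (FP 0).2.
have Ff : section_on f (F 0).
  move=> t t01; have tI : t \in `[0, 1] by rewrite in_itv.
  by have [|] := (FP 0).1 t; [lra|rewrite Hf].
have Fh : section_on h (F 1).
  move=> t t01; have tI : t \in `[0, 1] by rewrite in_itv.
  by have [|] := (FP 1).1 t; [lra|rewrite Hh].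
rewrite (monodromyE hf Ff) (monodromyE hh Fh) /tile -/i0 F01.
by rewrite (FP 0).2 (FP 1).2.
Qed.

Context (x : surface R g).

Definition monodromy_pi1 (w : pi1 R x) : G :=
  monodromy (repr w \o clamp) (repr x) (repr x).

Lemma monodromy_pi1E f : path_from_to f x x ->
  monodromy_pi1 (path_class x f) = monodromy f (repr x) (repr x).
Proof.
move=> hf; rewrite /monodromy_pi1.
set w := path_class x f; set l := repr w.
have [lw hl] := path_class_loop l.
have xE : pr (repr x) = x by exact: surface_pr_repr.
have fE : w = path_class x (l \o clamp) by rewrite lw loop_class_repr.
apply: monodromy_homotopic; rewrite ?xE //.
move: fE; rewrite /w /path_class.
case: pselect => // {}hf; case: pselect => // {}hl.
move=> /esym/loop_classP/homotopic_clamp[H [cH H0 H1 He]]; exists H; split=> //.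
- by move=> t t01; rewrite H0 loop_of_pathE clamp_id.
- by move=> t t01; rewrite H1 loop_of_pathE clamp_id.
- by move=> s; have [-> ->] := He s; case: (hl) => _ -> ->.
Qed.

Lemma path_class_surj (w : pi1 R x) :
  exists2 f, path_from_to f x x & w = path_class x f.
Proof.
have [lw hl] := path_class_loop (repr w); exists (repr w \o clamp) => //.
by rewrite lw loop_class_repr.
Qed.

Lemma monodromy_pi1M : {morph monodromy_pi1 : u v / (u * v)%g >-> (u * v)%g}.
Proof.
move=> u v; have [f hf ->] := path_class_surj u; have [h hh ->] := path_class_surj v.
rewrite -path_class_cat // !monodromy_pi1E //; last exact: path_catP hf hh.
by apply: monodromy_cat; rewrite surface_pr_repr.
Qed.

(** The two framing segments lift to the polygon and contribute nothing; only the jump from [p] to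
    [q] does. *)
Lemma monodromy_zeta p q i : pr p = pr q -> in_chart i p ->
  monodromy_pi1 (zeta x p q) = ((lab i p)^-1 * lab i q)%g.
Proof.
move=> pq ip; have xE : pr (repr x) = x by exact: surface_pr_repr.
have hc : path_from_to (cst (pr p) : R -> surface R g) (pr p) (pr q).
  by rewrite pq; exact: path_cstP.
have hp : path_from_to (frame x p) (pr (repr x)) (pr p).
  by rewrite xE; exact: frameP.
have hq : path_from_to (frame x q) (pr (repr x)) (pr q).
  by rewrite xE; exact: frameP.
rewrite /zeta /framed monodromy_pi1E; last exact: framed_path (frameP x) _ _ _ hc.
have m1 d : monodromy (frame x d) (repr x) d = 1%g.
  by apply: monodromy_lift; [exact: disc_seg_continuous|exact: disc_seg0|exact: disc_seg1].
rewrite (monodromy_cat (e := q)) ?(path_catP hp hc) //; last exact: path_revP hq.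
rewrite (monodromy_cat hp hc) monodromy_rev // !m1 invg1 mulg1 mul1g.
have FP : section_on (cst (pr p)) (fun j _ => (lab j p)^-1%g).
  move=> t _; split=> [j k|j] /=; rewrite !in_patchE // => jp; last first.
    exact: filterE.
  by move=> kp; rewrite (transitionE g0 labelP) // mulKg.
have i0 : 0 <= (0 : R) <= 1 by lra.
have i1 : 0 <= (1 : R) <= 1 by lra.
rewrite (monodromyE hc FP) (@tileE (cst (pr p)) _ _ p i (FP 0 i0)) //.
rewrite (@tileE (cst (pr p)) _ _ q i (FP 1 i1)) ?mulVg ?invg1 ?mul1g //.
by rewrite -(in_chart_pr g0 i pq).
exact: path_catP hp hc.
Qed.

End Monodromy.

Lemma continuous_pair_at (X Y Z : topologicalType) (f : X -> Y) (h : X -> Z)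
    (y : X) : {for y, continuous f} -> {for y, continuous h} ->
  {for y, continuous (fun z => (f z, h z))}.
Proof. by move=> cf ch; apply: cvg_pair; [exact: cf|exact: ch]. Qed.

(** * The standard presentation *)

Section Contraction.
Local Open Scope classical_set_scope.
Local Open Scope ring_scope.
Context {R : realType} (g : nat) (g0 : (0 < g)%N).
Local Notation D := (@disc R).
Local Notation N := (8 * g)%N.
Local Notation pr := (@surface_pr R g).
Local Notation in_chart := (@in_chart R g).
Local Notation in_patch := (@in_patch R g).

(* Contracts a chart onto the centre of the disc, or each of its cones onto the
   boundary point in its middle, in a way that is compatible with the gluing. *)
Definition chart_contract (i : chart) (d : D) (u : R) : D :=
  let s := clamp u in
  match i with
  | None => to_disc ((1 - s) * (val d).1, (1 - s) * (val d).2)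
  | Some b => let n := (node g b d)%:R in let r := plane_norm (val d) in
      disc_polar g (r + (1 - r) * s) (n + (1 - s) * cone_angle g n (val d))
  end.

Lemma chart_contract0 i d : in_chart i d -> chart_contract i d 0 = d.
Proof.
rewrite /chart_contract clamp_low //; case: i => [b|] id; last first.
  by rewrite subr0 !mul1r -surjective_pairing val_to_disc.
have [_ _ /(coneE g0)[_ _ dE]] := nodeP id.
by rewrite mulr0 addr0 subr0 mul1r /disc_polar -dE val_to_disc.
Qed.

(** Glued points lie on the boundary, where the radial part is at rest and the offset from the
    centre is scaled; the scaling commutes with the reflection, which only changes the sign of the
    offset. *)
Lemma chart_contract_pr i p q u : pr p = pr q -> in_chart i p ->
  pr (chart_contract i p u) = pr (chart_contract i q u).
Proof.
move=> pq ip; suff [_] : in_chart i p = in_chart i q /\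
  (in_chart i p -> pr (chart_contract i p u) = pr (chart_contract i q u)) by apply.
move: p q pq {ip}; apply: surface_pr_ind.
- by move=> p; split.
- by move=> p q [pq H]; split=> // iq; rewrite H // pq.
- move=> p q s [pq H] [qs H']; split=> [|ip]; first by rewrite pq.
  by rewrite H // H' // -pq.
- move=> p q pq; split=> [|]; first exact/in_chart_pr/surface_pr_glued.
  move/(gluedE g0) : pq => [k [c [v [v01 -> ->]]]].
  case: i => [b|]; last first.
    by have [/negbTE ->] := side_interior g (side_low k c) v.
  move=> /(chart_side_l g0 erefl v01)[n [nlo <- vn]] /=.
  have [_ -> -> -> ->] := chart_side g0 erefl v01 nlo vn.
  have i1 : 0 <= (1 : R) <= 1 by lra.
  rewrite !val_disc_polar // !norm_polar // subrr mul0r addr0.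
  apply/surface_pr_glued/(gluedE g0).
  have := clamp_itv u; rewrite in_itv /=; set s := clamp u => s01.
  exists k, c, (n%:R + (1 - s) * (v - n%:R)); split=> //.
    have n1 : (side_low k c)%:R <= n%:R :> R by rewrite ler_nat; lia.
    have n2 : n%:R <= (side_low k c)%:R + 2 :> R by rewrite -natrD ler_nat; lia.
    have [v0 v1] := andP v01; have [s0 s1] := andP s01.
    rewrite (_ : _ + _ = s * n%:R + (1 - s) * v); last ring.
    by apply/andP; split; nra.
  have lN := side_low_le g0 k c.
  have sE : (2 * side_low k c + 6)%:R = n%:R + (2 * side_low k c + 6 - n)%:R :> R.
    by rewrite -natrD; congr _%:R; lia.
  rewrite sE; set m := (2 * _ + 6 - n)%N.
  have mN : (m <= N)%N by rewrite /m; lia.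
  rewrite (_ : _ + _ - _ = m%:R + (1 - s) * (n%:R - v)); last ring.
  move: mN; rewrite leq_eqVlt => /orP[/eqP ->|mN]; last by rewrite modn_small.
  by rewrite modnn add0r [in RHS]addrC disc_polar_period.
Qed.

Lemma disc_polar_continuous :
  continuous (fun y : R * R => disc_polar g (clamp y.1) y.2).
Proof.
apply: to_disc_continuous => [|y]; last first.
  have := clamp_itv y.1; rewrite in_itv /= => /andP[s0 s1].
  by rewrite norm_polar.
have c1 : continuous (fun y : R * R => clamp y.1).
  by apply: continuous_compT clamp_continuous; exact: continuous_fst.
have c2 : continuous (fun y : R * R => y.2 * @unit_angle R g).
  by apply: continuous_mulr => [|y]; [exact: continuous_snd|exact: cvg_cst].
apply: continuous_pair; apply: continuous_mulr => //.
  by apply: continuous_compT c2 _ => y; exact: continuous_cos.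
by apply: continuous_compT c2 _ => y; exact: continuous_sin.
Qed.

(** As [node] is locally constant, the contraction is a fixed formula near [d]; its quotient is
    continuous because [dot_dir] is positive on the cone. *)
Lemma chart_contract_continuous i d u : in_chart i d ->
  {for (d, u), continuous (fun y : D * R => chart_contract i y.1 y.2)}.
Proof.
have cv1 : continuous (fun y : D * R => (val y.1).1).
  apply: (@continuous_compT _ _ _ (fun y : D * R => val y.1) fst).
    apply: (@continuous_compT _ _ _ fst (fun p : D => val p)).
      exact: continuous_fst.
    exact: val_disc_continuous.
  exact: continuous_fst.
have cv2 : continuous (fun y : D * R => (val y.1).2).
  apply: (@continuous_compT _ _ _ (fun y : D * R => val y.1) snd).
    apply: (@continuous_compT _ _ _ fst (fun p : D => val p)).
      exact: continuous_fst.
    exact: val_disc_continuous.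
  exact: continuous_snd.
have cv : continuous (fun y : D * R => val y.1).
  apply: (@continuous_compT _ _ _ fst (fun p : D => val p)).
    exact: continuous_fst.
  exact: val_disc_continuous.
have cs : continuous (fun y : D * R => clamp y.2).
  by apply: continuous_compT clamp_continuous; exact: continuous_snd.
have ck (c : R) : continuous (fun y : D * R => c) by move=> y; exact: cvg_cst.
have c1s : continuous (fun y : D * R => 1 - clamp y.2) by apply: continuous_subr.
case: i => [b|] id; last first.
  move: (d, u); apply: to_disc_continuous.
    by apply: continuous_pair; apply: continuous_mulr.
  move=> y; have := clamp_itv y.2; rewrite in_itv /= => s01.
  have := @plane_norm_conv R (val y.1) (0, 0) _ s01 (disc_norm _).
  rewrite !mulr0 !addr0; apply.
  by rewrite /plane_norm /= expr0n /= addr0 sqrtr0.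
have [_ _ cd] := nodeP id; set n := node g b d in cd.
have [cn cdot ccross] := @cone_cst_continuous R g.
pose F (y : D * R) := (plane_norm (val y.1) + (1 - plane_norm (val y.1)) * clamp y.2,
   n%:R + (1 - clamp y.2) * cone_angle g n%:R (val y.1)).
have cF : {for (d, u), continuous F}.
  have cnv : continuous (fun y : D * R => plane_norm (val y.1)).
    by apply: (continuous_compT cv).
  apply: (@continuous_pair_at _ _ _ (fun y : D * R =>
      plane_norm (val y.1) + (1 - plane_norm (val y.1)) * clamp y.2)
    (fun y : D * R => n%:R + (1 - clamp y.2) * cone_angle g n%:R (val y.1))).
    have : continuous (fun y : D * R =>
        plane_norm (val y.1) + (1 - plane_norm (val y.1)) * clamp y.2).
      apply: continuous_addr => //; apply: continuous_mulr => //.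
      exact: continuous_subr.
    by apply.
  apply: (@continuousD R R _ (fun=> n%:R)
    (fun y : D * R => (1 - clamp y.2) * cone_angle g n%:R (val y.1)) (d, u)).
    exact: cvg_cst.
  apply: (@continuousM R _ (fun y : D * R => 1 - clamp y.2)
    (fun y : D * R => cone_angle g n%:R (val y.1)) (d, u)); first exact: c1s.
  apply: (@continuousM R _ (fun y : D * R => atan (cross_dir g n%:R (val y.1) /
      dot_dir g n%:R (val y.1))) (fun=> (unit_angle g)^-1) (d, u)); last first.
    exact: cvg_cst.
  apply: (@continuous_comp _ _ _ (fun y : D * R => cross_dir g n%:R (val y.1) /
      dot_dir g n%:R (val y.1)) atan (d, u)); last exact: continuous_atan.
  apply: (@continuousM R _ (fun y : D * R => cross_dir g n%:R (val y.1))
    (fun y : D * R => (dot_dir g n%:R (val y.1))^-1) (d, u)).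
    exact: (continuous_compT cv (ccross _)).
  apply: continuousV; last exact: (continuous_compT cv (cdot _)).
  rewrite /= gt_eqF //; apply: le_lt_trans cd.
  by rewrite mulr_ge0 ?plane_norm_ge0 // ltW // cos_unit_gt0.
have FE (y : D * R) : node g b y.1 = n ->
    chart_contract (Some b) y.1 y.2 = disc_polar g (clamp (F y).1) (F y).2.
  move=> ny; rewrite /chart_contract ny [clamp (F y).1]clamp_id //.
  have := clamp_itv y.2; rewrite !in_itv /= => /andP[s0 s1].
  have r0 := plane_norm_ge0 (val y.1); have r1 := disc_norm y.1.
  by apply/andP; split; nra.
have nn : \forall y \near (d, u), node g b y.1 = n.
  have := node_near g0 id => /= nd.
  have nd' : \forall y \near d, node g b y = n by apply: filterS nd => y [].
  exact: (@continuous_fst D R (d, u) _ nd').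
have FE0 : chart_contract (Some b) d u = disc_polar g (clamp (F (d, u)).1) (F (d, u)).2.
  exact: (FE (d, u) erefl).
suff : (fun y : D * R => chart_contract (Some b) y.1 y.2) @ (d, u) -->
  chart_contract (Some b) d u by [].
rewrite FE0.
have cDF : (fun y => disc_polar g (clamp (F y).1) (F y).2) @ (d, u) -->
    disc_polar g (clamp (F (d, u)).1) (F (d, u)).2.
  exact: (continuous_comp cF (@disc_polar_continuous (F (d, u)))).
apply: cvg_trans cDF; apply: near_eq_cvg; near=> y.
by rewrite FE //; near: y.
Unshelve. all: by end_near. Qed.

End Contraction.

(** * Contraction of patches and generation by jumps *)

Section Generation.
Local Open Scope classical_set_scope.
Local Open Scope ring_scope.
Context {R : realType} (g : nat) (g0 : (0 < g)%N).
Local Notation D := (@disc R).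
Local Notation pr := (@surface_pr R g).
Local Notation in_chart := (@in_chart R g).
Local Notation in_patch := (@in_patch R g).

Definition patch_contract (i : chart) (s : surface R g) (u : R) : surface R g :=
  pr (chart_contract g i (repr s) u).

Lemma patch_contractE i d u : in_chart i d ->
  patch_contract i (pr d) u = pr (chart_contract g i d u).
Proof.
move=> id; apply: chart_contract_pr => //; first by rewrite surface_pr_repr.
by rewrite -/(in_patch i (pr d)) in_patchE.
Qed.

(* Whitehead's argument: as [chart_contract] respects the gluing, the set of points
   whose tracks over a compact interval of times stay in a given open set is
   saturated, and it is open by compactness. *)
Lemma patch_contract_continuous i s u : in_patch i s ->
  {for (s, u), continuous (fun y => patch_contract i y.1 y.2)}.
Proof.
move=> is_ W0 /= nW0; pose W := interior W0.
have oW : open W by exact: open_interior.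
have WW0 : W `<=` W0 by exact: interior_subset.
have Wsu : W (patch_contract i s u) by exact: nW0.
have cpr := @surface_pr_continuous R g.
have oW' : open (pr @^-1` W) by apply: open_comp => // ? _; exact: cpr.
have cC d v : in_chart i d -> W (pr (chart_contract g i d v)) ->
    \forall y \near (d, v), W (pr (chart_contract g i y.1 y.2)).
  move=> id Wd; have cc := @chart_contract_continuous R g g0 i d v id.
  apply: (cc (pr @^-1` W)); exact: open_nbhs_nbhs.
have idr : in_chart i (repr s) by exact: is_.
have c1 : \forall v \near u, W (pr (chart_contract g i (repr s) v)).
  have := cC _ _ idr Wsu => nW.
  have cp : continuous (fun v : R => (repr s, v)).
    apply: continuous_pair => v; [exact: cvg_cst|exact: cvg_id].
  exact: (cp u _ nW).
have [/= e e0 eW] : exists2 e : R, 0 < e & forall v, `|u - v| <= e ->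
    W (pr (chart_contract g i (repr s) v)).
  have /nbhs_ballP[e /= e0 eW] := c1; exists (e / 2); first by rewrite divr_gt0.
  by move=> v uv; apply: eW; rewrite /ball /=; apply: le_lt_trans uv _; lra.
pose J := `[u - e, u + e]%classic.
have JE v : J v <-> `|u - v| <= e.
  by rewrite /J /= in_itv /= ler_distlC.
pose V := [set d : D | in_chart i d /\ forall v, J v -> W (pr (chart_contract g i d v))].
have oV : open V.
  rewrite openE => d [id dW]; rewrite /interior /=.
  have cJ : near_covering J by apply/compact_near_coveringP; exact: segment_compact.
  have nV : \forall d' \near d, J `<=` [set v | W (pr (chart_contract g i d' v))].
    apply: (cJ D (nbhs d) (fun d' v => W (pr (chart_contract g i d' v)))) => v Jv.
    have := cC _ _ id (dW v Jv).
    case=> -[A B] /= [nA nB] AB; exists (B, A) => //= -[w d'] /= [Bw Ad'].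
    exact: (AB (d', w)).
  have ni : \forall d' \near d, in_chart i d'.
    by apply: open_nbhs_nbhs; split => //; exact: in_chart_open.
  near=> d'; split; first by near: d'.
  suff JV : J `<=` [set v | W (pr (chart_contract g i d' v))] by move=> v /JV.
  by near: d'.
pose V' := [set t : surface R g | in_patch i t /\
  forall v, J v -> W (patch_contract i t v)].
have oV' : open V'.
  rewrite surface_open (_ : _ @^-1` _ = V) //; apply/seteqP; split => d /=.
    by move=> []; rewrite in_patchE // => id dW; split=> // v /dW; rewrite patch_contractE.
  move=> [id dW]; split; first by rewrite in_patchE.
  by move=> v /dW; rewrite patch_contractE.
have nV' : \forall t \near s, V' t.
  apply: open_nbhs_nbhs; split => //; split=> // v /JE; exact: eW.
have nJ : \forall v \near u, J v.
  near=> v; apply/JE; apply: ltW; near: v.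
  have : nbhs u (ball u e) by exact: nbhsx_ballx.
  by apply: filterS => v.
exists (V', J) => // -[t v] /= [[_ tW] Jv]; apply: WW0; exact: tW.
Unshelve. all: by end_near. Qed.

Context (x : surface R g).
Local Notation frame := (frame x).
Local Notation framed := (framed x frame).
Local Notation zeta := (zeta x).

(* The radial retraction of the plane onto the disc. *)
Definition retract_disc (z : R * R) : D :=
  let m := Num.max 1 (plane_norm z) in to_disc (z.1 / m, z.2 / m).

Lemma retract_disc_continuous : continuous retract_disc.
Proof.
have [cn _ _] := @cone_cst_continuous R g.
have m0 (z : R * R) : 0 < Num.max 1 (plane_norm z) by rewrite lt_max ltr01.
apply: to_disc_continuous => [|z].
  have cm : continuous (fun z : R * R => (Num.max 1 (plane_norm z))^-1).
    move=> z; apply: (@continuousV R _ (fun z : R * R => Num.max 1 (plane_norm z))).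
      by rewrite gt_eqF.
    apply: continuous_maxr => //; by move=> ?; exact: cvg_cst.
  by apply: continuous_pair; apply: continuous_mulr => //;
    [exact: continuous_fst|exact: continuous_snd].
have mz := m0 z; set m := Num.max _ _ in mz *.
have mi : 0 <= m^-1 by rewrite invr_ge0 ltW.
rewrite /plane_norm /= !exprMn -mulrDl exprVn sqrtrM ?addr_ge0 ?sqr_ge0 //.
rewrite -/(plane_norm z) -exprVn sqrtr_sqr ger0_norm //.
by rewrite ler_pdivrMr // mul1r /m le_max lexx orbT.
Qed.

Lemma retract_disc_val d : retract_disc (val d) = d.
Proof.
by rewrite /retract_disc max_l ?disc_norm // !divr1 -surjective_pairing val_to_disc.
Qed.

(** The disc is a retract of the plane, so two paths in it with common ends are joined by a
    straight-line homotopy. *)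
Lemma framed_lift (f : R -> D) d e : continuous f -> f 0 = d -> f 1 = e ->
  framed d (fun t => pr (f t)) e = 1%g.
Proof.
move=> cf f0 f1; apply: framed1 (pr_path g cf f0 f1) _; first exact: frameP.
pose a := path_cat (disc_seg (repr x) d) f; pose b := disc_seg (repr x) e.
have ha : path_from_to a (repr x) e.
  apply: (path_catP (q := d)); last by split.
  by split; [exact: disc_seg_continuous|exact: disc_seg0|exact: disc_seg1].
have [ca a0 a1] := ha.
apply: (@path_homotopic_plane _ _ (fun z => pr (retract_disc z))
  (fun t => val (a t)) (fun t => val (b t))).
- apply: continuous_compT retract_disc_continuous _; exact: surface_pr_continuous.
- by apply: continuous_compT ca _; exact: val_disc_continuous.
- apply: continuous_compT (@disc_seg_continuous _ _ _) _.
  exact: val_disc_continuous.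
- by rewrite a0 /b disc_seg0.
- by rewrite a1 /b disc_seg1.
- by move=> t _; rewrite retract_disc_val /a /path_cat; case: ifP.
- by move=> t _; rewrite retract_disc_val.
Qed.

Lemma zeta_path p q : pr p = pr q ->
  path_from_to (cst (pr p) : R -> surface R g) (pr p) (pr q).
Proof. by move=> <-; exact: path_cstP. Qed.

Lemma cat_cst (s : surface R g) : path_cat (cst s) (cst s) = (cst s : R -> _).
Proof. by apply/funext => t; rewrite /path_cat /=; case: ifP. Qed.

Lemma zetaM p q s : pr p = pr q -> pr q = pr s ->
  (zeta p q * zeta q s)%g = zeta p s.
Proof.
move=> pq qs.
have := framed_cat (@frameP R g x) (zeta_path pq) (zeta_path qs).
have -> : path_cat (cst (pr p)) (cst (pr q)) = (cst (pr p) : R -> _).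
  by rewrite -pq cat_cst.
exact.
Qed.

Lemma zeta1 p : zeta p p = 1%g.
Proof. exact: (framed_cst1 (@frameP R g x)). Qed.

Lemma zetaV p q : pr p = pr q -> zeta q p = (zeta p q)^-1%g.
Proof. by move=> pq; apply: (mulgI (zeta p q)); rewrite mulgV zetaM // zeta1. Qed.

(** Sliding a pair of identified points along two lifts of the same path does not change the class
    of the jump. *)
Lemma zeta_lift (f h : R -> D) p q p' q' :
  continuous f -> continuous h -> (forall t, pr (f t) = pr (h t)) ->
  f 0 = p -> f 1 = p' -> h 0 = q -> h 1 = q' -> zeta p q = zeta p' q'.
Proof.
move=> cf ch fh f0 f1 h0 h1.
have lf := framed_lift cf f0 f1; have lh := framed_lift ch h0 h1.
have pf := pr_path g cf f0 f1; have ph := pr_path g ch h0 h1.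
have pq : pr p = pr q by rewrite -f0 -h0.
have pq' : pr p' = pr q' by rewrite -f1 -h1.
have phE : (fun t => pr (h t)) = (fun t => pr (f t)) by apply/funext.
have fr := @frameP R g x.
rewrite phE in lh ph.
have := framed_cat fr (zeta_path pq) ph; rewrite lh mulg1 -/(zeta p q) => ->.
have := framed_cat fr pf (zeta_path pq'); rewrite lf mul1g -/(zeta p' q') => ->.
have [cpf pf0 pf1] := pf.
apply: (framed_homotopic fr) => //.
- exact: path_catP (zeta_path pq) ph.
- exact: path_catP pf (zeta_path pq').
apply: (path_homotopic_trans (g := fun t => pr (f t))).
  by rewrite -pf0; exact: path_homotopic_cat1l.
apply: path_homotopic_sym.
by rewrite -pf1; exact: path_homotopic_cat1r.
Qed.

(** The contraction of the patch deforms the path into the track of its start, a constant path at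
    the centre, and the reversed track of its end. Both tracks lift to the disc, so only the jump
    between their final points is left. *)
Lemma framed_patch i (gam : R -> surface R g) (a b : R) d e :
  continuous gam -> (forall s, 0 <= s <= 1 -> in_patch i (gam (a + (b - a) * s))) ->
  pr d = gam a -> pr e = gam b ->
  exists p q, pr p = pr q /\
    framed d (fun s => gam (a + (b - a) * clamp s)) e = zeta p q.
Proof.
move=> cg gi da eb.
pose c s := gam (a + (b - a) * clamp s).
have cc : continuous c.
  apply: continuous_compT cg; apply: continuous_addr => [s|]; first exact: cvg_cst.
  by apply: continuous_mulr => [s|]; [exact: cvg_cst|exact: clamp_continuous].
have ci s : in_patch i (c s).
  by apply: gi; have := clamp_itv s; rewrite in_itv.
have c0 : c 0 = pr d by rewrite /c clamp_low // mulr0 addr0.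
have c1 : c 1 = pr e by rewrite /c clamp_high // mulr1 addrC subrK.
have id : in_chart i d by rewrite -(in_patchE g0) -c0.
have ie : in_chart i e by rewrite -(in_patchE g0) -c1.
pose K (y : R * R) := patch_contract i (c y.1) y.2.
have cK : continuous K.
  have c2 : continuous (fun y : R * R => (c y.1, y.2)).
    apply: continuous_pair; last exact: continuous_snd.
    by apply: continuous_compT cc; exact: continuous_fst.
  move=> y; apply: (@continuous_comp _ _ _ (fun y : R * R => (c y.1, y.2))
    (fun z => patch_contract i z.1 z.2)); last exact: patch_contract_continuous.
  exact: c2.
have K0 s : K (s, 0) = c s.
  by rewrite /K /patch_contract chart_contract0 ?surface_pr_repr //; exact: ci.
have cD d' (id' : in_chart i d') : continuous (chart_contract g i d').
  have c2 : continuous (fun u : R => (d', u)).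
    by apply: continuous_pair => u; [exact: cvg_cst|exact: cvg_id].
  move=> u; apply: (@continuous_comp _ _ _ (fun u : R => (d', u))
    (fun y => chart_contract g i y.1 y.2)); last exact: chart_contract_continuous.
  exact: c2.
pose p := chart_contract g i d 1; pose q := chart_contract g i e 1.
have Kd u : K (0, u) = pr (chart_contract g i d u) by rewrite /K /= c0 patch_contractE.
have Ke u : K (1, u) = pr (chart_contract g i e u) by rewrite /K /= c1 patch_contractE.
(* At time 1 the patch has collapsed onto isolated centres, so the top row is locally constant. *)
have Ktop s : K (s, 1) = K (0, 1).
  apply: (@locally_constant_line R _ (fun s => K (s, 1))) => t.
  suff nt : \forall z \near c t, patch_contract i z 1 = patch_contract i (c t) 1.
    exact: (cc t _ nt).
  pose V := [set z | in_patch i z /\ patch_contract i z 1 = patch_contract i (c t) 1].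
  have oV : open V.
    rewrite surface_open openE => d' []; rewrite in_patchE // => id'.
    rewrite patch_contractE // => dE; rewrite /interior /=.
    have : \forall d'' \near d', in_chart i d'' /\ chart_contract g i d'' 1 = chart_contract g i d' 1.
      case: (i) id' => [b'|] id'; last first.
        have nd : nbhs d' [set d'' : D | in_chart None d''].
          by apply: open_nbhs_nbhs; split => //; exact: in_chart_open.
        apply: filterS nd => d'' id''; split=> //.
        by rewrite /chart_contract clamp_high // subrr !mul0r.
      have := node_near g0 id'; apply: filterS => d'' [id'' nd]; split=> //.
      rewrite /chart_contract clamp_high // subrr !mul0r nd !mulr1.
      by rewrite ![_ + (1 - _)]addrC !subrK.
    apply: filterS => d'' [id'' E]; split; first by rewrite in_patchE.
    by rewrite patch_contractE // E.
  have nV : nbhs (c t) V by apply: open_nbhs_nbhs; split.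
  by apply: filterS nV => z [].
have pq : pr p = pr q by rewrite -Kd -Ke Ktop.
exists p, q; split=> //; rewrite -/c.
have fr := @frameP R g x.
have hc : path_from_to c (pr d) (pr e) by split.
have hl := pr_path g (cD d id) (chart_contract0 g0 id) (erefl p).
have hr := pr_path g (cD e ie) (chart_contract0 g0 ie) (erefl q).
have ll := framed_lift (cD d id) (chart_contract0 g0 id) (erefl p).
have lr := framed_lift (cD e ie) (chart_contract0 g0 ie) (erefl q).
have := framed_cat fr hc hr; rewrite lr mulg1 => ->.
have := framed_cat fr hl (zeta_path pq); rewrite ll mul1g -/(zeta p q) => ->.
apply: (framed_homotopic fr) => //.
- exact: path_catP hc hr.
- exact: path_catP hl (zeta_path pq).
have cmin : continuous (fun t : R => Num.min (2 * t) 1).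
  apply: continuous_minr => t; last exact: cvg_cst.
  exact: mulrl_continuous.
have cmax : continuous (fun t : R => Num.max 0 (2 * t - 1)).
  apply: continuous_maxr; last exact: continuous_affine.
  by move=> t; exact: cvg_cst.
(* The two ways around the unit square from (0, 0) to (1, 1). *)
apply: (@path_homotopic_plane _ _ K
  (fun t => (Num.min (2 * t) 1, Num.max 0 (2 * t - 1)))
  (fun t => (Num.max 0 (2 * t - 1), Num.min (2 * t) 1))).
- exact: cK.
- exact: continuous_pair.
- exact: continuous_pair.
- by congr pair; case: leP => ?; case: leP => ?; lra.
- by congr pair; case: leP => ?; case: leP => ?; lra.
- move=> t; rewrite in_itv /path_cat /= => t01; case: ifPn => t2.
    by rewrite min_l ?max_l ?K0 //; lra.
  have t2' : 2^-1 < t by rewrite ltNge.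
  by rewrite min_r ?max_r ?Ke //; lra.
- move=> t; rewrite in_itv /path_cat /= => t01; case: ifPn => t2.
    by rewrite min_l ?max_l ?Kd //; lra.
  have t2' : 2^-1 < t by rewrite ltNge.
  by rewrite min_r ?max_r ?Ktop ?Kd //; lra.
Qed.

End Generation.

(** * Surface groups by generators and relation *)

Section Presentation.
Local Open Scope group_scope.

Definition commutator_of (G : groupType) (x y : G) : G := x * y * x^-1 * y^-1.

Fixpoint commutator_prod (G : groupType) (X Y : nat -> G) (n : nat) : G :=
  if n is m.+1 then commutator_of (X m) (Y m) * commutator_prod X Y m else 1.

(* [X] and [Y] present [G] as the surface group of genus [g]. *)
Record surface_presentation (g : nat) (G : groupType) (X Y : nat -> G) : Prop :=
  SurfacePresentation {
    presentation_rel : commutator_prod X Y g = 1;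
    presentation_gen : forall P : G -> Prop, P 1 ->
      (forall u v, P u -> P v -> P (u * v)) -> (forall u, P u -> P u^-1) ->
      (forall k, (k < g)%N -> P (X k) /\ P (Y k)) -> forall u, P u;
    presentation_univ : forall (H : groupType) (X' Y' : nat -> H),
      commutator_prod X' Y' g = 1 ->
      exists2 f : G -> H, {morph f : u v / u * v} &
        forall k, (k < g)%N -> f (X k) = X' k /\ f (Y k) = Y' k }.

End Presentation.

Section SurfaceGroup.
Local Open Scope classical_set_scope.
Local Open Scope ring_scope.
Context {R : realType} (g : nat) (g0 : (0 < g)%N) (x : surface R g).
Local Notation D := (@disc R).
Local Notation pr := (@surface_pr R g).
Local Notation in_chart := (@in_chart R g).
Local Notation in_patch := (@in_patch R g).
Local Notation frame := (frame x).
Local Notation framed := (framed x frame).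
Local Notation zeta := (zeta x).

(** That the loop up to time [t], closed up through some lift of its end, satisfies [P] is locally
    constant in [t] by [framed_patch]. *)
Lemma zeta_generate (P : pi1 R x -> Prop) :
  (forall u v, P u -> P v -> P (u * v)%g) ->
  (forall p q, pr p = pr q -> P (zeta p q)) -> forall w, P w.
Proof.
move=> PM Pz w; have [f hf ->] := path_class_surj w; have [cf f0 f1] := hf.
have fr := @frameP R g x; have xE : pr (repr x) = x by exact: surface_pr_repr.
pose fa (a b : R) s := f (a + (b - a) * clamp s).
have cfa a b : continuous (fa a b).
  apply: continuous_compT cf; apply: continuous_addr => [s|]; first exact: cvg_cst.
  by apply: continuous_mulr => [s|]; [exact: cvg_cst|exact: clamp_continuous].
have fa0 a b : fa a b 0 = f a by rewrite /fa clamp_low // mulr0 addr0.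
have fa1 a b : fa a b 1 = f b by rewrite /fa clamp_high // mulr1 addrC subrK.
pose Q t := exists2 d, pr d = f t & P (framed (repr x) (fa 0 t) d).
have Q0 : Q 0.
  exists (repr x); first by rewrite f0.
  have -> : fa 0 0 = cst (pr (repr x)).
    by apply/funext => s; rewrite /fa subrr mul0r addr0 f0 xE.
  rewrite (framed_cst1 fr) -(zeta1 x (repr x)); exact: Pz.
have step i t t' : (forall s, 0 <= s <= 1 -> in_patch i (f (t + (t' - t) * s))) ->
    Q t -> Q t'.
  move=> it [d df Pd]; exists (repr (f t')); first exact: surface_pr_repr.
  have [|p [q [pq E]]] := framed_patch g0 x cf it df (_ : pr (repr (f t')) = f t').
    exact: surface_pr_repr.
  suff -> : framed (repr x) (fa 0 t') (repr (f t')) =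
      (framed (repr x) (fa 0%R t) d * framed d (fa t t') (repr (f t')))%g.
    by apply: PM => //; rewrite /fa E; exact: Pz.
  have h1 : path_from_to (fa 0 t) (pr (repr x)) (pr d).
    by split; rewrite ?fa0 ?fa1 ?f0 ?xE.
  have h2 : path_from_to (fa t t') (pr d) (pr (repr (f t'))).
    by split; rewrite ?fa0 ?fa1 ?surface_pr_repr.
  have h3 : path_from_to (fa 0 t') (pr (repr x)) (pr (repr (f t'))).
    by split; rewrite ?fa0 ?fa1 ?f0 ?xE ?surface_pr_repr.
  rewrite (framed_cat fr h1 h2); apply: (framed_homotopic fr) h3 _ _.
    exact: path_catP h1 h2.
  apply: (@path_homotopic_line _ _ f (fun s => t' * clamp s)
    (path_cat (fun s => t * clamp s) (fun s => t + (t' - t) * clamp s))) => //.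
  - by apply: continuous_mulr => [s|]; [exact: cvg_cst|exact: clamp_continuous].
  - have h (a b : R) : path_from_to (fun s => a + (b - a) * clamp s) a b.
      split; last by rewrite clamp_high // mulr1 addrC subrK.
        apply: continuous_addr => [s|]; first exact: cvg_cst.
        by apply: continuous_mulr => [s|]; [exact: cvg_cst|exact: clamp_continuous].
      by rewrite clamp_low // mulr0 addr0.
    have h0 : path_from_to (fun s => t * clamp s) 0 t.
      by have := h 0 t; rewrite subr0; under eq_fun do rewrite add0r.
    by case: (path_catP h0 (h t t')).
  - rewrite /path_cat invr_ge0 ler0n (mulr0 2) !clamp_low ?mulr0 //.
  - rewrite /path_cat ifF; last by apply/negbTE; rewrite -ltNge; lra.
    rewrite clamp_high // clamp_high; last lra.
    by rewrite !mulr1 addrC subrK.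
  - by move=> s _; rewrite /fa subr0 add0r.
  - by move=> s _; rewrite /path_cat /fa; case: ifP; rewrite ?subr0 ?add0r.
have QP : Q 1.
  suff -> : Q 1 = Q 0 by [].
  apply: locally_constant_line => t0.
  have [i it0] := patch_cover g0 (f t0).
  have nJ := patch_near_comp g0 (cf t0) it0.
  have /nbhs_ballP[e /= e0 eJ] := nJ.
  have line t t' s : ball t0 e t -> ball t0 e t' -> 0 <= s <= 1 ->
      in_patch i (f (t + (t' - t) * s)).
    move=> Jt Jt' s01; apply: eJ; move: Jt Jt'.
    have [s0 s1] := andP s01.
    rewrite /ball /= !ltr_distlC => /andP[a1 a2] /andP[b1 b2].
    have [tt|/ltW tt] := leP t t'.
      have h1 : 0 <= (t' - t) * s by rewrite mulr_ge0 // subr_ge0.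
      have h2 : (t' - t) * s <= t' - t by rewrite ler_piMr // subr_ge0.
      by apply/andP; split; lra.
    have h1 : 0 <= (t - t') * s by rewrite mulr_ge0 // subr_ge0.
    have h2 : (t - t') * s <= t - t' by rewrite ler_piMr // subr_ge0.
    rewrite (_ : (t' - t) * s = - ((t - t') * s)); last ring.
    by apply/andP; split; lra.
  near=> t; apply/propext.
  have Jt : ball t0 e t by near: t; exact: nbhsx_ballx.
  have J0 : ball t0 e t0 by exact: ballxx.
  by split; apply: (step i) => s; exact: line.
case: QP => d df Pd; rewrite f1 in df.
have h1 : path_from_to (fa 0 1) (pr (repr x)) (pr d).
  by split; rewrite ?fa0 ?fa1 ?f0 ?f1 ?xE.
(* The last lift [d] of the base point may differ from [repr x]; one more jump corrects this. *)
have dx : pr d = pr (repr x) by rewrite df xE.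
have h2 := @zeta_path R g d (repr x) dx.
have fE : frame (repr x) = cst x.
  by apply/funext => s; rewrite /frame disc_seg_id.
have hf' : path_from_to f (pr (repr x)) (pr (repr x)) by rewrite xE.
have <- := framed_loop xE fE hf.
suff -> : framed (repr x) f (repr x) = (framed (repr x) (fa 0 1)%R d * zeta d (repr x))%g.
  by apply: PM => //; exact: Pz.
rewrite (framed_cat fr h1 h2); apply: (framed_homotopic fr) hf' _ _.
  exact: path_catP h1 h2.
have [c1 _ e1] := h1.
apply: (path_homotopic_trans (g := fa 0 1)).
  apply: path_homotopic_eq => // t t01.
  by rewrite /fa subr0 mul1r add0r clamp_id.
by apply: path_homotopic_sym; rewrite -e1; exact: path_homotopic_cat1r.
Unshelve. all: by end_near. Qed.

Definition side_loop (k : 'I_g) (c : bool) : pi1 R x :=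
  zeta (disc_polar g 1 (side_low k c)%:R)
       (disc_polar g 1 ((2 * side_low k c + 6)%:R - (side_low k c)%:R)).

(** A side can be crossed at any of its points, by sliding the crossing along the side. *)
Lemma side_loopE (k : 'I_g) (c : bool) v : (side_low k c)%:R <= v <= (side_low k c)%:R + 2 ->
  side_loop k c =
  zeta (disc_polar g 1 v) (disc_polar g 1 ((2 * side_low k c + 6)%:R - v)).
Proof.
move=> v01; set lo := (side_low k c)%:R in v01 *.
set m := (2 * side_low k c + 6)%:R; have [v0 v1] := andP v01.
pose a t := lo + (v - lo) * clamp t.
have ca : continuous a.
  apply: continuous_addr => [s|]; first exact: cvg_cst.
  by apply: continuous_mulr => [s|]; [exact: cvg_cst|exact: clamp_continuous].
have cdp (b : R -> R) : continuous b -> continuous (fun t => disc_polar g 1 (b t)).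
  move=> cb; have c1 : continuous (fun t => (1 : R, b t)).
    by apply: continuous_pair => // t; exact: cvg_cst.
  have := continuous_compT c1 (@disc_polar_continuous R g).
  by under eq_fun do rewrite /= clamp_high //.
have a0 : a 0 = lo by rewrite /a clamp_low // mulr0 addr0.
have a1 : a 1 = v by rewrite /a clamp_high // mulr1 addrC subrK.
apply: (@zeta_lift _ _ x (fun t => disc_polar g 1 (a t))
  (fun t => disc_polar g 1 (m - a t))); rewrite ?a0 ?a1 //.
- exact: cdp.
- by apply: cdp; apply: continuous_subr => // t; exact: cvg_cst.
move=> t; apply/surface_pr_glued/(gluedE g0); exists k, c, (a t); split=> //.
have := clamp_itv t; rewrite in_itv /= -/lo /a => /andP[s0 s1].
by apply/andP; split; nra.
Qed.

Lemma side_glued (k : 'I_g) (c : bool) v : (side_low k c)%:R <= v <= (side_low k c)%:R + 2 ->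
  pr (disc_polar g 1 v) = pr (disc_polar g 1 ((2 * side_low k c + 6)%:R - v)).
Proof.
by move=> v01; apply/surface_pr_glued/(gluedE g0); exists k, c, v.
Qed.

Lemma side_loop_generate (P : pi1 R x -> Prop) : P 1%g ->
  (forall u v, P u -> P v -> P (u * v)%g) -> (forall u, P u -> P u^-1%g) ->
  (forall k c, P (side_loop k c)) -> forall w, P w.
Proof.
move=> P1 PM PV Ps; apply: zeta_generate => // p q pq.
suff [_] : pr p = pr q /\ P (zeta p q) by [].
move: p q pq; apply: surface_pr_ind.
- by move=> p; split=> //; rewrite zeta1.
- by move=> p q [pq Ppq]; split=> //; rewrite zetaV //; exact: PV.
- move=> p q s [pq Ppq] [qs Pqs]; split; first by rewrite pq.
  by rewrite -(zetaM x pq qs); exact: PM.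
- move=> p q pq; split; first exact: surface_pr_glued.
  move/(gluedE g0) : pq => [k [c [v [v01 -> ->]]]].
  by rewrite -side_loopE.
Qed.

End SurfaceGroup.

(** * The standard presentation of the fundamental group *)

Section SurfacePresentation.
Local Open Scope group_scope.
Context {R : realType} (g : nat) (g0 : (0 < g)%N) (x : surface R g).
Local Notation D := (@disc R).
Local Notation pr := (@surface_pr R g).
Local Notation zeta := (zeta x).

Definition side_gen (c : bool) (k : nat) : pi1 R x :=
  if insub k is Some k' then side_loop x k' c else 1.

Definition surface_X (k : nat) : pi1 R x := (side_gen true k)^-1.
Definition surface_Y (k : nat) : pi1 R x := side_gen false k.

Definition boundary_point (n : nat) : D := disc_polar g 1%R n%:R%R.
Local Notation E := boundary_point.

Lemma side_gen_ord (c : bool) (k : 'I_g) : side_gen c k = side_loop x k c.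
Proof. by rewrite /side_gen valK. Qed.

Lemma side_gen_zeta (k : 'I_g) (c : bool) (n : nat) :
  (8 * k + 2 * c <= n <= 8 * k + 2 * c + 2)%N ->
  side_gen c k = zeta (E n) (E (2 * (8 * k + 2 * c) + 6 - n)) /\
  pr (E n) = pr (E (2 * (8 * k + 2 * c) + 6 - n)).
Proof.
rewrite -/(side_low k c) => nlo; rewrite side_gen_ord.
have v01 : ((side_low k c)%:R <= (n%:R : R) <= (side_low k c)%:R + 2)%R.
  by rewrite -natrD !ler_nat.
have mE : (2 * side_low k c + 6 - n)%:R%R = ((2 * side_low k c + 6)%:R - n%:R)%R :> R.
  by rewrite natrB //; lia.
by rewrite (side_loopE g0 x v01) /E mE; split=> //; exact: side_glued.
Qed.

(** Each side loop may be read at either end of its side. With suitable choices the four jumps run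
    through the vertices [8k + 8], [8k + 2], [8k + 4], [8k + 6], [8k] and telescope. *)
Lemma commutator_vertex (k : 'I_g) : pr (E (8 * k.+1)) = pr (E (8 * k)) /\
  commutator_of (surface_X k) (surface_Y k) = zeta (E (8 * k.+1)) (E (8 * k)).
Proof.
have side c n m : (8 * k + 2 * nat_of_bool c <= n <= 8 * k + 2 * c + 2)%N ->
    m = (2 * (8 * k + 2 * c) + 6 - n)%N ->
    side_gen c k = zeta (E n) (E m) /\ pr (E n) = pr (E m).
  by move=> nE ->; exact: side_gen_zeta.
have [a1 p1] : _ := side false (8 * k)%N (8 * k + 6)%N ltac:(lia) ltac:(lia).
have [a2 p2] : _ := side false (8 * k + 2)%N (8 * k + 4)%N ltac:(lia) ltac:(lia).
have [b1 q1] : _ := side true (8 * k + 2)%N (8 * k.+1)%N ltac:(lia) ltac:(lia).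
have [b2 q2] : _ := side true (8 * k + 4)%N (8 * k + 6)%N ltac:(lia) ltac:(lia).
split; first by rewrite -q1 p2 q2 -p1.
rewrite /commutator_of /surface_X /surface_Y invgK b1 -(zetaV x q1).
rewrite -b1 b2 a1 -(zetaV x p1) -a1 a2.
rewrite (zetaM x (esym q1) p2) (zetaM x (etrans (esym q1) p2) q2).
by rewrite (zetaM x (etrans (etrans (esym q1) p2) q2) (esym p1)).
Qed.

Lemma surface_rel : commutator_prod surface_X surface_Y g = 1.
Proof.
have main m : (m <= g)%N -> pr (E (8 * m)) = pr (E 0) /\
    commutator_prod surface_X surface_Y m = zeta (E (8 * m)) (E 0).
  elim: m => [|m IHm] mg; first by rewrite muln0 zeta1.
  have [pm cm] := IHm (ltnW mg).
  have [pm' cm'] := commutator_vertex (Ordinal mg).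
  split; first by rewrite pm'.
  by rewrite [LHS]/= cm; rewrite /= in cm'; rewrite cm' zetaM.
have [_ ->] := main g (leqnn g).
suff -> : E (8 * g) = E 0 by rewrite zeta1.
by rewrite /E -[(8 * g)%:R%R]add0r disc_polar_period.
Qed.

Lemma surface_gen (P : pi1 R x -> Prop) : P 1 ->
  (forall u v, P u -> P v -> P (u * v)) -> (forall u, P u -> P u^-1) ->
  (forall k, (k < g)%N -> P (surface_X k) /\ P (surface_Y k)) ->
  forall u, P u.
Proof.
move=> P1 PM PV PXY; apply: (side_loop_generate g0) => // k c.
have [PX PY] := PXY k (ltn_ord k); rewrite -side_gen_ord.
by case: c; [rewrite -[side_gen _ _]invgK; exact: PV|].
Qed.

Section Universal.
Context (H : groupType) (X Y : nat -> H).
Context (relXY : commutator_prod X Y g = 1).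

Let V (k : nat) := commutator_prod X Y k.

(** At the vertices these are the values forced by the gluing rule, starting from 1 at vertex 0;
    passing the handle [k] changes the label from [(V k)^-1] to [(V k.+1)^-1]. The middles of the
    sides start from 1 separately on each glued pair. *)
Definition vertex_label (n : nat) : H :=
  let k := (n %/ 8)%N in
  match (n %% 8)%N with
  | 0 => (V k)^-1
  | 2 => (V k)^-1 * Y k * X k * (Y k)^-1
  | 4 => (V k)^-1 * Y k * X k
  | 5 => Y k
  | 6 => (V k)^-1 * Y k
  | 7 => (X k)^-1
  | _ => 1
  end.

Definition generator_label (k : 'I_g) (c : bool) : H :=
  if c then (X k)^-1 else Y k.

Lemma vertex_labelP (k : 'I_g) (c : bool) (n : nat) :
  (side_low k c <= n <= side_low k c + 2)%N ->
  vertex_label ((2 * side_low k c + 6 - n) %% (8 * g))%N =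
  vertex_label n * generator_label k c.
Proof.
have val8 r : (r < 8)%N -> ((8 * k + r) %/ 8 = k)%N /\ ((8 * k + r) %% 8 = r)%N.
  by lia.
have lab r : (r < 8)%N -> vertex_label ((8 * k + r) %% (8 * g))%N = vertex_label (8 * k + r).
  by move=> r8; rewrite modn_small //; have := ltn_ord k; lia.
have lab8 : vertex_label ((8 * k + 8) %% (8 * g))%N = (V k.+1)^-1.
  have -> : (8 * k + 8 = 8 * k.+1)%N by lia.
  have := ltn_ord k; rewrite leq_eqVlt => /orP[/eqP kE|kg].
    (* Back at vertex 0 the labels close up by the relation of [H]. *)
    rewrite kE modnn /vertex_label div0n mod0n /= /V relXY //.
  rewrite modn_small; last by rewrite ltn_mul2l.
  by rewrite /vertex_label mulKn // modnMr.
rewrite /side_low => nlo; case: c nlo => nlo.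
  have [->|[->|->]] : (n = 8 * k + 2 \/ n = 8 * k + 3 \/ n = 8 * k + 4)%N by lia.
  - have -> : (2 * (8 * k + 2 * true) + 6 - (8 * k + 2) = 8 * k + 8)%N by lia.
    rewrite lab8 /vertex_label; have [-> ->] := val8 2%N isT.
    by rewrite /V /= /commutator_of !invgM !invgK !mulgA.
  - have -> : (2 * (8 * k + 2 * true) + 6 - (8 * k + 3) = 8 * k + 7)%N by lia.
    rewrite lab // /vertex_label; have [-> ->] := val8 7%N isT.
    by have [-> ->] := val8 3%N isT; rewrite mul1g.
  - have -> : (2 * (8 * k + 2 * true) + 6 - (8 * k + 4) = 8 * k + 6)%N by lia.
    rewrite lab // /vertex_label; have [-> ->] := val8 6%N isT.
    by have [-> ->] := val8 4%N isT; rewrite /= mulgK.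
have [->|[->|->]] : (n = 8 * k + 0 \/ n = 8 * k + 1 \/ n = 8 * k + 2)%N by lia.
- have -> : (2 * (8 * k + 2 * false) + 6 - (8 * k + 0) = 8 * k + 6)%N by lia.
  rewrite lab // /vertex_label; have [-> ->] := val8 6%N isT.
  by have [-> ->] := val8 0%N isT.
- have -> : (2 * (8 * k + 2 * false) + 6 - (8 * k + 1) = 8 * k + 5)%N by lia.
  rewrite lab // /vertex_label; have [-> ->] := val8 5%N isT.
  by have [-> ->] := val8 1%N isT; rewrite mul1g.
- have -> : (2 * (8 * k + 2 * false) + 6 - (8 * k + 2) = 8 * k + 4)%N by lia.
  rewrite lab // /vertex_label; have [-> ->] := val8 4%N isT.
  by have [-> ->] := val8 2%N isT; rewrite /= mulgVK.
Qed.

Lemma surface_univ : exists2 f : pi1 R x -> H, {morph f : u v / u * v} &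
  forall k, (k < g)%N -> f (surface_X k) = X k /\ f (surface_Y k) = Y k.
Proof.
exists (@monodromy_pi1 R g g0 H vertex_label x).
  exact: (monodromy_pi1M g0 vertex_labelP).
have mM := monodromy_pi1M g0 vertex_labelP (x := x).
have mZ c (k : 'I_g) : monodromy_pi1 g0 vertex_label (side_gen c k) =
    generator_label k c.
  have i1 : (0 < (1 : R) <= 1)%R by lra.
  have kN : (8 * k + 2 * c + 1 <= 8 * g)%N.
    by have := ltn_ord k; case: (c); lia.
  have y1 : (`|0 : R| < 1)%R by rewrite normr0 ltr01.
  have [+ _ _ _] := node_polar g0 kN i1 y1; rewrite addr0 => iE.
  have [] := @side_gen_zeta k c (8 * k + 2 * c + 1)%N; first lia.
  move=> -> pE; rewrite (monodromy_zeta g0 vertex_labelP x pE iE).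
  have v01 : ((side_low k c)%:R <= (8 * k + 2 * c + 1)%:R :> R)%R &&
      ((8 * k + 2 * c + 1)%:R <= (side_low k c)%:R + 2 :> R)%R.
    by rewrite -natrD !ler_nat /side_low; lia.
  have := lab_side g0 vertex_labelP v01 iE.
  have -> : ((2 * side_low k c + 6)%:R - (8 * k + 2 * c + 1)%:R =
     (2 * (8 * k + 2 * c) + 6 - (8 * k + 2 * c + 1))%:R :> R)%R.
    by rewrite natrB //; lia.
  by rewrite -/(E _) -/(E _) => ->; rewrite mulKg.
have m1 : monodromy_pi1 g0 vertex_label (1 : pi1 R x) = 1.
  have := mM 1 1; rewrite mulg1 => h.
  by apply: (mulgI (monodromy_pi1 g0 vertex_label (1 : pi1 R x))); rewrite mulg1 -h.
have mV (u : pi1 R x) : monodromy_pi1 g0 vertex_label u^-1 = (monodromy_pi1 g0 vertex_label u)^-1.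
  have := mM u u^-1; rewrite mulgV m1 => h.
  by apply: (mulgI (monodromy_pi1 g0 vertex_label u)); rewrite -h mulgV.
move=> k kg; rewrite /surface_X /surface_Y mV.
by rewrite (mZ true (Ordinal kg)) (mZ false (Ordinal kg)) /= invgK.
Qed.

End Universal.

Theorem surface_pi1_presentation : surface_presentation g surface_X surface_Y.
Proof.
split; [exact: surface_rel|exact: surface_gen|exact: surface_univ].
Qed.

End SurfacePresentation.

(** * Cyclic covers *)

Section Bijections.
Context (T : Type).

Record bijection := Bijection {
  bij_fun :> T -> T;
  bij_inv : T -> T;
  bij_funK : cancel bij_fun bij_inv;
  bij_invK : cancel bij_inv bij_fun }.

Lemma bijectionP (s t : bijection) : s =1 t -> s = t.
Proof.
case: s t => [f f' fK f'K] [h h' hK h'K] /= /funext E.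
rewrite E in fK f'K *; have E' : f' = h'.
  by apply/funext => y; rewrite -[y in LHS]h'K fK.
rewrite E' in fK f'K *; congr Bijection; exact: Prop_irrelevance.
Qed.

HB.instance Definition _ := gen_eqMixin bijection.
HB.instance Definition _ := gen_choiceMixin bijection.

Definition bijection_one : bijection := Bijection (frefl id) (frefl id).
(** The right factor acts first, so that left translations multiply in the order of the group. *)
Definition bijection_mul (s t : bijection) : bijection :=
  Bijection (can_comp (bij_funK s) (bij_funK t)) (can_comp (bij_invK t) (bij_invK s)).
Definition bijection_inv (s : bijection) : bijection :=
  Bijection (bij_invK s) (bij_funK s).

Lemma bijection_mulA : associative bijection_mul.
Proof. by move=> s t u; apply: bijectionP. Qed.
Lemma bijection_mul1g : left_id bijection_one bijection_mul.
Proof. by move=> s; apply: bijectionP. Qed.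
Lemma bijection_mulg1 : right_id bijection_one bijection_mul.
Proof. by move=> s; apply: bijectionP. Qed.
Lemma bijection_mulVg : left_inverse bijection_one bijection_inv bijection_mul.
Proof. by move=> s; apply: bijectionP; exact: bij_funK. Qed.
Lemma bijection_mulgV : right_inverse bijection_one bijection_inv bijection_mul.
Proof. by move=> s; apply: bijectionP; exact: bij_invK. Qed.

HB.instance Definition _ := isGroup.Build bijection
  bijection_mulA bijection_mul1g bijection_mulg1 bijection_mulVg bijection_mulgV.

End Bijections.

Section Morphisms.
Local Open Scope group_scope.
Context {G H : groupType} (f : G -> H) (fM : {morph f : u v / u * v}).

Lemma morph1g : f 1 = 1.
Proof. by apply: (mulgI (f 1)); rewrite -fM !mulg1. Qed.

Lemma morphVg u : f u^-1 = (f u)^-1.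
Proof. by apply: (mulgI (f u)); rewrite -fM !mulgV morph1g. Qed.

Lemma morphXg u n : f (u ^+ n) = f u ^+ n.
Proof. by elim: n => [|n IH]; rewrite ?expg0 ?morph1g // !expgS fM IH. Qed.

End Morphisms.

(** * Embedding higher genus into genus 2 *)

Section Cover.
Local Open Scope group_scope.

(* The cyclic cover of degree [m.+1] of the surface of genus 2 has genus
   [m.+2]; these are the images of its generators. *)
Section Target.
Context {G : groupType} (a b A B : G) (m : nat).
Context (rel2 : commutator_of a b * (commutator_of A B * 1) = 1).

(** The cover belongs to the map onto the cyclic group of order [m.+1] that sends [a] to a generator
    and kills [b], [A], [B]: its handles are the conjugates of [A], [B] by powers of [a], and the
    pair [a ^+ m.+1], [b]. *)
Definition cover_gen (u v : G) (k : nat) : G :=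
  if (k <= m)%N then a ^+ (m - k) * u * (a ^+ (m - k))^-1 else v.

(** With [d] the commutator of [A] and [B] the relation reads [d * a = b * a * b^-1]. The conjugates
    of [d] multiply to [(d * a) ^+ m.+1 * (a ^+ m.+1)^-1], which is the inverse of the last
    commutator. *)
Lemma cover_rel :
  commutator_prod (cover_gen A (a ^+ m.+1)) (cover_gen B b) m.+2 = 1.
Proof.
set d := commutator_of A B; have r2 := rel2; rewrite mulg1 -/d in r2.
have dE : d * a = b * a * b^-1.
  apply: (mulgI (commutator_of a b)); rewrite mulgA r2 mul1g /commutator_of.
  by rewrite !mulgA mulgVK mulgVK mulgK.
have dX n : (d * a) ^+ n = b * a ^+ n * b^-1.
  by rewrite dE; elim: n => [|n IH]; rewrite ?expg0 ?mulg1 ?mulgV // !expgS IH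
    !mulgA mulgVK.
have main n : (n <= m.+1)%N ->
    commutator_prod (cover_gen A (a ^+ m.+1)) (cover_gen B b) n =
    a ^+ (m.+1 - n) * (d * a) ^+ n * (a ^+ m.+1)^-1.
  elim: n => [|n IH] nm; first by rewrite subn0 expg0 mulg1 mulgV.
  rewrite [LHS]/= IH 1?ltnW // /cover_gen -ltnS nm subSS.
  set c := a ^+ (m - n).
  have -> : a ^+ (m.+1 - n) = c * a by rewrite subSn // expgSr.
  have -> : commutator_of (c * A * c^-1) (c * B * c^-1) = c * d * c^-1.
    by rewrite /d /commutator_of !invgM !invgK !mulgA !mulgVK.
  have aux e w z : c * e * c^-1 * (c * a * w * z) = c * (e * a * w) * z.
    by rewrite !mulgA mulgVK.
  by rewrite [(d * a) ^+ n.+1]expgS; exact: aux.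
rewrite [LHS]/= -/(commutator_prod _ _ m.+1) main // subnn expg0 mul1g dX.
rewrite /cover_gen ltnn /commutator_of.
by rewrite !mulgA mulgVK mulgVK mulgK mulgV.
Qed.

End Target.

(* The representation of the genus 2 group induced from the left regular
   representation of [G]: on the fibre over [ord0] the elements of the cover act
   as left translations. *)
Section Action.
Context {G : groupType} (X Y : nat -> G) (m : nat).
Context (relXY : commutator_prod X Y m.+2 = 1).
Implicit Types (v : G).

Let dd (i : nat) := commutator_of (X (m - i)) (Y (m - i)).

(** The action of [b] on the fibres. As [a] moves the fibre [i] to its predecessor, the relation of
    genus 2 forces this recursion at every fibre but the one over [ord0]. *)
Fixpoint cover_conj (i : nat) : G :=
  if i is j.+1 then (dd j)^-1 * cover_conj j else Y m.+1.
Local Notation beta := cover_conj.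

(** The remaining condition, at the fibre over [ord0], is the relation of [G]. *)
Lemma cover_conj_last : X m.+1 * beta 0 = beta m.+1 * X m.+1.
Proof.
have main n : (n <= m.+1)%N -> commutator_prod X Y m.+1 =
    beta 0 * (beta n)^-1 * commutator_prod X Y (m.+1 - n).
  elim: n => [|n IH] nm; first by rewrite subn0 mulgV mul1g.
  rewrite IH 1?ltnW // subSn //= invgM invgK /dd !mulgA.
  by rewrite subSS.
have := relXY; rewrite [LHS]/= -/(commutator_prod _ _ m.+1) (main m.+1) //.
rewrite subnn mulg1 /commutator_of -[Y m.+1]/(beta 0) !mulgA mulgVK => E.
apply: (mulIg ((X m.+1)^-1 * (beta m.+1)^-1)).
by rewrite !mulgA E mulgK mulgV.
Qed.

Lemma mul_bij_subproof (s : 'I_m.+1 -> G) (p p' : 'I_m.+1 -> 'I_m.+1) :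
  cancel p p' -> cancel (fun y : G * 'I_m.+1 => (s y.2 * y.1, p y.2))
                        (fun y => ((s (p' y.2))^-1 * y.1, p' y.2)).
Proof. by move=> pK [v i] /=; rewrite pK mulKg. Qed.

Lemma mul_bij_subproof' (s : 'I_m.+1 -> G) (p p' : 'I_m.+1 -> 'I_m.+1) :
  cancel p' p -> cancel (fun y => ((s (p' y.2))^-1 * y.1, p' y.2))
    (fun y : G * 'I_m.+1 => (s y.2 * y.1, p y.2)).
Proof. by move=> pK [v i] /=; rewrite pK mulVKg. Qed.

Definition cover_shift : bijection (G * 'I_m.+1) :=
  let s i := if i == ord0 then X m.+1 else 1 in
  Bijection (mul_bij_subproof s (@ord_predK m.+1))
            (mul_bij_subproof' s (@ordSK m.+1)).

Definition cover_mul (s : 'I_m.+1 -> G) : bijection (G * 'I_m.+1) :=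
  Bijection (mul_bij_subproof s (frefl id)) (mul_bij_subproof' s (frefl id)).

Lemma cover_mulM s t : cover_mul s * cover_mul t = cover_mul (fun i => s i * t i).
Proof. by apply: bijectionP => -[v i] /=; rewrite mulgA. Qed.

Lemma cover_mulV s : (cover_mul s)^-1 = cover_mul (fun i => (s i)^-1).
Proof. by apply: bijectionP => -[v i]. Qed.

Definition cover_A := cover_mul (fun i => X (m - i)).
Definition cover_B := cover_mul (fun i => Y (m - i)).
Definition cover_b := cover_mul (fun i => beta i).

Lemma cover_action_rel :
  commutator_of cover_shift cover_b * (commutator_of cover_A cover_B * 1) = 1.
Proof.
have dE : commutator_of cover_A cover_B = cover_mul (fun i => dd i).
  by rewrite /commutator_of !cover_mulV !cover_mulM.
rewrite mulg1 dE /commutator_of.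
suff E : cover_shift * cover_b = cover_mul (fun i => (dd i)^-1) * cover_b * cover_shift.
  by rewrite E mulgK mulgK cover_mulM; apply: bijectionP => -[v i] /=;
    rewrite mulVg mul1g.
apply: bijectionP => -[v i] /=; congr pair.
case: eqP => [->|/eqP i0].
  rewrite add0n modn_small //.
  transitivity (X m.+1 * beta 0 * v); first by rewrite mulgA.
  by rewrite cover_conj_last /= !mulgA.
rewrite !mul1g mulgA; congr (_ * v).
have iE : i = (ord_pred i).+1 :> nat.
  case: i i0 => -[|i] im //= _; rewrite modnDr modn_small //.
  exact: ltnW.
by rewrite {1}iE.
Qed.

Lemma cover_shiftX (j : nat) v : (j <= m)%N ->
  (cover_shift ^+ j) (v, inord j) = (v, ord0).
Proof.
elim: j => [|j IH] jm.
  by rewrite expg0 /=; congr pair; apply/val_inj; rewrite /= inordK.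
rewrite expgSr.
have -> : (cover_shift ^+ j * cover_shift) (v, inord j.+1) =
  (cover_shift ^+ j) (cover_shift (v, inord j.+1)) by [].
have -> : cover_shift (v, inord j.+1) = (v, inord j).
  rewrite /= ifF ?mul1g; last by apply/negbTE/eqP => /(congr1 val); rewrite /= inordK.
  congr pair; apply/val_inj; rewrite /= !inordK //; last exact: ltnW.
  by rewrite modnDr modn_small // ltnW.
by apply: IH; exact: ltnW.
Qed.

Lemma cover_shift_last v : (cover_shift ^+ m.+1) (v, ord0) = (X m.+1 * v, ord0).
Proof.
rewrite expgSr.
have -> : (cover_shift ^+ m * cover_shift) (v, ord0) =
  (cover_shift ^+ m) (cover_shift (v, ord0)) by [].
have -> : cover_shift (v, ord0) = (X m.+1 * v, inord m).
  rewrite /=; congr pair; apply/val_inj; rewrite /= inordK //.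
  by rewrite modn_small.
exact: cover_shiftX.
Qed.

End Action.

(** The induced action, pulled back along [f], is left translation on the fibre over [ord0], which
    recovers [w] from [f w]. *)
Lemma surface_cover_embedding (m : nat) (G G2 : groupType) (X Y : nat -> G)
    (X2 Y2 : nat -> G2) :
  surface_presentation m.+2 X Y -> surface_presentation 2 X2 Y2 ->
  exists2 f : G -> G2, {morph f : u v / u * v} & injective f.
Proof.
move=> [relG genG univG] [rel2 _ univ2].
(* The handle 1 of the genus 2 surface is unwrapped; the handle 0 is copied [m.+1] times. *)
have [f fM fXY] := univG G2 _ _ (@cover_rel G2 (X2 1%N) (Y2 1%N) (X2 0%N) (Y2 0%N) m rel2).
have [h hM hXY] := univ2 _
  (fun k => if k is 0 then cover_A X m else cover_shift X m)
  (fun k => if k is 0 then cover_B Y m else cover_b X Y m) (cover_action_rel relG).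
have [hA hB] := hXY 0%N isT; have [ha hb] := hXY 1%N isT.
suff act w v : h (f w) (v, ord0) = (w * v, ord0).
  exists f => // u w E; have := act u 1; rewrite E act !mulg1.
  by case.
pose P w := forall v, h (f w) (v, ord0) = (w * v, ord0).
move: w v; apply: (genG P).
- by move=> v; rewrite (morph1g fM) (morph1g hM) mul1g.
- by move=> u w Pu Pw v; rewrite fM hM /= Pw Pu mulgA.
- move=> u Pu v; rewrite (morphVg fM) (morphVg hM).
  have := Pu (u^-1 * v); rewrite mulVKg => <-; exact: bij_funK.
move=> k km; rewrite /P; have [-> ->] := fXY k km.
rewrite /cover_gen; case: leqP => kkm; last first.
  have -> : k = m.+1 by apply/eqP; rewrite eqn_leq -ltnS km.
  split=> v; first by rewrite (morphXg hM) ha cover_shift_last.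
  by rewrite hb.
have conj (s : 'I_m.+1 -> G) v :
    (cover_shift X m ^+ (m - k) * cover_mul s * (cover_shift X m ^+ (m - k))^-1)
      (v, ord0) = (s (inord (m - k)) * v, ord0).
  have mk : (m - k <= m)%N by rewrite leq_subr.
  have E : (cover_shift X m ^+ (m - k))^-1 (v, ord0) = (v, inord (m - k)).
    rewrite -(cover_shiftX X v mk); exact: bij_funK.
  have -> : (cover_shift X m ^+ (m - k) * cover_mul s *
      (cover_shift X m ^+ (m - k))^-1) (v, ord0) =
    (cover_shift X m ^+ (m - k))
      (cover_mul s ((cover_shift X m ^+ (m - k))^-1 (v, ord0))) by [].
  by rewrite E /= cover_shiftX.
have kE : (m - @inord m (m - k) = k)%N by rewrite inordK ?subKn // ltnS leq_subr.
by split=> v; rewrite !hM (morphVg hM) (morphXg hM) ha ?hA ?hB conj kE.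
Qed.

End Cover.

(** * A faithful representation over the polynomial ring *)

Section SL2.
Local Open Scope ring_scope.
Context (A : comNzRingType).

Record sl2 := SL2 {
  sl2_a : A; sl2_b : A; sl2_c : A; sl2_d : A;
  sl2_det : sl2_a * sl2_d - sl2_b * sl2_c = 1 }.

Lemma sl2P (s t : sl2) : sl2_a s = sl2_a t -> sl2_b s = sl2_b t ->
  sl2_c s = sl2_c t -> sl2_d s = sl2_d t -> s = t.
Proof.
case: s t => [a b c d e] [a' b' c' d' e'] /= aE bE cE dE.
by subst; congr SL2; exact: Prop_irrelevance.
Qed.

HB.instance Definition _ := gen_eqMixin sl2.
HB.instance Definition _ := gen_choiceMixin sl2.

Lemma sl2_one_subproof : 1 * 1 - 0 * 0 = 1 :> A. Proof. by ring. Qed.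
Definition sl2_one := SL2 sl2_one_subproof.

Lemma sl2_mul_subproof (s t : sl2) :
  (sl2_a s * sl2_a t + sl2_b s * sl2_c t) * (sl2_c s * sl2_b t + sl2_d s * sl2_d t) -
  (sl2_a s * sl2_b t + sl2_b s * sl2_d t) * (sl2_c s * sl2_a t + sl2_d s * sl2_c t) = 1.
Proof.
transitivity ((sl2_a s * sl2_d s - sl2_b s * sl2_c s) *
              (sl2_a t * sl2_d t - sl2_b t * sl2_c t)); first by ring.
by rewrite !sl2_det mulr1.
Qed.
Definition sl2_mul s t := SL2 (sl2_mul_subproof s t).

Lemma sl2_inv_subproof (s : sl2) :
  sl2_d s * sl2_a s - - sl2_b s * - sl2_c s = 1.
Proof. by rewrite -[RHS](sl2_det s); ring. Qed.
Definition sl2_inv s := SL2 (sl2_inv_subproof s).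

Lemma sl2_mulA : associative sl2_mul.
Proof. by move=> s t u; apply: sl2P => /=; ring. Qed.
Lemma sl2_mul1g : left_id sl2_one sl2_mul.
Proof. by move=> s; apply: sl2P => /=; ring. Qed.
Lemma sl2_mulg1 : right_id sl2_one sl2_mul.
Proof. by move=> s; apply: sl2P => /=; ring. Qed.
Lemma sl2_mulVg : left_inverse sl2_one sl2_inv sl2_mul.
Proof.
move=> s; apply: sl2P => /=; rewrite -?(sl2_det s); ring.
Qed.
Lemma sl2_mulgV : right_inverse sl2_one sl2_inv sl2_mul.
Proof.
move=> s; apply: sl2P => /=; rewrite -?(sl2_det s); ring.
Qed.

HB.instance Definition _ := isGroup.Build sl2
  sl2_mulA sl2_mul1g sl2_mulg1 sl2_mulVg sl2_mulgV.

(** [sl2_X] and [sl2_Y] are a free basis of the commutator subgroup of SL_2(Z), a once-punctured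
    torus group. Their commutator [sl2_C] is minus a translation by -6, the parabolic element around
    the puncture. *)
Lemma sl2_X_subproof : 2 * 1 - -1 * -1 = 1 :> A. Proof. by ring. Qed.
Definition sl2_X := SL2 sl2_X_subproof.
Lemma sl2_Y_subproof : 2 * 1 - 1 * 1 = 1 :> A. Proof. by ring. Qed.
Definition sl2_Y := SL2 sl2_Y_subproof.

Lemma sl2_U_subproof (t : A) : 1 * 1 - t * 0 = 1 :> A. Proof. by ring. Qed.
Definition sl2_U t := SL2 (sl2_U_subproof t).

Lemma sl2_C_subproof : -1 * -1 - 6 * 0 = 1 :> A. Proof. by ring. Qed.
Definition sl2_C := SL2 sl2_C_subproof.

Lemma sl2_commutator : commutator_of sl2_X sl2_Y = sl2_C.
Proof. by apply: sl2P => /=; ring. Qed.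

End SL2.

Section SL2Map.
Local Open Scope ring_scope.
Context (A B : comNzRingType) (f : {rmorphism A -> B}).

Lemma sl2_map_subproof (s : sl2 A) :
  f (sl2_a s) * f (sl2_d s) - f (sl2_b s) * f (sl2_c s) = 1.
Proof. by rewrite -!rmorphM -rmorphB sl2_det rmorph1. Qed.
Definition sl2_map (s : sl2 A) : sl2 B := SL2 (sl2_map_subproof s).

Lemma sl2_mapM : {morph sl2_map : s t / (s * t)%g}.
Proof. by move=> s t; apply: sl2P; rewrite /= rmorphD !rmorphM. Qed.

Lemma sl2_mapX : sl2_map (sl2_X A) = sl2_X B.
Proof. by apply: sl2P; rewrite /= ?rmorphN ?rmorph1 ?rmorph_nat. Qed.

Lemma sl2_mapY : sl2_map (sl2_Y A) = sl2_Y B.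
Proof. by apply: sl2P; rewrite /= ?rmorphN ?rmorph1 ?rmorph_nat. Qed.

End SL2Map.

(** * The stabilizer of the cusp, by ping-pong *)

Section CyclicSubgroup.
Local Open Scope group_scope.
Context {G : groupType} (c : G).

(** An integral exponent, written as a difference of natural numbers. *)
Definition cyc (u : G) := exists n m : nat, u = (c ^+ n)^-1 * c ^+ m.

Lemma cyc1 : cyc 1.
Proof. by exists 0%N, 0%N; rewrite mulVg. Qed.

Lemma cycM u v : cyc u -> cyc v -> cyc (u * v).
Proof.
move=> [n [m ->]] [n' [m' ->]]; exists (n' + n)%N, (m + m')%N.
rewrite !expgnDr invgM !mulgA; congr (_ * _).
have E : commute (c ^+ m) (c ^+ n')^-1 by apply/commuteV/commuteX2.
by rewrite -mulgA E mulgA.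
Qed.

Lemma cycV u : cyc u -> cyc u^-1.
Proof. by move=> [n [m ->]]; exists m, n; rewrite invgM invgK. Qed.

Lemma cyc_id : cyc c.
Proof. by exists 0%N, 1%N; rewrite expg0 expg1 invg1 mul1g. Qed.

End CyclicSubgroup.

Section PingPong.
Context {G : groupType} (a b : G).
Local Notation c := (commutator_of a b).

(* Letters: [(false, false)], [(false, true)] are [a], [a^-1] and
   [(true, false)], [(true, true)] are [b], [b^-1]. *)
Definition letter := (bool * bool)%type.

Definition letter_inv (l : letter) : letter := (l.1, ~~ l.2).

Definition letter_val (l : letter) : G :=
  let s := if l.1 then b else a in if l.2 then s^-1%g else s.

Definition letter_mx (l : letter) : sl2 int :=
  let s := if l.1 then sl2_Y int else sl2_X int in if l.2 then s^-1%g else s.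

(** The same word evaluated in [G] and in matrices. Freeness of [a] and [b] is not known at this
    stage, so a matrix belongs to a word and not to its value in [G]. *)
Inductive word_pair : G -> sl2 int -> Prop :=
| WordNil : word_pair 1%g 1%g
| WordCons l u m :
    word_pair u m -> word_pair (letter_val l * u)%g (letter_mx l * m)%g.

Inductive reduced_pair : letter -> G -> sl2 int -> Prop :=
| Reduced1 l : reduced_pair l (letter_val l) (letter_mx l)
| ReducedS l l' u m : reduced_pair l' u m -> l <> letter_inv l' ->
    reduced_pair l (letter_val l * u)%g (letter_mx l * m)%g.

Lemma letter_valV l : (letter_val (letter_inv l) * letter_val l = 1)%g.
Proof. by case: l => [[] []]; rewrite /letter_val /= ?mulVg ?mulgV. Qed.

Lemma letter_mxV l : (letter_mx (letter_inv l) * letter_mx l = 1)%g.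
Proof. by case: l => [[] []]; rewrite /letter_mx /= ?mulVg ?mulgV. Qed.

Lemma reduce_pair u m : word_pair u m ->
  (u = 1%g /\ m = 1%g) \/ exists l, reduced_pair l u m.
Proof.
elim=> [|l {}u {}m _ [[-> ->]|[l' red]]]; first by left.
  by right; exists l; rewrite !mulg1; exact: Reduced1.
have [lE|nl] := eqVneq l (letter_inv l'); last first.
  by right; exists l; apply: ReducedS red _; exact/eqP.
case: red lE => [l'' ->|l'' l2 v k red _ ->].
  by left; rewrite letter_valV letter_mxV.
by right; exists l2; rewrite !mulgA letter_valV letter_mxV !mul1g.
Qed.

Section Cones.
Local Open Scope ring_scope.

(* With [p / r] a point of the real projective line, the four letters send the
   complement of the closed interval of their inverse into the interval of
   their own; the intervals are [1, oo], [-1, 0], [0, 1] and [oo, -1]. *)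
Definition letter_cone (l : letter) (p r : int) : Prop :=
  match l with
  | (true, false) => (r > 0) && (p > r)
  | (true, true) => (p < 0) && (- p < r)
  | (false, true) => (p > 0) && (p < r)
  | (false, false) => (r > 0) && (- p > r)
  end.

(** Homogeneous coordinates matter up to sign. *)
Definition strict_cone l p r := letter_cone l p r \/ letter_cone l (- p) (- r).

(* The reduced words that move the cusp only through endpoints of the
   intervals: they are the suffixes of the powers of [c] and [c^-1]. *)
Definition cusp_word (l : letter) (u : G) (p r : int) : Prop :=
  match l with
  | (true, true) => p = - r /\ cyc c (b * u)%g \/ p = 0 /\ cyc c (a * (b * u))%g
  | (false, true) => p = 0 /\ cyc c (b * (a * u))%g \/ p = r /\ cyc c (a * u)%g
  | (true, false) =>
      p = r /\ cyc c (b * (a * (b^-1 * u)))%g \/ r = 0 /\ cyc c u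
  | (false, false) =>
      r = 0 /\ cyc c u \/ p = - r /\ cyc c (a * (b * (a^-1 * u)))%g
  end.

(** The first column is the image of the cusp at infinity. Once it is in the interior of an
    interval, every further letter keeps it in an interior; until then it only passes through
    endpoints, and the word is a suffix of a power of [c] or of [c^-1]. *)
Lemma reduced_cone l u m : reduced_pair l u m ->
  strict_cone l (sl2_a m) (sl2_c m) \/ cusp_word l u (sl2_a m) (sl2_c m).
Proof.
elim=> {l u m} [[[] []]|l l' u m red IH nl] /=.
- by right; left; rewrite mulgV; split=> //; exact: cyc1.
- by left; left.
- by right; right; rewrite mulgV; split=> //; exact: cyc1.
- by left; right.
have nz : sl2_a m <> 0 \/ sl2_c m <> 0.
  have := sl2_det m; case: (sl2_a m =P 0) => [->|]; last by left.
  case: (sl2_c m =P 0) => [->|]; last by right.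
  by rewrite mul0r mulr0 subr0.
case: m red IH nz => p q r s /= dm red IH nz.
(* A factor [c] or [c^-1] turns one description of the suffix into the one that the next letter
   needs. *)
have cab (v : G) : cyc c (b * (a * (b^-1 * v)))%g -> cyc c (a * v)%g.
  move=> /(cycM (cyc_id c)); rewrite /commutator_of !mulgA !mulgVK.
  by rewrite mulgK.
have cba (v : G) : cyc c (a * (b * (a^-1 * v)))%g -> cyc c (b * v)%g.
  move=> /(cycM (cycV (cyc_id c))); rewrite /commutator_of !invgM !invgK.
  by rewrite !mulgA !mulgVK mulgK.
case: l nl => [[] []]; case: l' red IH => [[] []] red IH nl //=;
  try (by case: nl);
  case: IH => [[/= IH|/= IH]|[[pE cu]|[pE cu]]];
  try (by left; left => /=; lia); try (by left; right => /=; lia);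
  try (by right; left; split; [lia|rewrite /letter_val /= ?mulVKg ?mulKg; auto]);
  try (by right; right; split; [lia|rewrite /letter_val /= ?mulVKg ?mulKg; auto]);
  try (by case: (ltrgtP r 0) => r0; [left; right => /=; lia|left; left => /=; lia|case: nz; lia]);
  try (by case: (ltrgtP r 0) => r0; [left; left => /=; lia|left; right => /=; lia|case: nz; lia]);
  try (by case: (ltrgtP p 0) => r0; [left; right => /=; lia|left; left => /=; lia|case: nz; lia]);
  try (by case: (ltrgtP p 0) => r0; [left; left => /=; lia|left; right => /=; lia|case: nz; lia]).
Qed.

(** A zero lower left entry puts the image of the cusp back at infinity, which lies in no open
    interval and so is reached by powers of [c] only. *)
Lemma cusp_stabilizer u m : word_pair u m -> sl2_c m = 0 -> cyc c u.
Proof.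
move=> /reduce_pair[[-> _] _|[l red] c0]; first exact: cyc1.
have ad : sl2_a m <> 0.
  by move=> a0; have := sl2_det m; rewrite a0 c0 mul0r mulr0 subr0.
have := reduced_cone red; rewrite c0 /strict_cone /cusp_word /letter_cone.
by case: l {red} => [[] []] /= [[|]|[[]|[]]] //; lia.
Qed.

End Cones.

Lemma word_pairM u m v k : word_pair u m -> word_pair v k ->
  word_pair (u * v)%g (m * k)%g.
Proof.
move=> wu wv; elim: wu => [|l {}u {}m _ IH]; first by rewrite !mul1g.
by rewrite -!mulgA; exact: WordCons.
Qed.

Lemma letter_pair l : word_pair (letter_val l) (letter_mx l).
Proof. by rewrite -[letter_val l]mulg1 -[letter_mx l]mulg1; do 2!constructor. Qed.

Lemma cyc_pair z : cyc c z -> exists k, [/\ word_pair z k, sl2_c k = 0%R &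
  sl2_d k <> 0%R].
Proof.
have wc : word_pair c (sl2_C int).
  rewrite -sl2_commutator; do ! apply: word_pairM.
  - exact: (letter_pair (false, false)).
  - exact: (letter_pair (true, false)).
  - exact: (letter_pair (false, true)).
  - exact: (letter_pair (true, true)).
have wcV : word_pair c^-1 (sl2_C int)^-1%g.
  rewrite -sl2_commutator /commutator_of !invgM !invgK; do ! apply: word_pairM.
  - exact: (letter_pair (true, false)).
  - exact: (letter_pair (false, false)).
  - exact: (letter_pair (true, true)).
  - exact: (letter_pair (false, true)).
have pw (v : G) (k : sl2 int) n : word_pair v k -> sl2_c k = 0%R ->
    word_pair (v ^+ n)%g (k ^+ n)%g /\ sl2_c (k ^+ n)%g = 0%R.
  move=> wv k0; elim: n => [|n [IH1 IH2]]; first by split; first constructor.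
  rewrite !expgS; split; first exact: word_pairM.
  by rewrite /= k0 IH2 mul0r mulr0 addr0.
move=> [n [m ->]]; rewrite -expVgn.
have [w1 e1] := pw _ _ n wcV ltac:(by rewrite /= oppr0).
have [w2 e2] := pw _ _ m wc erefl.
pose k := ((sl2_C int)^-1 ^+ n * (sl2_C int) ^+ m)%g; exists k.
have k0 : sl2_c k = 0%R by rewrite /k /= e1 e2 mul0r mulr0 addr0.
split; [exact: word_pairM|exact: k0|].
by move=> d0; have := sl2_det k; rewrite d0 k0 !mulr0 subr0.
Qed.

End PingPong.

(** * Normal forms in the amalgam *)

Section Amalgam.
Local Open Scope group_scope.
Context {G : groupType} (X Y : nat -> G).
Context (presG : surface_presentation 2 X Y).

Local Notation c := (commutator_of (X 0%N) (Y 0%N)).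

(* Exchanging the generators of the second handle makes the commutators of the
   two factors equal. *)
Let side_a (s : bool) : G := if s then Y 1%N else X 0%N.
Let side_b (s : bool) : G := if s then X 1%N else Y 0%N.

Lemma side_commutator s : commutator_of (side_a s) (side_b s) = c.
Proof.
case: s => //; have := presentation_rel presG; rewrite /= mulg1.
rewrite /commutator_of /side_a /side_b => E.
apply: (mulgI (X 1%N * Y 1%N * (X 1%N)^-1 * (Y 1%N)^-1)); rewrite E.
by rewrite !mulgA mulgVK mulgVK mulgK mulgV.
Qed.

Local Notation wp s := (word_pair (side_a s) (side_b s)).

(* Alternating products of elements of the two factors outside the amalgamated
   subgroup, starting in the factor [s]. *)
Inductive alternating_prod : bool -> G -> Prop :=
| Alternating1 s u m : wp s u m -> sl2_c m <> 0%R -> alternating_prod s u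
| AlternatingS s u m v : wp s u m -> sl2_c m <> 0%R -> alternating_prod (~~ s) v ->
    alternating_prod s (u * v).

Lemma side_cusp s u m : wp s u m -> sl2_c m = 0%R -> cyc c u.
Proof. by rewrite -(side_commutator s); exact: cusp_stabilizer. Qed.

(** A power of [c] has an upper triangular matrix with nonzero diagonal, so absorbing it into the
    leading factor keeps the lower left entry nonzero. *)
Lemma alternating_cyc s z u : cyc c z -> alternating_prod s u -> alternating_prod s (z * u).
Proof.
move=> cz alt; case: alt cz => {s u} [s u m wu m0|s u m v wu m0 alt] cz;
  have := cz; rewrite -(side_commutator s) => /cyc_pair[k [wk k0 d0]];
  have wz := word_pairM wk wu.
all: have cm0 : sl2_c (k * m) <> 0%R
  by rewrite /= k0 mul0r add0r => /eqP; rewrite mulf_eq0 => /orP[] /eqP.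
  exact: Alternating1 wz cm0.
by rewrite mulgA; exact: AlternatingS wz cm0 alt.
Qed.

Definition normal_form (u : G) := cyc c u \/ exists s, alternating_prod s u.

Lemma normal_form_letter s l u : normal_form u ->
  normal_form (letter_val (side_a s) (side_b s) l * u).
Proof.
set x := letter_val _ _ l; have wx : wp s x (letter_mx l) by exact: letter_pair.
have x0 : sl2_c (letter_mx l) <> 0%R by case: (l) => [[] []].
have cons v m : wp s v m -> forall w, alternating_prod (~~ s) w -> normal_form (v * w).
  move=> wv w aw; case: (sl2_c m =P 0%R) => [m0|m0].
    by right; exists (~~ s); apply: alternating_cyc aw; exact: (side_cusp wv m0).
  by right; exists s; exact: (AlternatingS wv m0 aw).
have single v m : wp s v m -> normal_form v.
  move=> wv; case: (sl2_c m =P 0%R) => [m0|m0]; first by left; exact: (side_cusp wv m0).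
  by right; exists s; exact: (Alternating1 wv m0).
case=> [cu|[s' alt]].
  have := cu; rewrite -(side_commutator s) => /cyc_pair[k [wk _ _]].
  exact: single (word_pairM wx wk).
have [sE|ns] := eqVneq s' s; last first.
  have nE : s' = ~~ s by move: ns; case: (s); case: (s').
  by apply: cons wx _ _; rewrite -nE.
case: alt sE => {s'} [s' v m wv _|s' v m w wv _ alt] sE; rewrite sE in wv *.
  exact: single (word_pairM wx wv).
by rewrite mulgA; apply: cons (word_pairM wx wv) _ _; rewrite -sE.
Qed.

Lemma normal_formP u : normal_form u.
Proof.
(* Both [u] and its inverse are carried along, which makes the property closed under inversion. *)
pose P u := (forall v, normal_form v -> normal_form (u * v)) /\
            (forall v, normal_form v -> normal_form (u^-1 * v)).
suff [+ _] : P u by move/(_ 1); rewrite mulg1; apply; left; exact: cyc1.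
move: u; apply: (presentation_gen presG).
- by split=> v; rewrite ?invg1 mul1g.
- move=> u v [u1 u2] [v1 v2]; split=> w nw; rewrite ?invgM -mulgA; auto.
- by move=> u [u1 u2]; split=> // v; rewrite invgK; exact: u1.
move=> [|[|//]] _; split; split=> v.
- exact: (@normal_form_letter false (false, false)).
- exact: (@normal_form_letter false (false, true)).
- exact: (@normal_form_letter false (true, false)).
- exact: (@normal_form_letter false (true, true)).
- exact: (@normal_form_letter true (true, false)).
- exact: (@normal_form_letter true (true, true)).
- exact: (@normal_form_letter true (false, false)).
- exact: (@normal_form_letter true (false, true)).
Qed.

End Amalgam.

(** * The twisted representation *)

Section Representation.
Local Open Scope ring_scope.
Context {G : groupType} (X Y : nat -> G).
Context (presG : surface_presentation 2 X Y).

Local Notation sl2Zt := (sl2 {poly int}).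
Let emb : sl2 int -> sl2Zt := sl2_map polyC.
Let side_a (s : bool) : G := if s then Y 1%N else X 0%N.
Let side_b (s : bool) : G := if s then X 1%N else Y 0%N.
Let tw (s : bool) : sl2Zt := if s then sl2_U 'X else 1%g.

(** In matrix terms, [sl2_U 'X] commutes with [sl2_C]; the exchange of generators in the second
    handle makes the two commutators inverse to each other. *)
Lemma twist_rel :
  commutator_prod
    (fun k => if k is 0 then sl2_X {poly int} else tw true * sl2_Y _ * (tw true)^-1)%g
    (fun k => if k is 0 then sl2_Y {poly int} else tw true * sl2_X _ * (tw true)^-1)%g
    2 = 1%g.
Proof.
rewrite /= mulg1 /commutator_of.
by apply: sl2P => /=; ring.
Qed.

Section Injectivity.
Context (rho : G -> sl2Zt).
Context (rhoM : {morph rho : u v / (u * v)%g}).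
Context (rho_a : forall s, rho (side_a s) = (tw s * emb (sl2_X int) * (tw s)^-1)%g).
Context (rho_b : forall s, rho (side_b s) = (tw s * emb (sl2_Y int) * (tw s)^-1)%g).

Lemma rho_word s u m : word_pair (side_a s) (side_b s) u m ->
  rho u = (tw s * emb m * (tw s)^-1)%g.
Proof.
have embM : {morph emb : k l / (k * l)%g} by exact: sl2_mapM.
elim=> [|l {}u {}m _ IH].
  by rewrite (morph1g rhoM) (morph1g embM) mulg1 mulgV.
suff E : rho (letter_val (side_a s) (side_b s) l) =
    (tw s * emb (letter_mx l) * (tw s)^-1)%g.
  by rewrite rhoM IH E embM !mulgA mulgVK.
case: l => [[] []]; rewrite /letter_val /letter_mx /= ?(morphVg rhoM) ?(morphVg embM)
  ?rho_a ?rho_b // !invgM !invgK !mulgA //.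
Qed.

(** The term [e * Q] is alone of top degree in [P + e * Q], and multiplication by the nonzero
    integer [c] keeps it so; the column stays dominated by its lower entry. *)
Lemma size_step (e : {poly int}) (P Q : {poly int}) (a b c d : int) :
  e = 'X \/ e = - 'X -> c != 0 -> Q != 0 -> (size P <= size Q)%N ->
  let P' := a%:P * (P + e * Q) + b%:P * Q in
  let Q' := c%:P * (P + e * Q) + d%:P * Q in
  Q' != 0 /\ (size P' <= size Q')%N.
Proof.
move=> eX c0 Q0 PQ P' Q'.
have eQ : size (e * Q) = (size Q).+1.
  by case: eX => ->; rewrite ?mulNr ?size_polyN mulrC size_mulX.
have sV : size (P + e * Q) = (size Q).+1 by rewrite addrC size_polyDl eQ.
have sdQ (k : int) : (size (k%:P * Q)%R <= size Q)%N.
  by rewrite mul_polyC size_scale_leq.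
have sQ' : size Q' = (size Q).+1.
  have scV : size (c%:P * (P + e * Q)) = (size Q).+1.
    by rewrite mul_polyC size_scale.
  by rewrite /Q' size_polyDl ?scV ?ltnS //.
split; first by rewrite -size_poly_gt0 sQ'.
rewrite sQ' (leq_trans (size_polyD _ _)) // geq_max.
by rewrite (leq_trans (sdQ _)) // mul_polyC (leq_trans (size_scale_leq _ _)) ?sV.
Qed.

(* Every passage from one factor to the other multiplies by [sl2_U] of ['X] or
   [- 'X], which raises the degree of the lower left entry by one. *)
Lemma alternating_degree s u : alternating_prod X Y s u ->
  let v := ((tw s)^-1 * rho u)%g in
  sl2_c v != 0 /\ (size (sl2_a v) <= size (sl2_c v))%N.
Proof.
elim=> {s u} [s u m wu m0|s u m w wu m0 alt IH]; cbv zeta.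
  rewrite (rho_word wu) -mulgA mulKg.
  have -> : sl2_a (emb m * (tw s)^-1)%g = (sl2_a m)%:P.
    by case: s {wu}; rewrite /= ?oppr0 ?mulr0 ?mulr1 addr0.
  have -> : sl2_c (emb m * (tw s)^-1)%g = (sl2_c m)%:P.
    by case: s {wu}; rewrite /= ?oppr0 ?mulr0 ?mulr1 addr0.
  have c0 : sl2_c m != 0 by apply/eqP.
  by rewrite polyC_eq0 c0 !size_polyC c0; case: (_ != _).
have [c0 sz] := IH.
pose v := ((tw (~~ s))^-1 * rho w)%g.
pose e : {poly int} := if s then - 'X else 'X.
have E : ((tw s)^-1 * tw (~~ s) = sl2_U e)%g.
  by rewrite /e; case: (s); apply: sl2P => /=; ring.
have -> : ((tw s)^-1 * rho (u * w) = emb m * (sl2_U e * v))%g.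
  by rewrite rhoM (rho_word wu) -E /v !mulgA mulVg mul1g mulgK.
have := @size_step e (sl2_a v) (sl2_c v) (sl2_a m) (sl2_b m) (sl2_c m) (sl2_d m) _ _ c0 sz.
rewrite /= !mul1r !mul0r !add0r; apply; last by apply/eqP.
by rewrite /e; case: (s); [right|left].
Qed.

Lemma rho_injective : injective rho.
Proof.
suff ker u : rho u = 1%g -> u = 1%g.
  move=> u v uv; apply: (mulIg v^-1%g); rewrite mulgV; apply: ker.
  by rewrite rhoM (morphVg rhoM) uv mulgV.
move=> ru; case: (normal_formP presG u) => [cu|[s alt]]; last first.
  have [c0 _] := alternating_degree alt; case/eqP: c0; rewrite ru mulg1.
  by case: (s); rewrite /= ?oppr0.
have rc : rho (commutator_of (X 0%N) (Y 0%N)) = sl2_C {poly int}.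
  have rX := rho_a false; have rY := rho_b false.
  rewrite /side_a /side_b /tw /= in rX rY.
  rewrite /commutator_of !rhoM !(morphVg rhoM) rX rY -sl2_commutator.
  by rewrite /emb sl2_mapX sl2_mapY !mul1g invg1 !mulg1.
(* For the powers of [c] the exponent is visible in the upper right entry. *)
have rcX n : sl2_c (sl2_C {poly int} ^+ n)%g = 0 /\
    sl2_a (sl2_C {poly int} ^+ n)%g = (-1) ^+ n /\
    sl2_b (sl2_C {poly int} ^+ n)%g = - (6 * n)%:R * (-1) ^+ n.
  elim: n => [|n [IHc [IHa IHb]]]; first by rewrite expg0 /= muln0 oppr0 mul0r.
  rewrite expgSr /= IHc IHa IHb exprSr.
  split; first by ring.
  split; first by ring.
  by rewrite mulnS natrD; ring.
case: cu ru => n [m ->]; rewrite rhoM (morphVg rhoM) !(morphXg rhoM) rc => E.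
have {}E : (sl2_C {poly int} ^+ m = sl2_C {poly int} ^+ n)%g.
  by apply: (mulgI (sl2_C {poly int} ^+ n)^-1%g); rewrite E mulVg.
have [_ [am bm]] := rcX m; have [_ [an bn]] := rcX n.
have anm : (-1) ^+ m = (-1) ^+ n :> {poly int} by rewrite -am -an E.
have : - (6 * m)%:R * (-1) ^+ n = - (6 * n)%:R * (-1) ^+ n :> {poly int}.
  by rewrite -bn -anm -bm E.
move=> /(mulIf (expf_neq0 _ _)) => /(_ _)/oppr_inj H.
have {}H : (6 * m)%:R = (6 * n)%:R :> {poly int} by apply: H; rewrite oppr_eq0 oner_eq0.
have : (6 * m)%:R = (6 * n)%:R :> int.
  by apply: (@polyC_inj int); rewrite !polyCMn.
move=> /eqP; rewrite eqr_nat eqn_mul2l /= => /eqP ->; by rewrite mulVg.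
Qed.

End Injectivity.

Lemma surface2_linear : exists2 rho : G -> sl2Zt,
  {morph rho : u v / (u * v)%g} & injective rho.
Proof.
have [rho rhoM rhoXY] := presentation_univ presG twist_rel.
exists rho => //; apply: (rho_injective rhoM) => -[].
- by rewrite (rhoXY 1%N isT).2 /emb sl2_mapX.
- by rewrite (rhoXY 0%N isT).1 /emb sl2_mapX mul1g invg1 mulg1.
- by rewrite (rhoXY 1%N isT).1 /emb sl2_mapY.
- by rewrite (rhoXY 0%N isT).2 /emb sl2_mapY mul1g invg1 mulg1.
Qed.

End Representation.

(** * Prime moduli and finite quotients *)

Section Primes.

Lemma prod_prime_dvd (m n c : nat) :
  (forall p, m <= p < n -> prime p -> p %| c) ->
  \prod_(m <= p < n | prime p) p %| c.
Proof.
elim: n => [|n IHn] dvd_c; first by rewrite big_geq.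
have [mn|nm] := leqP m n; last by rewrite big_geq.
rewrite big_mkcond big_nat_recr //= -big_mkcond /=.
have dn : \prod_(m <= p < n | prime p) p %| c.
  by apply: IHn => p /andP[mp pn]; apply: dvd_c; rewrite mp ltnW.
case: ifP => [pn|_]; last by rewrite muln1.
rewrite Gauss_dvd ?dn ?dvd_c ?mn //=.
rewrite coprime_sym big_nat_cond; apply: (big_ind (fun x => coprime n x)) => [|x y cx cy|p].
- exact: coprimen1.
- by rewrite coprimeMr cx.
move=> /andP[/andP[_ pltn] pp]; rewrite prime_coprime // dvdn_prime2 //.
by rewrite gtn_eqF.
Qed.

Lemma prime_dvd_fact p n : prime p -> p %| n`! -> p <= n.
Proof.
move=> pp; elim: n => [|n IHn]; first by rewrite fact0 dvdn1 => /eqP p1; rewrite p1 in pp.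
rewrite factS Euclid_dvdM // => /orP[/dvdn_leq -> //|/IHn/leqW].
by [].
Qed.

Lemma sum_bin n : \sum_(i < n.+1) 'C(n, i) = 2 ^ n.
Proof.
rewrite -[2]/(1 + 1) expnDn; apply: eq_bigr => i _.
by rewrite !exp1n !muln1.
Qed.

(** The two middle coefficients of an odd row are equal, and together at most the sum of the row. *)
Lemma bin_mid_odd j : 'C(j.*2.+1, j) <= 4 ^ j.
Proof.
rewrite -(@leq_pmul2l 2) // -[4]/(2 ^ 2) -expnM -expnS mul2n mulnC muln2.
rewrite -sum_bin -addnn.
have jn : j < j.*2.+2 by rewrite ltnS leqW // -addnn leq_addr.
have jn1 : j.+1 < j.*2.+2 by rewrite !ltnS -addnn leq_addr.
rewrite (bigD1 (Ordinal jn)) //= (bigD1 (Ordinal jn1)) /=; last first.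
  by rewrite -val_eqE /= gtn_eqF.
rewrite addnA; apply: leq_trans (leq_addr _ _).
rewrite leq_add2l -(@bin_sub j.*2.+1 j.+1) ?ltnS -?addnn ?leq_addr //.
by rewrite subSS addnK.
Qed.

(** For odd [n = j.*2.+1] the primes above [j.+1] all divide ['C(n, j)], which is at most [4 ^ j];
    an even [n] above 2 adds no prime. *)
Lemma primorial_le n : \prod_(0 <= p < n.+1 | prime p) p <= 4 ^ n.
Proof.
elim/ltn_ind: n => n IHn.
have [n2|n2] := leqP n 2.
  by case: n n2 {IHn} => [|[|[|//]]] _; rewrite !big_mkcond unlock.
have [odd_n|even_n] := boolP (odd n); last first.
  have np : ~~ prime n by
    by apply/negP => /even_prime[nE|]; [rewrite nE in n2|exact/negP].
  case: n n2 np even_n IHn => [//|n] n2 np _ IHn.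
  rewrite big_mkcond big_nat_recr //= (negbTE np) muln1 -big_mkcond /=.
  by apply: leq_trans (IHn n _) _; rewrite // leq_exp2l.
pose j := n./2; have nE : n = j.*2.+1 by rewrite -[LHS]odd_double_half odd_n.
have j0 : 0 < j by rewrite /j; case: (n) n2 => [|[|[|]]].
have jn : j.+1 < n by rewrite nE ltnS -addnn -addn1 leq_add2l.
rewrite (@big_cat_nat _ _ _ j.+2) ?ltnS //=; last exact: ltnW.
have -> : 4 ^ n = 4 ^ j.+1 * 4 ^ j.
  by rewrite -expnD nE -addnn addSn.
apply: leq_mul; first exact: IHn.
apply: leq_trans (bin_mid_odd j); apply: dvdn_leq.
  by rewrite bin_gt0 -addnn leqW // leq_addr.
apply: prod_prime_dvd => p /andP[jp pn] pp.
have bf := @bin_fact j.*2.+1 j (leqW _).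
have := dvdn_fact (_ : 0 < p <= n); rewrite prime_gt0 // -ltnS pn => /(_ isT).
rewrite nE -bf; last by rewrite -addnn leq_addr.
rewrite !Euclid_dvdM // => /orP[//|/orP[]] /(prime_dvd_fact pp); first by lia.
by rewrite subSn -?addnn ?leq_addr // addnK; lia.
Qed.

(** Legendre's formula: the power [p ^ k] contributes [m.*2 %/ p ^ k - 2 * (m %/ p ^ k)], which is
    at most 1, and 0 once [p ^ k] exceeds [m.*2]. The maximum with 1 covers [m = 0]. *)
Lemma prime_pow_bin p m : prime p -> p ^ logn p 'C(m.*2, m) <= maxn 1 m.*2.
Proof.
move=> pp; have p1 := prime_gt1 pp; move: m => n.
have [->|n_gt0] := posnP n; first by rewrite bin0 logn1.
have n0 : 0 < n.*2 by rewrite double_gt0.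
rewrite (maxn_idPr n0).
have mn : n <= n.*2 by rewrite -addnn leq_addr.
apply: leq_trans (trunc_logP p1 n0); rewrite leq_exp2l //.
set t := trunc_log p n.*2.
have nn : n.*2 - n = n by rewrite -addnn addnK.
have E : logn p 'C(n.*2, n) + (logn p n`! + logn p n`!) = logn p (n.*2)`!.
  by rewrite -(bin_fact mn) nn !lognM ?muln_gt0 ?fact_gt0 // bin_gt0.
rewrite !logn_fact // in E.
have cut N M : N <= M -> \sum_(1 <= k < M.+1) N %/ p ^ k =
    \sum_(1 <= k < N.+1) N %/ p ^ k.
  move=> NM; rewrite (@big_cat_nat _ _ _ N.+1) //= [X in _ + X]big_nat_cond.
  rewrite [X in _ + X]big1 ?addn0 // => k /andP[/andP[Nk _] _].
  by apply: divn_small; apply: leq_trans Nk _; exact/ltnW/ltn_expl.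
have : logn p 'C(n.*2, n) + 2 * \sum_(1 <= k < n.*2.+1) n %/ p ^ k =
    \sum_(1 <= k < n.*2.+1) n.*2 %/ p ^ k.
  by rewrite -E (cut n n.*2) // mulSn mul1n.
have tn : t <= n.*2.
  by rewrite -ltnS; apply: leq_trans (ltn_expl t p1) _; exact/leqW/trunc_logP.
suff : \sum_(1 <= k < n.*2.+1) n.*2 %/ p ^ k <=
    2 * \sum_(1 <= k < n.*2.+1) n %/ p ^ k + t by lia.
have -> : t = \sum_(1 <= k < n.*2.+1) (k <= t).
  rewrite (@big_cat_nat _ _ _ t.+1) //= [X in _ + X]big_nat_cond.
  rewrite [X in _ + X]big1 ?addn0; last first.
    by move=> k /andP[/andP[tk _] _]; rewrite leqNgt tk.
  rewrite big_nat_cond (eq_bigr (fun=> 1)); last by move=> k /andP[/andP[_]]; rewrite ltnS => ->.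
  by rewrite -big_nat_cond sum_nat_const_nat muln1 subn1.
rewrite big_distrr -big_split /=; apply: leq_sum => k _.
have pk : 0 < p ^ k by rewrite expn_gt0 ltnW.
have [kt|tk] := leqP k t.
  have := divn_eq n (p ^ k); have := ltn_pmod n pk.
  have := divn_eq n.*2 (p ^ k); have := ltn_pmod n.*2 pk.
  move: (n.*2 %/ p ^ k) (n.*2 %% p ^ k) (n %/ p ^ k) (n %% p ^ k) => a b c d.
  move: (p ^ k) => e ? ? ? ?.
  rewrite /= addn1 -ltnS; nia.
rewrite divn_small //; apply: leq_trans (trunc_log_ltn n.*2 p1) _.
by rewrite leq_exp2l.
Qed.

Lemma bin_mid_ge m : 2 ^ m <= 'C(m.*2, m).
Proof.
elim: m => [//|m IHm]; rewrite doubleS expnS mul2n -addnn binS.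
apply: leq_add; last by apply: leq_trans IHm _; exact: leq_bin2l.
by rewrite binS (leq_trans IHm) // leq_addl.
Qed.

(** By [prime_pow_bin] a prime up to [r] contributes at most [m.*2], while a prime above [r] occurs
    at most once since its square exceeds [m.*2]. *)
Lemma bin_mid_le m r B : 0 < m -> m.*2 < r.+1 ^ 2 -> r <= m.*2 -> B <= m.*2 ->
  'C(m.*2, m) <= m.*2 ^ r.+1 * \prod_(0 <= p < B.+1 | prime p) p *
                 \prod_(B.+1 <= p < m.*2.+1 | prime p) p.
Proof.
move=> m0 rN rleN BN; set N := m.*2 in rN rleN BN *.
have N0 : 0 < N by rewrite double_gt0.
set b := 'C(N, m).
have b0 : 0 < b by rewrite bin_gt0 /N -addnn leq_addr.
have -> : b = \prod_(0 <= p < N.+1) p ^ logn p b.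
  rewrite -[LHS]partnT // (widen_partn _ (leq_addr N b)).
  rewrite (@big_cat_nat _ _ _ N.+1) //= ?ltnS ?leq_addl //.
  rewrite [X in _ * X]big_nat_cond [X in _ * X]big1 ?muln1 // => p /andP[/andP[Np _] _].
  have [pp|np] := boolP (prime p); last by rewrite lognE (negbTE np).
  have [pb|npb] := boolP (p %| b); last by rewrite logn_coprime // prime_coprime.
  have mN : m <= N by rewrite /N -addnn leq_addr.
  suff : p <= N by rewrite leqNgt Np.
  by apply: (prime_dvd_fact pp); rewrite -(bin_fact mN); exact: dvdn_mulr.
(* [f1] charges [N] for every number up to [r], prime or not, whence the exponent [r.+1]. *)
pose f1 p := if p <= r then N else 1.
pose f2 p := if prime p && (p <= B) then p else 1.
pose f3 p := if prime p && (B < p) then p else 1.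
apply: (@leq_trans (\prod_(0 <= p < N.+1) (f1 p * f2 p * f3 p))).
  apply: leq_prod => p _; rewrite /f1 /f2 /f3.
  have [pp|np] := boolP (prime p); last first.
    by rewrite lognE (negbTE np) /= !muln1; case: ifP.
  have pN := prime_pow_bin m pp; rewrite -/N -/b (maxn_idPr N0) in pN.
  have [pr|rp] := leqP p r; rewrite /=.
    apply: leq_trans pN _; rewrite -mulnA leq_pmulr // muln_gt0.
    by have p0 := prime_gt0 pp; case: (p <= B); case: (B < p); rewrite ?p0.
  have l1 : logn p b <= 1.
    rewrite leqNgt; apply/negP => l2.
    have : r.+1 ^ 2 <= N.
      apply: leq_trans pN; apply: (@leq_trans (p ^ 2)); first by rewrite leq_exp2r.
      by rewrite leq_exp2l // prime_gt1.
    by rewrite leqNgt rN.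
  have pl : p ^ logn p b <= p.
    by rewrite -{3}[p]expn1 leq_exp2l // prime_gt1.
  by case: leqP; rewrite !mul1n ?muln1.
rewrite !big_split /=; apply: leq_mul; first apply: leq_mul.
- rewrite (@big_cat_nat _ _ _ r.+1) //= [X in _ * X]big_nat_cond.
  rewrite [X in _ * X]big1 ?muln1; last first.
    by move=> p /andP[/andP[rp _] _]; rewrite /f1 leqNgt rp.
  rewrite big_nat_cond (eq_bigr (fun=> N)); last first.
    by move=> p /andP[/andP[_]]; rewrite ltnS /f1 => ->.
  by rewrite -big_nat_cond prod_nat_const_nat subn0.
- rewrite (@big_cat_nat _ _ _ B.+1) //= [X in _ * X]big_nat_cond.
  rewrite [X in _ * X]big1 ?muln1; last first.
    by move=> p /andP[/andP[Bp _] _]; rewrite /f2 leqNgt Bp andbF.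
  rewrite [leqRHS]big_mkcond big_nat [leqRHS]big_nat; apply: leq_prod => p /andP[_].
  by rewrite ltnS /f2 => ->; rewrite andbT.
rewrite (@big_cat_nat _ _ _ B.+1) //= [X in X * _]big_nat_cond.
rewrite [X in X * _]big1 ?mul1n; last first.
  by move=> p /andP[/andP[_ pB] _]; rewrite /f3 ltnNge -ltnS pB andbF.
rewrite [leqRHS]big_mkcond big_nat [leqRHS]big_nat; apply: leq_prod => p /andP[Bp _].
by rewrite /f3 Bp andbT.
Qed.

(* Otherwise all the primes between [K * n] and [N = m.*2] divide [c], and the
   central binomial coefficient of [N], which is at least [2 ^ m], is at most
   [N ^ (sqrt N + 1) * 4 ^ (K * n) * c]. *)
Lemma good_prime (K n c : nat) : 0 < K -> 0 < n -> 0 < c -> c <= K ^ n ->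
  exists p, [/\ prime p, K * n < p <= 12 * 4 ^ 7 * K * n & ~~ (p %| c)].
Proof.
move=> K0 n0 c0 cK; pose D := 12 * K * n.
have D0 : 0 < D by rewrite !muln_gt0 K0.
(* [N] is chosen as a power of 4, so that its square root is the integer [2 ^ k]. It lies between
   [4 ^ 6 * D] and [4 ^ 7 * D], which is the origin of the constant [12 * 4 ^ 7]. *)
set t := trunc_log 4 D; have /andP[tD Dt] := @trunc_log_bounds 4 D isT D0.
rewrite -/t in tD Dt.
pose k := t + 7; pose m := 2 * 4 ^ (t + 6).
have mE : m.*2 = 4 ^ k.
  rewrite /m /k (_ : t + 7 = (t + 6).+1); last by lia.
  by rewrite expnS; move: (4 ^ _) => y; lia.
have rE : (2 ^ k) ^ 2 = 4 ^ k by rewrite -expnM mulnC expnM.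
have NC : m.*2 <= 12 * 4 ^ 7 * K * n.
  rewrite mE /k expnD; apply: leq_trans (leq_mul tD (leqnn _)) _.
  by rewrite /D (mulnAC _ n) (mulnAC 12 K).
have DN : D * 4 ^ 6 < m.*2.
  rewrite mE /k (_ : t + 7 = t.+1 + 6); last by lia.
  by rewrite expnD ltn_mul2r Dt expn_gt0.
pose B := K * n.
have BD : D = 12 * B by rewrite /D -mulnA.
have BN : B <= m.*2.
  apply: ltnW; apply: leq_ltn_trans DN.
  by rewrite BD mulnAC leq_pmull.
case: (pselect (exists p, [/\ prime p, B < p <= m.*2 & ~~ (p %| c)])).
  by move=> [p [pp /andP[Bp pm] pc]]; exists p; rewrite pp Bp (leq_trans pm).
move=> none; exfalso.
have dvdc : \prod_(B.+1 <= p < m.*2.+1 | prime p) p %| c.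
  apply: prod_prime_dvd => p Bp pp; apply: contrapT => /negP pc.
  by apply: none; exists p; rewrite pp.
have m0 : 0 < m by rewrite muln_gt0 expn_gt0.
have r1 : m.*2 < (2 ^ k).+1 ^ 2 by rewrite mE -rE ltn_exp2r.
have r2 : 2 ^ k <= m.*2 by rewrite mE leq_exp2r // addn_gt0 orbT.
have := bin_mid_le m0 r1 r2 BN; apply/negP; rewrite -ltnNge.
apply: leq_trans (bin_mid_ge m).
have c2 : c <= 2 ^ B.
  apply: leq_trans cK _; rewrite /B expnM leq_exp2r //.
  exact/ltnW/ltn_expl.
apply: (@leq_ltn_trans (m.*2 ^ (2 ^ k).+1 * 4 ^ B * 2 ^ B)).
  apply: leq_mul; first by apply: leq_mul => //; exact: primorial_le.
  exact: leq_trans (dvdn_leq c0 dvdc) c2.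
(* What remains is a comparison of exponents of 2, namely [2 k (2 ^ k + 1) + 3 B < m] with
   [2 m = 4 ^ k]; it needs [16 k <= 2 ^ k], true from [k = 7] on. *)
rewrite mE -[4]/(2 ^ 2) -!expnM -!expnD ltn_exp2l //.
have k16 : 16 * k <= 2 ^ k.
  rewrite /k; elim: (t) => [//|u IHu].
  by rewrite addSn expnS; move: IHu; move: (2 ^ _) => y; lia.
have kk : 2 ^ k * 2 ^ k = 2 * m by rewrite mulnn rE -mE mul2n.
have B24 : 12 * B * 4 ^ 6 < 2 * m by rewrite -BD mul2n.
have k7 : 128 <= 2 ^ k by rewrite /k expnD leq_pmull // expn_gt0.
move: (2 ^ k) k16 kk k7 => r k16 kk k7.
have : 16 * k * r <= r * r by rewrite leq_mul2r k16 orbT.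
have : k <= k * r by rewrite leq_pmulr //; lia.
rewrite mulnS (mulnC k r) in kk *; lia.
Qed.

End Primes.

(** * Growth of matrix entries along words *)

Section Growth.
Local Open Scope ring_scope.

(** A dominating polynomial controls the degree and the coefficients together and is compatible with
    products. *)
Definition coef_dom (P Q : {poly int}) := forall i, `|P`_i| <= Q`_i.

Lemma coef_domM P Q P' Q' :
  coef_dom P Q -> coef_dom P' Q' -> coef_dom (P * P') (Q * Q').
Proof.
move=> PQ PQ' i; rewrite !coefM; apply: le_trans (ler_norm_sum _ _ _) _.
by apply: ler_sum => j _; rewrite normrM ler_pM.
Qed.

Lemma coef_domD P Q P' Q' :
  coef_dom P Q -> coef_dom P' Q' -> coef_dom (P + P') (Q + Q').
Proof.
move=> PQ PQ' i; rewrite !coefD; apply: le_trans (ler_normD _ _) _.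
exact: lerD.
Qed.

Definition entry_dom (s : sl2 {poly int}) (Q : {poly int}) :=
  [/\ coef_dom (sl2_a s) Q, coef_dom (sl2_b s) Q, coef_dom (sl2_c s) Q
    & coef_dom (sl2_d s) Q].

Lemma entry_domM s t Q Q' : entry_dom s Q -> entry_dom t Q' ->
  entry_dom (s * t)%g ((Q *+ 2) * Q').
Proof.
move=> [sa sb sc sd] [ta tb tc td]; rewrite mulr2n mulrDl.
by split; apply: coef_domD; apply: coef_domM.
Qed.

Lemma entry_dom1 : entry_dom 1%g 1.
Proof.
by split=> i; rewrite /= ?coef0 ?coefC; case: eqP => _; rewrite ?normr1 ?normr0.
Qed.

Lemma le_sum4 (a b c d : int) : 0 <= a -> 0 <= b -> 0 <= c -> 0 <= d ->
  [/\ a <= a + b + c + d, b <= a + b + c + d, c <= a + b + c + d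
    & d <= a + b + c + d].
Proof. by split; lia. Qed.

Lemma entry_dom_exists s : exists Q, entry_dom s Q /\ entry_dom s^-1%g Q.
Proof.
pose ab (P : {poly int}) := \poly_(i < size P) `|P`_i|.
have abE P i : (ab P)`_i = `|P`_i|.
  rewrite coef_poly; case: ltnP => // sP; rewrite nth_default // normr0.
exists (ab (sl2_a s) + ab (sl2_b s) + ab (sl2_c s) + ab (sl2_d s)).
have le4 i := le_sum4 (normr_ge0 (sl2_a s)`_i) (normr_ge0 (sl2_b s)`_i)
  (normr_ge0 (sl2_c s)`_i) (normr_ge0 (sl2_d s)`_i).
by split; split=> i; rewrite /= ?coefN ?normrN !coefD !abE; case: (le4 i).
Qed.

(** One [Q] dominates all generators and their inverses; an entry of a product is a sum of two
    products, so each letter costs a factor [Q *+ 2]. *)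
Lemma word_dom (G : groupType) (rho : G -> sl2 {poly int}) (S : seq G) :
  {morph rho : u v / (u * v)%g} ->
  exists Q : {poly int}, forall s w, word_over S s -> represents s w ->
    entry_dom (rho w) ((Q *+ 2) ^+ size s).
Proof.
move=> rhoM.
have [Q QS] : exists Q, forall y, (y \in S) || (y^-1%g \in S) -> entry_dom (rho y) Q.
  elim: S => [|z S [Q IH]]; first by exists 0 => y; rewrite !in_nil.
  have [Q' [Q1 Q2]] := entry_dom_exists (rho z).
  have Q'0 i : 0 <= Q'`_i by case: Q1 => + _ _ _ => /(_ i); exact: le_trans.
  exists (Q' + \poly_(i < size Q) `|Q`_i|) => y.
  have QE i : (\poly_(i < size Q) `|Q`_i|)`_i = `|Q`_i|.
    by rewrite coef_poly; case: ltnP => // sQ; rewrite nth_default // normr0.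
  have w1 t : entry_dom t Q' -> entry_dom t (Q' + \poly_(i < size Q) `|Q`_i|).
    move=> [ta tb tc td]; split=> i; rewrite coefD QE ler_wpDr //.
  have w2 t : entry_dom t Q -> entry_dom t (Q' + \poly_(i < size Q) `|Q`_i|).
    move=> [ta tb tc td]; split=> i; rewrite coefD QE ler_wpDl //;
      by apply: le_trans (ler_norm _).
  rewrite !inE => /orP[/orP[/eqP ->|yS]|/orP[/eqP yz|yS]].
  - exact: w1.
  - by apply/w2/IH; rewrite yS.
  - by rewrite -[y]invgK yz (morphVg rhoM); apply: w1.
  - by apply/w2/IH; rewrite yS orbT.
exists Q => s; rewrite /represents; elim: s => [|y s IH] w /=.
  by rewrite big_nil expr0 => _ <-; rewrite (morph1g rhoM); exact: entry_dom1.
rewrite /word_over /= big_cons => /andP[yS sS] <-.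
by rewrite rhoM exprS; apply: entry_domM; [exact: QS|exact: IH].
Qed.

Lemma coef_le_horner1 (Q : {poly int}) i : (forall j, 0 <= Q`_j) -> Q`_i <= Q.[1].
Proof.
move=> Q0; have [iQ|Qi] := ltnP i (size Q); last first.
  rewrite nth_default // horner_coef; apply: sumr_ge0 => j _.
  by rewrite expr1n mulr1.
rewrite horner_coef (bigD1 (Ordinal iQ)) //= expr1n mulr1 lerDl.
by apply: sumr_ge0 => j _; rewrite expr1n mulr1.
Qed.

Definition sl2_height (s : sl2 {poly int}) (D M : nat) :=
  forall P, P \in [:: sl2_a s - 1; sl2_b s; sl2_c s; sl2_d s - 1] ->
    (size P <= D)%N /\ forall i, `|P`_i| <= M%:R.

(* Both the degrees and the logarithms of the coefficients of the entries grow
   at most linearly with the length of the word. *)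
Lemma word_height (G : groupType) (rho : G -> sl2 {poly int}) (S : seq G) :
  {morph rho : u v / (u * v)%g} ->
  exists2 K : nat, (0 < K)%N & forall s w n, word_over S s -> size s = n ->
    represents s w -> (0 < n)%N -> sl2_height (rho w) (K * n) (K ^ n).
Proof.
move=> rhoM; have [Q QP] := word_dom S rhoM.
(* The value at 1 bounds the coefficients of the [n]-th power by [q ^ n], and [size] takes care of
   the degree. The additional 1 pays for subtracting the identity. *)
pose q := `|(Q *+ 2).[1]|%N; exists (size (Q *+ 2) + q.+1)%N; first by rewrite addnS.
move=> s w n sS sn sw n0; have := QP s w sS sw; rewrite sn.
set V := Q *+ 2; move=> dm.
have V0 j : 0 <= (V ^+ n)`_j by case: dm => + _ _ _ => /(_ j); exact: le_trans.
have Vc j : (V ^+ n)`_j <= (q ^ n)%:R.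
  apply: le_trans (coef_le_horner1 j V0) _.
  rewrite horner_exp natrX; apply: le_trans (ler_norm _) _.
  by rewrite normrX /q natz abszE.
have Vs : (size (V ^+ n) <= (size V).-1 * n + 1)%N.
  by rewrite addn1; exact: size_poly_exp_leq.
have qn : (q ^ n + 1 <= (size V + q.+1) ^ n)%N.
  apply: (@leq_trans (q.+1 ^ n)); last by rewrite leq_exp2r // leq_addl.
  by rewrite addn1 ltn_exp2r.
have sn' : ((size V).-1 * n + 1 <= (size V + q.+1) * n)%N.
  by case: n n0 {sn dm V0 Vc Vs qn} => // n _; case: (size V) => [|k] /=; nia.
have main (P C : {poly int}) : coef_dom P (V ^+ n) -> coef_dom C 1 ->
    (size (P - C)%R <= (size V + q.+1) * n)%N /\
    forall i, `|(P - C)`_i| <= ((size V + q.+1) ^ n)%:R.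
  move=> PV C1; split.
    apply/leq_sizeP => j sj; rewrite coefB.
    have Vj : (V ^+ n)`_j = 0.
      by apply: nth_default; apply: leq_trans Vs _; exact: leq_trans sn' sj.
    have j0 : j != 0%N.
      by rewrite -lt0n (leq_trans _ sj) // muln_gt0 addnS.
    have Pj : P`_j = 0 by apply/eqP; rewrite -normr_le0; have := PV j; rewrite Vj.
    have Cj : C`_j = 0.
      by apply/eqP; rewrite -normr_le0; have := C1 j; rewrite coefC (negbTE j0).
    by rewrite Pj Cj subr0.
  move=> i; rewrite coefB; apply: le_trans (ler_normB _ _) _.
  apply: (@le_trans _ _ ((q ^ n + 1)%:R)); last by rewrite ler_nat.
  rewrite natrD; apply: lerD; first exact: le_trans (PV i) (Vc i).
  by apply: le_trans (C1 i) _; rewrite coefC; case: eqP.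
have c0 : coef_dom 0 1 by move=> i; rewrite coef0 normr0 coefC; case: eqP.
have c1 : coef_dom 1 1 by move=> i; rewrite coefC; case: eqP; rewrite ?normr0 ?normr1.
case: dm => da db dc dd P; rewrite !inE => /or4P[] /eqP ->.
- exact: main.
- by rewrite -[sl2_b _]subr0; exact: main.
- by rewrite -[sl2_c _]subr0; exact: main.
- exact: main.
Qed.

End Growth.

(** * Reduction to a prime field *)

Section Reduction.
Local Open Scope ring_scope.

Lemma nonroot_mod_prime (K n : nat) (P : {poly int}) : (0 < K)%N -> (0 < n)%N ->
  P != 0 -> (size P <= K * n)%N -> (forall i, `|P`_i| <= (K ^ n)%:R) ->
  exists p, [/\ prime p, (p <= 12 * 4 ^ 7 * K * n)%N &
    exists t : 'F_p, (map_poly intr P).[t] != 0].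
Proof.
move=> K0 n0 P0 sP cP.
have lP : lead_coef P != 0 by rewrite lead_coef_eq0.
have [||p [pp /andP[Kp pC] pl]] := @good_prime K n `|lead_coef P|%N K0 n0.
- by rewrite absz_gt0.
- by have := cP (size P).-1; rewrite -lead_coefE -abszE natz lez_nat.
exists p; split=> //.
pose Pp : {poly 'F_p} := map_poly intr P.
have Pp0 : Pp != 0.
  apply/eqP => /(congr1 (fun q : {poly _} => q`_(size P).-1)).
  rewrite coef0 coef_map /= -lead_coefE => /eqP.
  apply/negP; apply: contra pl.
  (* The sign of the leading coefficient is dropped, since [good_prime] speaks of a natural
     number. *)
  have -> : (lead_coef P)%:~R == 0 :> 'F_p = (`|lead_coef P|%N%:R == 0 :> 'F_p).
    by case: (lead_coef P) => k //=; rewrite NegzE /= mulrNz oppr_eq0.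
  by rewrite (dvdn_pcharf (pchar_Fp pp)).
have szp : (size Pp <= size P)%N by exact: size_poly.
case: (pselect (exists t : 'F_p, Pp.[t] != 0)) => // none; exfalso.
have roots : all (root Pp) (enum 'F_p).
  apply/allP => t _; apply: contrapT => /negP; rewrite rootE => tP.
  by apply: none; exists t.
have := max_poly_roots Pp0 roots (enum_uniq _).
rewrite -cardE card_Fp // ltnNge; apply/negP; rewrite negbK.
exact: leq_trans szp (leq_trans sP (ltnW Kp)).
Qed.

(* Determinant one gives the last entry in terms of the others if the upper left
   one is nonzero; otherwise it gives [sl2_c] in terms of [sl2_b]. *)
Lemma sl2_code_bound (p : nat) : prime p ->
  exists code : sl2 'F_p -> nat, injective code /\ forall s, (code s < p ^ 3)%N.
Proof.
move=> pp; have ltp (t : 'F_p) : (t < p)%N by rewrite -[X in (_ < X)%N](Fp_cast pp).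
exists (fun s : sl2 'F_p => if sl2_a s == 0%R then sl2_b s * p + sl2_d s * p ^ 2
                 else sl2_a s + sl2_b s * p + sl2_c s * p ^ 2)%N.
have digits (x y z x' y' z' : 'F_p) :
    (x + y * p + z * p ^ 2 = x' + y' * p + z' * p ^ 2)%N ->
    [/\ x = x', y = y' & z = z'].
  have := ltp x; have := ltp y; have := ltp z.
  have := ltp x'; have := ltp y'; have := ltp z'.
  move=> lz' ly' lx' lz ly lx E.
  have p0 : (0 < p)%N by exact: prime_gt0.
  have E1 : (x + (y + z * p) * p = x' + (y' + z' * p) * p)%N.
    by rewrite !mulnDl -!mulnA !addnA.
  have ex : x = x' :> nat.
    by have := congr1 (modn^~ p) E1; rewrite /= ![(_ + _ * p)%N]addnC !modnMDl !modn_small.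
  have E2 : (y + z * p = y' + z' * p)%N.
    by apply/eqP; rewrite -(eqn_pmul2r p0); apply/eqP; move: E1; rewrite ex => /addnI.
  have ey : y = y' :> nat.
    by have := congr1 (modn^~ p) E2; rewrite /= ![(_ + _ * p)%N]addnC !modnMDl !modn_small.
  have E3 : (z * p = z' * p)%N by move: E2; rewrite ey => /addnI.
  have ez : z = z' :> nat by apply/eqP; rewrite -(eqn_pmul2r p0) E3.
  by split; exact: val_inj.
split=> [s t|s].
  have ds := sl2_det s; have dt := sl2_det t.
  have z0 : (0 : 'F_p) = 0%N :> nat by [].
  case: (sl2_a s =P 0) => as0; case: (sl2_a t =P 0) => at0 E.
  - have [_ eb ed] := digits 0 _ _ 0 _ _ E.
    apply: sl2P => //; first by rewrite as0 at0.
    have b0 : sl2_b t != 0.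
      apply/eqP => b0; move: dt; rewrite at0 b0 !mul0r subrr => /eqP.
      by rewrite eq_sym oner_eq0.
    apply: (mulfI b0); apply: oppr_inj; rewrite -{1}eb.
    by move: ds dt; rewrite as0 at0 !mul0r !sub0r => -> ->.
  - have [ea _ _] := digits 0 _ _ _ _ _ E; by case: at0.
  - have [ea _ _] := digits _ _ _ 0 _ _ E; by case: as0.
  have [ea eb ec] := digits _ _ _ _ _ _ E; apply: sl2P => //.
  have a0 : sl2_a t != 0 by apply/eqP.
  apply: (mulfI a0); rewrite -{1}ea.
  by apply: (addIr (- (sl2_b s * sl2_c s))); rewrite ds -dt eb ec.
have p0 : (0 < p)%N by exact: prime_gt0.
have bnd (x y z : 'F_p) : (x + y * p + z * p ^ 2 < p ^ 3)%N.
  have := ltp x; have := ltp y; have := ltp z; rewrite !expnS expn0 muln1.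
  move: (nat_of_ord x) (nat_of_ord y) (nat_of_ord z) => a b c; nia.
by case: eqP => _; [exact: (bnd 0)|exact: bnd].
Qed.

End Reduction.

(** * Kernels of bounded index *)

Section Quotients.

Lemma kernel_normal_subgroup (G H : groupType) (f : G -> H) :
  {morph f : u v / (u * v)%g} -> normal_subgroup [pred y | f y == 1%g].
Proof.
move=> fM; split.
  split; first by rewrite inE (morph1g fM).
  by move=> u v; rewrite !inE => /eqP fu /eqP fv;
    rewrite fM (morphVg fM) fu fv mulgV.
move=> y z; rewrite !inE => /eqP fy.
by rewrite conjgE !fM (morphVg fM) fy mul1g mulVg.
Qed.

Lemma kernel_index (G H : groupType) (f : G -> H) (code : H -> nat) (m : nat) :
  {morph f : u v / (u * v)%g} -> injective code -> (forall h, code h < m) ->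
  index_at_most [pred y | f y == 1%g] m.
Proof.
move=> fM code_inj code_lt; rewrite /index_at_most.
set N := [pred y | f y == 1%g].
(* A coset of the kernel is determined by the code of its image; a code without preimage gets the
   junk coset of 1. *)
pose F k := lcoset_of N (xget 1%g [set y | code (f y) = k])%classic.
have rangeF : (range (lcoset_of N) = F @` (range (code \o f)))%classic.
  have FE y : F (code (f y)) = lcoset_of N y.
    rewrite /F; case: xgetP => [z _ /code_inj fz|/(_ y) []//].
    by apply/funext => v; rewrite /lcoset_of /mkset !inE !fM !(morphVg fM) fz.
  apply/seteqP; split => [_ [y _ <-]|_ [_ [y _ <-] <-]].
    by exists (code (f y)); [exists y|rewrite FE].
  by exists y => //=; rewrite FE.
rewrite rangeF; apply: card_le_trans (card_image_le _ _) _.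
by apply: subset_card_le => k [y _ <-]; exact: code_lt.
Qed.

Lemma linear_separation (G : groupType) (rho : G -> sl2 {poly int})
    (S : seq G) : {morph rho : u v / (u * v)%g} -> injective rho ->
  exists C : nat, forall (w : G) (n : nat), w <> 1%g ->
    (exists s, [/\ word_over S s, size s = n & represents s w]) ->
    exists N : {pred G},
      [/\ normal_subgroup N, index_at_most N (C * n ^ 3) & w \notin N].
Proof.
move=> rhoM rho_inj; have [K K0 rhoK] := word_height S rhoM.
(* The cube of the bound for [p] in [nonroot_mod_prime], as the index is at most [p ^ 3]. *)
exists ((12 * 4 ^ 7 * K) ^ 3) => w n w1 [s [Ss sn sw]].
(* The empty word represents 1. *)
have n0 : 0 < n.
  by case: n s sn sw {Ss} => [|//] [|//] _ /esym; rewrite big_nil.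
have hw := rhoK s w n Ss sn sw n0.
have rw1 : rho w <> 1%g by rewrite -(morph1g rhoM) => /rho_inj.
set entries := fun A (v : sl2 A) =>
  [:: sl2_a v - 1; sl2_b v; sl2_c v; sl2_d v - 1]%R.
have [P Pw P0] : exists2 P : {poly int}, P \in entries _ (rho w) & P != 0%R.
  apply/hasP; apply: contra_notT rw1; rewrite -all_predC => /allP e0.
  have {}e0 P : P \in entries _ (rho w) -> P = 0%R.
    by move=> /e0 /= /negbNE/eqP.
  apply: sl2P => /=.
  - by apply/eqP; rewrite -subr_eq0; apply/eqP/e0; rewrite !inE eqxx.
  - by apply: e0; rewrite !inE eqxx orbT.
  - by apply: e0; rewrite !inE eqxx !orbT.
  - by apply/eqP; rewrite -subr_eq0; apply/eqP/e0; rewrite !inE eqxx !orbT.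
have [sP cP] := hw P Pw.
have [p [pp ple [t Pt]]] := nonroot_mod_prime K0 n0 P0 sP cP.
pose ev : {rmorphism {poly int} -> 'F_p} := horner_eval t \o map_poly intr.
pose sigma y := sl2_map ev (rho y).
have sigmaM : {morph sigma : u v / (u * v)%g}.
  by move=> u v; rewrite /sigma rhoM sl2_mapM.
have [code [code_inj code_lt]] := sl2_code_bound pp.
exists (pred_of_simpl [pred y | sigma y == 1%g]); split.
- exact: kernel_normal_subgroup.
- apply: (kernel_index sigmaM code_inj) => h; apply: leq_trans (code_lt h) _.
  by rewrite -expnMn leq_exp2r.
apply: contra Pt => /= sw1; apply/eqP.
have {}sw1 : sigma w = 1%g by exact/eqP.
change (ev P = 0%R); move: Pw; rewrite !inE.
have ea : ev (sl2_a (rho w)) = 1%R := congr1 (@sl2_a _) sw1.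
have eb : ev (sl2_b (rho w)) = 0%R := congr1 (@sl2_b _) sw1.
have ec : ev (sl2_c (rho w)) = 0%R := congr1 (@sl2_c _) sw1.
have ed : ev (sl2_d (rho w)) = 1%R := congr1 (@sl2_d _) sw1.
by case/or4P => /eqP ->; rewrite ?rmorphB ?rmorph1 ?ea ?eb ?ec ?ed ?subrr.
Qed.

End Quotients.

Theorem theorem6p12 (R : realType) (g : nat) (hg : 2 <= g)
    (x : surface R g) (S : seq (pi1 R x)) (hS : generates S) :
  exists C : nat,
    forall (w : pi1 R x) (n : nat),
      w <> 1%g ->
      (exists s : seq (pi1 R x),
         [/\ word_over S s, size s = n & represents s w]) ->
      exists N : {pred pi1 R x},
        [/\ normal_subgroup N, index_at_most N (C * n ^ 3) & w \notin N].
Proof.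
have [m gE] : exists m, g = m.+2 by exists g.-2; case: g hg {x S hS} => [|[]].
subst g.
(* An arbitrary base point on the surface of genus 2; the presentation holds at every base point. *)
pose x2 := surface_pr 2 (side 2 0 (0%R : R)).
have [f fM f_inj] := surface_cover_embedding (surface_pi1_presentation (ltn0Sn _) x)
  (surface_pi1_presentation (ltn0Sn _) x2).
have [rho rhoM rho_inj] :=
  surface2_linear (surface_pi1_presentation (ltn0Sn _) x2).
apply: (@linear_separation _ (rho \o f)) => [u v /=|]; last exact: inj_comp.
by rewrite fM rhoM.
Qed.
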